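(* Let $n\ge 1$ and $r_0>0$. Then there exist a smooth function $\tilde F:S^1\times\mathbb{R}^{2n}\to\mathbb{R}$ and a compatible complex structure $J\in\mathcal{J}(S^1\times\mathbb{R}^{2n},\xi_0)$ such that through every point $(\theta_0,0,z)\in S^1\times\mathbb{R}^{2(n-1)}\times\mathbb{R}^2$ with $|z|<r_0$ there passes a finite-energy pseudoholomorphic plane for the data $(e^{\tilde F}\lambda_0,J)$ (i.e. the point lies in the image of the $S^1\times\mathbb{R}^{2n}$-component of the map) with limit set equal to the embedded torus $$S^1\times\{0\}\times\{|z|=r_0\}\subset S^1\times\mathbb{R}^{2(n-1)}\times\mathbb{R}^2.$$
   Context: Notation. $S^1=\mathbb{R}/2\pi\mathbb{Z}$. On $S^1\times\mathbb{R}^{2n}$ with coordinates $(\theta,x_1,y_1,\dots,x_n,y_n)$ let $\alpha_n=\sum_{i=1}^n x_i\,dy_i-y_i\,dx_i$, $\lambda_0=d\theta+\alpha_n$ (a contact form), and $\xi_0=\ker\lambda_0$. In the splitting $\mathbb{R}^{2n}=\mathbb{R}^{2(n-1)}\times\mathbb{R}^2$ the last factor has coordinates $z=(x_n,y_n)$. Contact forms. For a contact form $\lambda$ on $M$, with $\xi=\ker\lambda$, the Reeb vector field $X_\lambda$ is defined by $i_{X_\lambda}d\lambda=0$, $i_{X_\lambda}\lambda=1$, and $\pi_\lambda:TM=\mathbb{R}X_\lambda\oplus\xi\to\xi$ is the projection along $X_\lambda$. $\mathcal{J}(M,\xi)$ is the set of $J\in\operatorname{End}(\xi)$ with $J^2=-\mathrm{Id}$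 such that $d\lambda(\cdot,J\cdot)$ is symmetric and positive definite on $\xi$; this set is unchanged when $\lambda$ is replaced by $e^f\lambda$. Pseudoholomorphic maps. Let $(\Sigma,j)$ be a closed Riemann surface, $\Gamma\subset\Sigma$ a finite set (the punctures), and $a:\Sigma\setminus\Gamma\to\mathbb{R}$, $u:\Sigma\setminus\Gamma\to M$ smooth. The map $\tilde u=(a,u)$ is pseudoholomorphic for the data $(\lambda,J)$ if $\pi_\lambda\circ du\circ j=J\circ\pi_\lambda\circ du$ and $u^*\lambda\circ j=da$. Its Hofer energy is $E(u)=\sup_{\varphi\in\Xi}\int_{\Sigma\setminus\Gamma}d(\varphi(a)\,u^*\lambda)$, where $\Xi$ is the set of smooth $\varphi:\mathbb{R}\to[0,1]$ with $\varphi'\ge 0$, $\lim_{s\to-\infty}\varphi(s)=0$, $\lim_{s\to\infty}\varphi(s)=1$; finite-energy means $E(u)<\infty$. A plane is the case of the Riemann sphere with one puncture (domain $\mathbb{C}$). Limit sets. A holomorphic cylindrical coordinate system around $z_0\in\Gamma$ is a holomorphic embedding $\psi:[0,\infty)\times\mathbb{R}/\mathbb{Z}\subset\mathbb{C}/i\mathbb{Z}\to\Sigma\setminus\Gamma$ with $\lim_{s\to\infty}\psi(s,t)=z_0$. The mass of $z_0$ is $m(z_0)=\lim_{s\to\infty}\int_{\mathbb{R}/\mathbb{Z}}(u\circ\psi(s,\cdot))^*\lambda$. The limit set of the map is the collection of all periodic orbits, i.e. smooth loops $\gamma:\mathbb{R}/\mathbb{Z}\to M$ with $\dot\gamma=T\cdot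 X_\lambda\circ\gamma$, $T=m(z_0)\ne0$, obtained at the punctures $z_0$ as $C^\infty$-limits of loops $u\circ\psi(s_k,\cdot)$ for some sequence $s_k\to\infty$. Saying that the limit set equals a subset of $M$ means that the union of the images of these orbits is that subset. *)

(* Defs.v *)
From HB Require Import structures.
From mathcomp Require Import all_boot all_order all_algebra.
From mathcomp Require Import all_classical all_reals all_analysis.

Set Implicit Arguments.
Unset Strict Implicit.
Unset Printing Implicit Defensive.

Import Order.TTheory GRing.Theory Num.Theory.
Import numFieldNormedType.Exports.

Local Open Scope ring_scope.
Local Open Scope classical_set_scope.

(** The manifold M = S^1 x R^2n, S^1 = R/2piZ, is handled through its universal
    cover [ucover R n] = R x (R^n x R^n), with coordinates (theta, (x, y)):
    - functions and tensors on M are the 2pi-periodic ones on the cover;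
    - a subset of M is given by its (2pi-periodic) preimage in the cover;
    - a smooth map from a plane to M is given by a lift to the cover, which
      exists since the plane is simply connected;
    - a loop R/Z -> M is given by a lift gamma : R -> cover such that
      gamma (t + 1) and gamma t differ by a constant deck transformation.
    Tangent spaces of M are identified with the cover itself. *)
Notation ucover R n := (R * ('rV[R]_n * 'rV[R]_n))%type.

(** The plane C with coordinates s + it = (s, t). *)
Notation plane R := (R * R)%type.

Section Smooth.
Context {R : realType} {V W : normedModType R}.

Fixpoint Ck (k : nat) (f : V -> W) : Prop :=
  match k with
  | 0 => continuous f
  | k'.+1 => [/\ continuous f, forall x v, derivable f x v
               & forall v, Ck k' (fun x => 'D_v f x)]
  end.

Definition smooth (f : V -> W) : Prop := forall k, Ck k f.

End Smooth.

Section Forms.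
Context {R : realType} {V : normedModType R}.

(** A 1-form is a function of a point and a vector.  Convention:
    d beta (v, w) = v (beta w) - w (beta v) for constant fields v, w. *)
Definition dform (beta : V -> V -> R) (p v w : V) : R :=
  'D_v (fun q => beta q w) p - 'D_w (fun q => beta q v) p.

Definition pullback {U : normedModType R} (u : U -> V) (beta : V -> V -> R)
    (p v : U) : R := beta (u p) ('D_v u p).

(** [xget 0] returns the element of the set, which is unique when [lam] is a
    contact form. *)
Definition reeb (lam : V -> V -> R) (p : V) : V :=
  xget 0 [set X | (forall w, dform lam p X w = 0) /\ lam p X = 1].

Definition reeb_proj (lam : V -> V -> R) (p v : V) : V :=
  v - lam p v *: reeb lam p.

End Forms.

Section Manifold.
Context {R : realType} {n : nat}.
Local Notation M := (ucover R n).

Definition deck (m : int) : M := (2 * pi * m%:~R, (0, 0)).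

Definition same_point (p q : M) : Prop := exists m : int, p = q + deck m.

Definition deck_invariant {T : Type} (f : M -> T) : Prop :=
  forall (m : int) (p : M), f (p + deck m) = f p.

Definition lambda0 (p v : M) : R :=
  v.1 + \sum_(i < n) (p.2.1 0 i * v.2.2 0 i - p.2.2 0 i * v.2.1 0 i).

Definition conformal (F : M -> R) (lam : M -> M -> R) (p v : M) : R :=
  expR (F p) * lam p v.

(** J is a smooth periodic field of endomorphisms of the ambient tangent space
    preserving xi = ker lam; only its restriction to xi is meaningful, and
    every smooth section of End(xi) is such a restriction (compose it with a
    projection onto xi). *)
Definition compatible (lam : M -> M -> R) (J : M -> M -> M) : Prop :=
  [/\ forall p, linear (J p), forall v, smooth (fun p => J p v), deck_invariant J
    & forall p,
      [/\ forall v, lam p v = 0 -> lam p (J p v) = 0,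
          forall v, lam p v = 0 -> J p (J p v) = - v,
          forall v w, lam p v = 0 -> lam p w = 0 ->
            dform lam p v (J p w) = dform lam p w (J p v)
        & forall v, lam p v = 0 -> v != 0 -> 0 < dform lam p v (J p v)]].

End Manifold.

(** Multiplication by i on C and its tangent spaces. *)
Definition jC {R : realType} (v : plane R) : plane R := (- v.2, v.1).

Section Planes.
Context {R : realType} {n : nat}.
Local Notation M := (ucover R n).
Local Notation C := (plane R).

Definition pseudoholomorphic (lam : M -> M -> R) (J : M -> M -> M)
    (a : C -> R) (u : C -> M) : Prop :=
  [/\ smooth a, smooth u,
      forall w v, reeb_proj lam (u w) ('D_(jC v) u w)
                  = J (u w) (reeb_proj lam (u w) ('D_v u w))
    & forall w v, pullback u lam w (jC v) = 'D_v a w].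

Definition cutoffs : set (R -> R) :=
  [set phi : R -> R | [/\ smooth phi, forall s, 0 <= phi s <= 1,
                 forall s, 0 <= derive1 phi s,
                 phi s @[s --> -oo] --> (0 : R)
               & phi s @[s --> +oo] --> (1 : R)]].

Definition hofer_energy (lam : M -> M -> R) (a : C -> R) (u : C -> M) : \bar R :=
  ereal_sup [set (\int[(@lebesgue_measure R \x @lebesgue_measure R)]_w
      (dform (fun q v : C => phi (a q) * pullback u lam q v) w
         ((1, 0) : C) ((0, 1) : C))%:E)%E | phi in cutoffs].

Definition finite_energy_plane (lam : M -> M -> R) (J : M -> M -> M)
    (a : C -> R) (u : C -> M) : Prop :=
  pseudoholomorphic lam J a u /\ (hofer_energy lam a u < +oo)%E.

(** Holomorphic cylindrical coordinates (s, t) around the puncture infinity of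
    C; holomorphic on the closed half-cylinder s >= 0 means holomorphic on a
    neighbourhood of it. The convergence to the puncture is uniform in t. *)
Definition cylindrical_coordinates (psi : C -> C) : Prop :=
  [/\ forall w, psi (w + (0, 1)) = psi w,
      exists2 e : R, 0 < e & forall w : C, - e < w.1 ->
        differentiable psi w /\
        forall v, 'D_(jC v) psi w = jC ('D_v psi w),
      forall w : C, 0 <= w.1 -> 'D_((1, 0) : C) psi w != 0,
      forall w w' : C, 0 <= w.1 -> 0 <= w'.1 -> psi w = psi w' ->
        exists m : int, w = w' + (0, m%:~R)
    & forall A : R, exists s0 : R, forall s t : R, s0 <= s -> A < `|psi (s, t)|].

Definition circle_at (u : C -> M) (psi : C -> C) (s t : R) : M := u (psi (s, t)).

Definition has_mass (lam : M -> M -> R) (u : C -> M) (psi : C -> C) (T : R) :=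
  (\int[@lebesgue_measure R]_(t in `[0, 1])
     lam (circle_at u psi s t) (derive1 (circle_at u psi s) t)) @[s --> +oo] --> T.

(** C^oo-convergence of loops in M: uniform convergence of all derivatives, up
    to deck transformations of the lifts. *)
Definition loop_cvg (c : nat -> R -> M) (gamma : R -> M) : Prop :=
  exists m : nat -> int, forall (j : nat) (e : R), 0 < e ->
    \forall k \near \oo, forall t : R, 0 <= t <= 1 ->
      `|derive1n j (fun t' : R => c k t' + deck (m k)) t - derive1n j gamma t| < e.

Definition limit_orbits (lam : M -> M -> R) (u : C -> M) : set (R -> M) :=
  [set gamma : R -> M |
    [/\ smooth gamma,
        exists m : int, forall t, gamma (t + 1) = gamma t + deck m
      & exists (psi : C -> C) (T : R) (s : nat -> R),
        [/\ cylindrical_coordinates psi /\ has_mass lam u psi T,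
            T != 0,
            forall t, derive1 gamma t = T *: reeb lam (gamma t),
            (forall k, 0 <= s k) /\ (s k @[k --> \oo] --> +oo)
          & loop_cvg (fun k => circle_at u psi (s k)) gamma]]].

(** The union of the images of the limit orbits, as a subset of M. *)
Definition limit_set (lam : M -> M -> R) (u : C -> M) : set M :=
  [set p | exists gamma t, limit_orbits lam u gamma /\ same_point (gamma t) p].

End Planes.

Section Splitting.
Context {R : realType} {n : nat}.
Variable hn : (0 < n)%N.

Definition last_ord : 'I_n := Ordinal (etrans (ltn_predL n) hn).

(** The point (theta, 0, z) of S^1 x R^(2(n-1)) x R^2. *)
Definition axis_point (theta : R) (z : R * R) : ucover R n :=
  (theta, (z.1 *: delta_mx 0 last_ord, z.2 *: delta_mx 0 last_ord)).

Definition znorm (z : R * R) : R := Num.sqrt (z.1 ^+ 2 + z.2 ^+ 2).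

Definition torus (r : R) : set (ucover R n) :=
  [set p | exists theta z, znorm z = r /\ p = axis_point theta z].

End Splitting.

(* Main.v *)
Require Import Defs.
From HB Require Import structures.
From mathcomp Require Import all_boot all_order all_algebra.
From mathcomp Require Import all_classical all_reals all_analysis.
From mathcomp Require Import measurable_realfun.
From mathcomp Require Import ring lra.
Import Order.TTheory GRing.Theory Num.Theory.
Import numFieldNormedType.Exports.
Local Open Scope ring_scope.
Local Open Scope classical_set_scope.
Set Implicit Arguments.
Unset Strict Implicit.
Unset Printing Implicit Defensive.

(** The planes are looked for among those with a circular symmetry. Fix a unit
vector e of R^n (a coordinate vector in the application) and Q = r0^2, and use
on the complex line spanned by e the logarithmic radius
l = 1/2 ln ((|x|^2 + |y|^2) / Q), which is negative exactly inside the circle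
of radius r0. Let J be the standard complex structure of C^n lifted to xi, and
let the conformal factor F = pot l theta depend on l and theta only. Consider
a map that, in the cylindrical coordinate s + i t = ln w of the punctured
plane, reads
[theta = th s, x + i y = r0 exp (lam s) exp (i (eta s + t)) e].
It is the M-component of a pseudoholomorphic map for (exp F lambda0, J) as soon
as [lam' = 1 + F_l / 2], [th' = Q^2 / 2 exp (4 lam) F_theta] and
[eta' = - Q / 2 exp (2 lam) F_theta]; the R-component is then a primitive of an
explicit function of s. The first two equations form an autonomous planar
system, which is the gradient system of h = 2 l + F for a metric depending on
l: h increases along the orbits. The theorem becomes a question on
gradient-like flows: choose F such that all orbits issued from l < 0 converge to
the whole circle l = 0, although they cannot converge to a point of it.

The choice (wave, cutoff, pot) is the classical example of a gradient flow whose
orbits have no limit: near l = 0 from below,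
[h = - exp (1/l) (6/5 + sin (theta + 1/l))], and h = 0 for l >= 0, which is
smooth because exp (1/l) is flat. For l <= -1 a cut-off makes F vanish, so that
l = s + const and theta, eta are constant: there the map is affine in w,
hence it extends smoothly over w = 0 (lemma orbit_far).

- Since h has no critical point in l < 0 (ham_noncritical; this uses 6/5 > 1),
  every orbit in l < 0 reaches l <= -1 in the past (orbit_backward) and has
  h -> 0, hence l -> 0, in the future (ham_orbit_to_0, lam_to_0).
- theta tends to infinity (th_to_pinfty): take an angle b with cos b = -3/5 and
  sin b = -4/5. Where theta + 1/l = b mod 2 pi this quantity is increasing along
  the flow; this uses 6/5 < 7/5. So theta + 1/l stays above a constant, and
  -1/l tends to infinity.
- On l = 0 one has F = 0, F_theta = 0 and F_l = -2, so that the Reeb field there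
  rotates the circles {theta} x {|z| = r0}, which are closed orbits of period
  2 pi Q. As theta takes all values modulo 2 pi at arbitrarily late times
  (th_recurs), every such circle is a limit of circles s = s_k, after
  extraction of a subsequence along which the phase eta converges; conversely
  limits of loops have l = 0. So the limit set is the torus (limit_set_spiral).
- Hofer energy: the integrand is the divergence of a vector field on the plane,
  is nonnegative, and the field has size at most Q / N on the boundary of the
  square of half-side N. So all energies are at most 8 Q (spiral_energy).

Through a point with theta = theta0 and 0 < |z| < r0 passes the plane of the
orbit through (ln (|z| / r0), theta0), shifted in time so that l <= -1 at s = 1:
by the circular symmetry it takes the value z on the circle of w in question. For z = 0 any plane
with th 1 = theta0 takes the value (theta0, 0, 0) at w = 0. *)

(** * Germs of functions of class C^k *)

(** The differential is chosen among the linear maps satisfying the expansion, so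
    the expansion of f has to be transported to g before the choice is made. *)
Lemma near_eq_differentiable (R : numFieldType) (V W : normedModType R)
    (f g : V -> W) (x : V) :
  (\forall y \near x, f y = g y) -> differentiable f x -> differentiable g x.
Proof.
move=> fg dfx; have [cdf fE] := (diff_locallyP _ _).1 dfx.
apply/diffP.
apply: (@getPex _ (fun (df : {linear V -> W}) => continuous df /\
  forall y, g y = g (lim (nbhs x)) + df (y - lim (nbhs x))
                  +o_(y \near x) (y - lim (nbhs x)))).
exists ('d f x); split => //.
have gx : g x = f x by rewrite (nbhs_singleton fg).
have := (diffP _ _).1 dfx => -[_]; rewrite !lim_id//.
move=> /funext /eqaddoP H.
have E : g = (fun y => g x + ('d f x) (y - x)) +o_x (fun y => y - x).
  apply/eqaddoP => e e0; have := H e e0 => {}H; near=> y.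
  rewrite !fctE; rewrite gx; have <- : f y = g y by near: y.
  by near: y.
by move=> y; have := congr1 (fun k : V -> W => k y) E.
Unshelve. all: by end_near. Qed.

Section SmoothAt.
Context {R : realType}.

(** Ck speaks of globally defined functions and of existing directional derivatives only;
    it is not visibly stable under products or composition, nor local. This
    stronger local form, with differentiability in a neighbourhood, is. *)
Fixpoint Ck_at {V : normedModType R} (k : nat) (f : V -> R) (x : V) : Prop :=
  match k with
  | 0 => {for x, continuous f}
  | k'.+1 => (\forall y \near x, differentiable f y)
             /\ forall v, Ck_at k' (fun y => 'D_v f y) x
  end.

Context {V : normedModType R}.
Implicit Types (f g : V -> R) (x v : V).

Lemma Ck_at_near k f g x :
  (\forall y \near x, f y = g y) -> Ck_at k f x -> Ck_at k g x.
Proof.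
elim: k f g => [|k IHk] f g fg /=.
  move=> cf; have : g @ x --> f x.
    by apply: cvg_trans cf; apply: near_eq_cvg; apply: filterS fg.
  by rewrite (nbhs_singleton fg).
have fg2 : \forall y \near x, \forall z \near y, f z = g z by exact/near_join.
move=> [df Df]; split.
  near=> y; apply: (@near_eq_differentiable _ _ _ f); first by near: y.
  by near: y.
move=> v; apply: IHk (Df v); near=> y; apply: near_eq_derive; near: y.
exact: fg2.
Unshelve. all: by end_near. Qed.

(** How a function is shown to be C^(k+1): exhibit its directional derivatives G. *)
Lemma Ck_atS k f (G : V -> V -> R) x :
  (\forall y \near x, differentiable f y) ->
  (forall v, \forall y \near x, 'D_v f y = G v y) ->
  (forall v, Ck_at k (G v) x) -> Ck_at k.+1 f x.
Proof.
move=> df DG sG; split=> // v; apply: Ck_at_near (sG v).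
by apply: filterS (DG v) => y ->.
Qed.

Lemma Ck_atW k f x : Ck_at k.+1 f x -> Ck_at k f x.
Proof.
elim: k f => [|k IHk] f [df Df].
  exact/differentiable_continuous/(nbhs_singleton df).
by split=> // v; apply: IHk.
Qed.

Lemma Ck_at_cvg k f x : Ck_at k f x -> {for x, continuous f}.
Proof. by elim: k => // k IHk /Ck_atW. Qed.

Lemma Ck_at_cst k (c : R) x : Ck_at k (cst c) x.
Proof.
elim: k c => [|k IHk] c; first exact: cst_continuous.
apply: (@Ck_atS _ _ (fun _ => cst 0)) => //.
- by apply: nearW => y; exact: differentiable_cst.
- by move=> v; apply: nearW => y; rewrite derive_cst.
Qed.

Lemma Ck_at_lin k f x : (forall y, differentiable f y) ->
  (forall y v, 'D_v f y = f v) -> Ck_at k f x.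
Proof.
move=> df Df; case: k => [|k]; first exact: differentiable_continuous.
apply: (@Ck_atS _ _ (fun v => cst (f v))) => //; first exact: nearW.
  by move=> v; apply: nearW.
by move=> v; apply: Ck_at_cst.
Qed.

Lemma Ck_atD k f g x : Ck_at k f x -> Ck_at k g x -> Ck_at k (fun y => f y + g y) x.
Proof.
elim: k f g => [|k IHk] f g; first exact: continuousD.
move=> [df Df] [dg Dg].
apply: (@Ck_atS _ _ (fun v y => 'D_v f y + 'D_v g y)).
- by near=> y; apply: differentiableD; near: y.
- move=> v; near=> y; rewrite [LHS]deriveD//; apply: diff_derivable; near: y => //.
- by move=> v; exact: (IHk _ _ (Df v) (Dg v)).
Unshelve. all: by end_near. Qed.

Lemma Ck_atM k f g x : Ck_at k f x -> Ck_at k g x -> Ck_at k (fun y => f y * g y) x.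
Proof.
elim: k f g => [|k IHk] f g; first exact: continuousM.
move=> sf sg; have [df Df] := sf; have [dg Dg] := sg.
apply: (@Ck_atS _ _ (fun v y => f y * 'D_v g y + g y * 'D_v f y)).
- by near=> y; apply: differentiableM; near: y.
- move=> v; near=> y; rewrite [LHS]deriveM//; apply: diff_derivable; near: y => //.
- move=> v; apply: Ck_atD.
    by apply: IHk (Dg v); exact: Ck_atW.
  by apply: IHk (Df v); exact: Ck_atW.
Unshelve. all: by end_near. Qed.

Lemma Ck_atZ k (c : R) f x : Ck_at k f x -> Ck_at k (fun y => c * f y) x.
Proof. by move=> sf; apply: Ck_atM => //; exact: Ck_at_cst. Qed.

Lemma Ck_atN k f x : Ck_at k f x -> Ck_at k (fun y => - f y) x.
Proof.
by move=> /(Ck_atZ (-1)); apply: Ck_at_near; apply: nearW => y; rewrite mulN1r.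
Qed.

Lemma Ck_atB k f g x : Ck_at k f x -> Ck_at k g x -> Ck_at k (fun y => f y - g y) x.
Proof. by move=> sf sg; apply: Ck_atD => //; apply: Ck_atN. Qed.

Lemma Ck_at_sum n k (f : 'I_n -> V -> R) x : (forall i, Ck_at k (f i) x) ->
  Ck_at k (fun y => \sum_(i < n) f i y) x.
Proof.
elim: n f => [|n IHn] f sf.
  by apply: Ck_at_near (Ck_at_cst k 0 x); apply: nearW => y; rewrite big_ord0.
apply: (@Ck_at_near _ (fun y => \sum_(i < n) f (widen_ord (leqnSn n) i) y
    + f ord_max y)).
  by apply: nearW => y; rewrite big_ord_recr.
by apply: Ck_atD => //; apply: IHn.
Qed.

Lemma derive_comp_real (phi : R -> R) g y v :
  differentiable phi (g y) -> differentiable g y ->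
  'D_v (phi \o g) y = 'D_1 phi (g y) * 'D_v g y.
Proof.
move=> dphi dg; rewrite deriveE; last exact: differentiable_comp.
rewrite diff_comp//= !deriveE//.
by rewrite -[X in 'd phi _ X = _]mulr1 [LHS]linearZ mulrC.
Qed.

Lemma Ck_at_comp k (phi : R -> R) g x :
  Ck_at k phi (g x) -> Ck_at k g x -> Ck_at k (phi \o g) x.
Proof.
elim: k phi g => [|k IHk] phi g; first by move=> cp cg; apply: continuous_comp.
move=> sphi sg; have [dphi Dphi] := sphi; have [dg Dg] := sg.
have cg : {for x, continuous g} by apply: Ck_at_cvg sg.
have dphig : \forall y \near x, differentiable phi (g y).
  exact: (cg [set z | differentiable phi z] dphi).
apply: (@Ck_atS _ _ (fun v y => 'D_1 phi (g y) * 'D_v g y)).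
- by near=> y; apply: differentiable_comp; near: y.
- by move=> v; near=> y; apply: derive_comp_real; near: y.
- move=> v; apply: Ck_atM; last exact: Dg.
  exact: (IHk (fun z => 'D_1 phi z) g (Dphi 1) (Ck_atW sg)).
Unshelve. all: by end_near. Qed.

Lemma Ck_at_scale (W : normedModType R) k f (c : W) :
  (forall x, Ck_at k f x) -> Ck k (fun x => f x *: c).
Proof.
elim: k f => [|k IHk] f sf /=.
  by move=> x; apply: cvgZr_tmp; exact: sf.
have df x : differentiable f x by have [/nbhs_singleton] := sf x.
split.
- by move=> x; apply: cvgZr_tmp; exact/differentiable_continuous.
- by move=> x v; apply/diff_derivable/differentiableZl.
- move=> v; rewrite (_ : (fun x => _) = (fun x => 'D_v f x *: c)).
    by apply: IHk => x; have [_ Df] := sf x; exact: Df.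
  apply/funext => x; rewrite deriveE; last exact: differentiableZl.
  by rewrite diffZl//= deriveE.
Qed.

Lemma CkD (W : normedModType R) k (f g : V -> W) :
  Ck k f -> Ck k g -> Ck k (fun x => f x + g x).
Proof.
elim: k f g => [|k IHk] f g /=.
  by move=> cf cg x; apply: continuousD; [exact: cf|exact: cg].
move=> [cf df Df] [cg dg Dg]; split.
- by move=> x; apply: continuousD; [exact: cf|exact: cg].
- by move=> x v; apply: derivableD.
- move=> v; rewrite (_ : (fun x => _) = (fun x => 'D_v f x + 'D_v g x)).
    exact: IHk.
  by apply/funext => x; rewrite [LHS]deriveD.
Qed.

Lemma smooth_Ck_at f : (forall k x, Ck_at k f x) -> smooth f.
Proof.
move=> sf k; rewrite (_ : f = (fun x => f x *: (1 : R^o))).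
  by apply: Ck_at_scale.
by apply/funext => x; rewrite /GRing.scale/= mulr1.
Qed.

End SmoothAt.

Section SmoothAtR.
Context {R : realType}.
Implicit Types (f g : R -> R).

Lemma derive_R (W : normedModType R) (f : R -> W) (x v : R) :
  differentiable f x -> 'D_v f x = v *: 'D_1 f x.
Proof.
by move=> df; rewrite !deriveE// -[in LHS](mulr1 v) [LHS]linearZ.
Qed.

Lemma Ck_atS1 k f g (x : R) :
  (\forall y \near x, is_derive y (1 : R) f (g y)) -> Ck_at k g x -> Ck_at k.+1 f x.
Proof.
move=> df sg; apply: (@Ck_atS R R k f (fun v y : R => v * g y) x).
- by apply: filterS df => y [] /derivable1_diffP.
- move=> v; apply: filterS df => y [/derivable1_diffP dfy Dy].
  by rewrite derive_R// Dy.
- by move=> v; apply: Ck_atZ.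
Qed.

Lemma Ck_atS1T k f g (x : R) :
  (forall y, is_derive y (1 : R) f (g y)) -> Ck_at k g x -> Ck_at k.+1 f x.
Proof. by move=> df; apply: Ck_atS1; near do exact: df. Unshelve. all: by end_near. Qed.

Lemma Ck_at_id k (x : R) : Ck_at k id x.
Proof.
apply: Ck_at_lin => [y|y v]; first by apply/derivable1_diffP.
by rewrite derive_id.
Qed.

Lemma Ck_at_expR k (x : R) : Ck_at k expR x.
Proof.
elim: k => [|k IHk]; first exact: (@continuous_expR R x).
exact: Ck_atS1T IHk.
Qed.

Lemma Ck_at_sin_cos k (x : R) : Ck_at k sin x /\ Ck_at k cos x.
Proof.
elim: k => [|k [IHs IHc]]; first by split; [exact: (@continuous_sin R x)|exact: (@continuous_cos R x)].
split; first exact: Ck_atS1T IHc.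
exact: Ck_atS1T (Ck_atN IHs).
Qed.

Lemma Ck_at_sin k (x : R) : Ck_at k sin x. Proof. by case: (Ck_at_sin_cos k x). Qed.
Lemma Ck_at_cos k (x : R) : Ck_at k cos x. Proof. by case: (Ck_at_sin_cos k x). Qed.

Lemma Ck_at_inv k (x : R) : x != 0 -> Ck_at k (fun y : R => y^-1) x.
Proof.
move=> x0; elim: k => [|k IHk]; first exact: (@inv_continuous R x x0).
apply: (@Ck_atS1 _ _ (fun y : R => - (y^-1 * y^-1))); last exact/Ck_atN/Ck_atM.
have : \forall y \near x, y != 0 by exact: open_neq.
apply: filterS => y y0.
have := @is_deriveV _ id y 1 1 y0 (is_derive_id _ _).
by move=> /is_derive_eq; apply; rewrite /GRing.scale/= mulr1 -expr2 exprVn.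
Qed.

Lemma Ck_at_ln k (x : R) : 0 < x -> Ck_at k (@ln R) x.
Proof.
move=> x0; case: k => [|k]; first exact: (@continuous_ln R x x0).
apply: (@Ck_atS1 _ _ (fun y : R => y^-1)); last by apply: Ck_at_inv; rewrite gt_eqF.
have : \forall y \near x, 0 < y by exact: lt_nbhsr.
by apply: filterS => y y0; exact: is_derive1_ln.
Qed.

End SmoothAtR.

(** * Rules for derivatives *)

Section Rules1.
Context {R : realType}.
Implicit Types (f g : R -> R) (x a b : R).

(** The lemmas on [is_derive x 1] below have products in the form a * b rather than
    as scalings, and leave the derivative syntactically free: it is computed by
    the rules and compared with the expected value through this lemma. *)
Lemma isd_eq f x a b : is_derive x (1 : R) f a -> a = b -> is_derive x (1 : R) f b.
Proof. by move=> fa <-. Qed.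

Lemma isd_val f x a : is_derive x (1 : R) f a -> 'D_1 f x = a.
Proof. by case. Qed.

Lemma isd_differentiable f x a : is_derive x (1 : R) f a -> differentiable f x.
Proof. by case=> /derivable1_diffP. Qed.

Lemma isd_continuous f x a : is_derive x (1 : R) f a -> {for x, continuous f}.
Proof. by move=> /isd_differentiable /differentiable_continuous. Qed.

Lemma isd_cst (c : R) x : is_derive x (1 : R) (fun=> c) 0.
Proof. exact: is_derive_cst. Qed.

Lemma isd_id x : is_derive x (1 : R) (fun y : R => y) 1.
Proof. exact: is_derive_id. Qed.

Lemma isdD f g x a b : is_derive x (1 : R) f a -> is_derive x (1 : R) g b ->
  is_derive x (1 : R) (fun y => f y + g y) (a + b).
Proof. exact: is_deriveD. Qed.

Lemma isdN f x a : is_derive x (1 : R) f a ->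
  is_derive x (1 : R) (fun y => - f y) (- a).
Proof. exact: is_deriveN. Qed.

Lemma isdM f g x a b : is_derive x (1 : R) f a -> is_derive x (1 : R) g b ->
  is_derive x (1 : R) (fun y => f y * g y) (a * g x + f x * b).
Proof.
move=> fa gb; have /isd_eq := @is_deriveM R R f g x 1 a b fa gb; apply.
by rewrite /GRing.scale/= addrC [g x * a]mulrC.
Qed.

Lemma isd_comp f g x a b : is_derive (g x) (1 : R) f a ->
  is_derive x (1 : R) g b -> is_derive x (1 : R) (fun y => f (g y)) (a * b).
Proof. exact: is_derive1_comp. Qed.

Lemma isd_ext f g x a : f =1 g ->
  is_derive x (1 : R) f a -> is_derive x (1 : R) g a.
Proof. by move=> /funext ->. Qed.

Lemma isdX n x : is_derive x (1 : R) (fun y : R => y ^+ n) (n%:R * x ^+ n.-1).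
Proof.
elim: n => [|n IHn].
  by apply: (isd_eq (isd_cst 1 x)); rewrite mul0r.
apply: (@isd_ext (fun y => y * y ^+ n)); first by move=> y; rewrite exprS.
apply: (isd_eq (isdM (isd_id x) IHn)).
case: n {IHn} => [|n]; first by rewrite /= !expr0; ring.
by rewrite /= -[n.+2%:R]natr1 !exprS; ring.
Qed.

Lemma isdV x : x != 0 -> is_derive x (1 : R) (fun y : R => y^-1) (- (x^-1 * x^-1)).
Proof.
move=> x0; have := @is_deriveV _ id x 1 1 x0 (is_derive_id _ _).
by move=> /isd_eq; apply; rewrite /GRing.scale/= mulr1 -expr2 exprVn.
Qed.

Lemma isd_expR g x b : is_derive x (1 : R) g b ->
  is_derive x (1 : R) (fun y => expR (g y)) (expR (g x) * b).
Proof. exact: isd_comp. Qed.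

Lemma isd_sin g x b : is_derive x (1 : R) g b ->
  is_derive x (1 : R) (fun y => sin (g y)) (cos (g x) * b).
Proof. exact: isd_comp. Qed.

Lemma isd_cos g x b : is_derive x (1 : R) g b ->
  is_derive x (1 : R) (fun y => cos (g y)) (- sin (g x) * b).
Proof. exact: isd_comp. Qed.

Lemma isd_near f g x a : (\forall y \near x, f y = g y) ->
  is_derive x (1 : R) f a -> is_derive x (1 : R) g a.
Proof. exact: near_eq_is_derive. Qed.

Lemma isd_nondecr f (df : R -> R) x y : x <= y ->
  (forall z, x <= z <= y -> is_derive z (1 : R) f (df z)) ->
  (forall z, x <= z <= y -> 0 <= df z) -> f x <= f y.
Proof.
move=> xy fd df0.
have cf : {within `[x, y], continuous f}.
  apply: continuous_in_subspaceT => z /set_mem; rewrite /= in_itv/= => zxy.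
  exact: (isd_continuous (fd z zxy)).
have fd' : forall z, z \in `]x, y[%R -> is_derive z (1 : R) f (df z).
  by move=> z; rewrite in_itv/= => /andP[xz zy]; apply: fd; rewrite !ltW.
have [c] := MVT_segment xy fd' cf; rewrite in_itv/= => cxy E.
by rewrite -subr_ge0 E mulr_ge0 ?subr_ge0// df0.
Qed.

Lemma isd_cst_on f x y : x <= y ->
  (forall z, x <= z <= y -> is_derive z (1 : R) f 0) -> f x = f y.
Proof.
move=> xy fd; apply/eqP; rewrite eq_le (isd_nondecr xy fd)//=.
rewrite -lerN2; apply: (@isd_nondecr (fun z => - f z) (fun=> 0)) => // z /fd.
by move/isdN; rewrite oppr0.
Qed.

End Rules1.

Ltac isd := repeat first
  [ exact: isd_cst | exact: isd_id | assumption
  | apply: isdD | apply: isdN | apply: isdM | exact: isdX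
  | apply: isd_expR | apply: isd_sin | apply: isd_cos ].

Section LinearFunctional.
Context {R : realType} {V : normedModType R}.

(** Continuity has to be assumed because V may be infinite-dimensional. *)
Lemma linear_diff (f : V -> R) : (forall a u v, f (a *: u + v) = a * f u + f v) ->
  continuous f ->
  (forall y, differentiable f y) /\ (forall y v, 'D_v f y = f v).
Proof.
move=> lf cf.
pose fM := @GRing.isLinear.Build R V R^o _ (f : V -> R^o) lf.
pose fL : {linear V -> R^o} := HB.pack (f : V -> R^o) fM.
have cfL : continuous (fL : V -> R^o) by exact: cf.
have df y : differentiable f y by exact: (@linear_differentiable _ _ _ fL y cfL).
split => // y v; rewrite deriveE//.
by have := @diff_lin _ _ _ fL y cfL => ->.
Qed.

Lemma Ck_at_linear k (f : V -> R) x : (forall a u v, f (a *: u + v) = a * f u + f v) ->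
  continuous f -> Ck_at k f x.
Proof. by move=> lf cf; have [df Df] := linear_diff lf cf; exact: Ck_at_lin. Qed.

End LinearFunctional.

Section Plane.
Context {R : realType}.

Lemma fst_linear (W : normedModType R) : 
  (forall y : R * W, differentiable (fun p : R * W => p.1) y) /\
  (forall (y v : R * W), 'D_v (fun p : R * W => p.1) y = v.1).
Proof. by apply: linear_diff => // p; exact: cvg_fst. Qed.

Lemma snd_linear : 
  (forall y : R * R, differentiable (fun p : R * R => p.2) y) /\
  (forall (y v : R * R), 'D_v (fun p : R * R => p.2) y = v.2).
Proof. by apply: linear_diff => // p; exact: cvg_snd. Qed.

Lemma Ck_at_fst (W : normedModType R) k (p : R * W) : Ck_at k (fun p : R * W => p.1) p.
Proof. by apply: Ck_at_linear => // q; exact: cvg_fst. Qed.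

Lemma Ck_at_snd k (p : R * R) : Ck_at k (fun p : R * R => p.2) p.
Proof. by apply: Ck_at_linear => // q; exact: cvg_snd. Qed.

End Plane.

Section HasD.
Context {R : realType} {V : normedModType R}.
Implicit Types (f g : V -> R) (x : V) (D E : V -> R).

(** Differentiability with a named derivative in all directions at once; unlike
    [is_derive] it composes with differentiable functions. *)
Definition hasD f x D := differentiable f x /\ forall v, 'D_v f x = D v.

Lemma hasD_eq f x D E : hasD f x D -> D =1 E -> hasD f x E.
Proof. by move=> [df Df] DE; split => // v; rewrite Df. Qed.

Lemma hasD_cst (c : R) x : hasD (fun=> c) x (fun=> 0).
Proof. by split; [exact: differentiable_cst|move=> v; exact: derive_cst]. Qed.

Lemma hasDD f g x D E : hasD f x D -> hasD g x E ->
  hasD (fun y => f y + g y) x (fun v => D v + E v).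
Proof.
move=> [df Df] [dg Dg]; split; first exact: differentiableD.
by move=> v; rewrite [LHS]deriveD ?Df ?Dg//; exact: diff_derivable.
Qed.

Lemma hasDM f g x D E : hasD f x D -> hasD g x E ->
  hasD (fun y => f y * g y) x (fun v => D v * g x + f x * E v).
Proof.
move=> [df Df] [dg Dg]; split; first exact: differentiableM.
move=> v; rewrite [LHS]deriveM ?Df ?Dg; try exact: diff_derivable.
by rewrite addrC /GRing.scale/= [g x * _]mulrC.
Qed.

Lemma hasDZ (c : R) f x D : hasD f x D -> hasD (fun y => c * f y) x (fun v => c * D v).
Proof.
by move=> h; apply: (hasD_eq (hasDM (hasD_cst c x) h)) => v; rewrite mul0r add0r.
Qed.

Lemma hasDN f x D : hasD f x D -> hasD (fun y => - f y) x (fun v => - D v).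
Proof.
move=> [df Df]; split; first exact: differentiableN.
by move=> v; rewrite [LHS]deriveN ?Df//; exact: diff_derivable.
Qed.

Lemma hasDB f g x D E : hasD f x D -> hasD g x E ->
  hasD (fun y => f y - g y) x (fun v => D v - E v).
Proof. by move=> hf hg; exact: (hasDD hf (hasDN hg)). Qed.

Lemma hasD_comp (phi : R -> R) (d : R) f x D :
  is_derive (f x) (1 : R) phi d -> hasD f x D ->
  hasD (fun y => phi (f y)) x (fun v => d * D v).
Proof.
move=> hphi [df Df]; have dphi := isd_differentiable hphi.
split; first exact: (differentiable_comp df dphi).
by move=> v; rewrite [LHS](derive_comp_real v dphi df) (isd_val hphi) Df.
Qed.

Lemma hasD_near f g x D : (\forall y \near x, f y = g y) -> hasD f x D -> hasD g x D.
Proof.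
move=> fg [df Df]; split; first exact: near_eq_differentiable df.
by move=> v; rewrite -Df; apply: near_eq_derive; apply: filterS fg.
Qed.

Lemma hasD_ext f g x D : (forall y, f y = g y) -> hasD f x D -> hasD g x D.
Proof. by move=> /funext ->. Qed.

Lemma hasD_linear f x : (forall a u v, f (a *: u + v) = a * f u + f v) ->
  continuous f -> hasD f x f.
Proof. by move=> lf cf; have [df Df] := linear_diff lf cf; split. Qed.

Lemma hasD_sum n (f D : 'I_n -> V -> R) x : (forall i, hasD (f i) x (D i)) ->
  hasD (fun y => \sum_(i < n) f i y) x (fun v => \sum_(i < n) D i v).
Proof.
elim: n f D => [|n IHn] f D h.
  apply: (@hasD_near (fun=> 0)); first by apply: nearW => y; rewrite big_ord0.
  by apply: hasD_eq (hasD_cst 0 x) _ => v; rewrite big_ord0.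
apply: (@hasD_near (fun y => \sum_(i < n) f (widen_ord (leqnSn n) i) y
    + f ord_max y)).
  by apply: nearW => y; rewrite big_ord_recr.
apply: hasD_eq (hasDD (IHn _ _ (fun i => h (widen_ord (leqnSn n) i))) (h ord_max)) _.
by move=> v; rewrite big_ord_recr.
Qed.

End HasD.

Section SmoothLine.
Context {R : realType}.

Lemma Ck_at_smooth (f : R -> R) : smooth f -> forall k x, Ck_at k f x.
Proof.
move=> sf k; have := sf k; elim: k f {sf} => [|k IHk] f /=; first by move=> cf x; exact: cf.
move=> [_ df Df] x.
exact: (Ck_atS1T (fun y => derivableP (df y 1)) (IHk _ (Df 1) x)).
Qed.

Lemma hasD_isd_fst (f : R * R -> R) (x y : R) D : hasD f (x, y) D ->
  is_derive x (1 : R) (fun x => f (x, y)) (D (1, 0)).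
Proof.
move=> [df Df].
have dg : differentiable (fun x : R => (x, y)) x.
  by apply: differentiable_pair => //; exact: differentiable_cst.
have dfg : differentiable (fun x => f (x, y)) x by exact: (differentiable_comp dg df).
apply: DeriveDef; first exact/derivable1_diffP.
rewrite -Df !deriveE//.
rewrite (_ : (fun x => f (x, y)) = f \o (fun x : R => (x, y)))// diff_comp//=.
by rewrite diff_pair//= diff_cst diff_val.
Qed.

Lemma hasD_isd_snd (f : R * R -> R) (x y : R) D : hasD f (x, y) D ->
  is_derive y (1 : R) (fun y => f (x, y)) (D (0, 1)).
Proof.
move=> [df Df].
have dg : differentiable (fun y : R => (x, y)) y.
  by apply: differentiable_pair => //; exact: differentiable_cst.
have dfg : differentiable (fun y => f (x, y)) y by exact: (differentiable_comp dg df).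
apply: DeriveDef; first exact/derivable1_diffP.
rewrite -Df !deriveE//.
rewrite (_ : (fun y => f (x, y)) = f \o (fun y : R => (x, y)))// diff_comp//=.
by rewrite diff_pair//= diff_cst diff_val.
Qed.

End SmoothLine.

(** * Flat oscillating functions and a cut-off *)

Section Flat.
Context {R : realType}.
Implicit Types (x y d : R).

(** The functions d^-m exp (-1/d) (a + b cos (1/d) + c sin (1/d)), extended by 0 to
    d <= 0. Their linear span is closed under differentiation, which makes them
    all smooth at once, without estimating higher derivatives at 0. *)
Definition flat_wave (m : nat) (a b c : R) (d : R) : R :=
  if 0 < d then d^-1 ^+ m * expR (- d^-1) * (a + b * cos d^-1 + c * sin d^-1)
  else 0.

Lemma expR_ge_pow (m : nat) (y : R) :
  0 <= y -> y ^+ m.+1 <= (m.+1`!)%:R * expR y.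
Proof.
move=> y0; rewrite mulrC -ler_pdivrMr ?ltr0n ?fact_gt0//.
by apply: le_trans (expR_ge1Dxn m y0); rewrite lerDr.
Qed.

(** A function that is O(h^2) at a zero has derivative 0 there. *)
Lemma is_derive_flat (f : R -> R) (K : R) (x : R) :
  f x = 0 -> (forall h, `|f (x + h)| <= K * h ^+ 2) -> is_derive x (1 : R) f 0.
Proof.
move=> fx0 fK.
have H : h^-1 *: (f (h *: (1 : R) + x) - f x) @[h --> (0 : R)^'] --> (0 : R).
  apply/cvgrPdist_le => e e0; near=> h.
  have h0 : h != 0 by near: h; exact: nbhs_dnbhs_neq.
  rewrite sub0r normrN fx0 subr0 /GRing.scale/= mulr1 addrC normrM.
  rewrite normfV ler_pdivrMl ?normr_gt0//.
  rewrite (le_trans (fK h))// -real_normK ?num_real// expr2 mulrA [leRHS]mulrC.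
  rewrite ler_pM2r ?normr_gt0//.
  have K0 : K <= `|K| + 1 by rewrite (le_trans (ler_norm _))// lerDl.
  rewrite (le_trans (ler_wpM2r (normr_ge0 h) K0))// mulrC -ler_pdivlMr ?ltr_wpDl//.
  near: h; apply: dnbhs0_le; rewrite divr_gt0// ltr_wpDl//.
split; last exact: cvg_lim H.
by apply/cvg_ex; exists 0.
Unshelve. all: by end_near. Qed.

Lemma flat_wave_le0 m a b c d : d <= 0 -> flat_wave m a b c d = 0.
Proof. by rewrite /flat_wave leNgt => /negbTE ->. Qed.

Lemma flat_waveE m a b c d : 0 < d -> flat_wave m a b c d =
  d^-1 ^+ m * expR (- d^-1) * (a + b * cos d^-1 + c * sin d^-1).
Proof. by rewrite /flat_wave => ->. Qed.

(** This quadratic bound is what makes the derivative at d = 0 vanish; it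
    follows from (1/d)^(m+2) <= (m+2)! exp (1/d). *)
Lemma flat_wave_bound m a b c d :
  `|flat_wave m a b c d| <= (m.+2`!%:R * (`|a| + `|b| + `|c|)) * d ^+ 2.
Proof.
have K0 : 0 <= `|a| + `|b| + `|c| by rewrite !addr_ge0.
have [d0|d0] := ltP 0 d; last first.
  by rewrite flat_wave_le0// normr0; apply: mulr_ge0; [exact: mulr_ge0|exact: sqr_ge0].
rewrite flat_waveE// normrM mulrAC; apply: ler_pM => //.
  rewrite ger0_norm; last first.
    by rewrite mulr_ge0 ?expR_ge0// exprn_ge0// invr_ge0 ltW.
  have := @expR_ge_pow m.+1 d^-1; rewrite invr_ge0 ltW// => /(_ isT) H.
  rewrite expRN ler_pdivrMr ?expR_gt0// [leRHS]mulrAC.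
  rewrite -ler_pdivrMr ?exprn_gt0// -exprVn -exprD addn2 //.
rewrite (le_trans (ler_normD _ _))// lerD//.
  by rewrite (le_trans (ler_normD _ _))// lerD2l normrM ler_piMr// cos_max.
by rewrite normrM ler_piMr// sin_max.
Qed.

(** With y = 1/d one has dy/dd = - y^2: differentiating y^m raises the exponent
    by one, differentiating the exponential and the trigonometric factor raises
    it by two. *)
Lemma is_derive_flat_wave m a b c d :
  is_derive d (1 : R) (flat_wave m a b c)
    (flat_wave m.+1 (- (m%:R * a)) (- (m%:R * b)) (- (m%:R * c)) d
     + flat_wave m.+2 a (b - c) (c + b) d).
Proof.
have [d0|d0|<-] := ltgtP 0 d.
- pose g := fun d : R => d^-1 ^+ m * expR (- d^-1) * (a + b * cos d^-1 + c * sin d^-1).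
  apply: (@near_eq_is_derive _ _ _ g).
    by near=> z; rewrite flat_waveE//; near: z; exact: lt_nbhsr.
  rewrite !flat_waveE//.
  have dn0 : d != 0 by rewrite gt_eqF.
  have di := isdV dn0.
  pose y := d^-1.
  pose g1 := fun y : R => y ^+ m * expR (- y) * (a + b * cos y + c * sin y).
  have dg1 : is_derive (d^-1) (1 : R) g1 ((m%:R * y ^+ m.-1 * expR (- y) - y ^+ m * expR (- y)) * (a + b * cos y + c * sin y) + y ^+ m * expR (- y) * (- b * sin y + c * cos y)).
    apply: isd_eq; first by isd.
    by rewrite -/y /GRing.scale/=; ring.
  apply: isd_eq; first exact: (isd_comp dg1 di).
  rewrite -/y.
  by case: m {g g1 dg1} => [|m]; rewrite /= ?expr0 ?exprS; ring.
- apply: (@near_eq_is_derive _ _ _ (cst 0)).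
    by near=> z; rewrite flat_wave_le0// ltW//; near: z; exact: lt_nbhsl.
  by rewrite !flat_wave_le0 ?ltW// addr0; exact: is_derive_cst.
- rewrite !flat_wave_le0// addr0.
  apply: (@is_derive_flat _ (m.+2`!%:R * (`|a| + `|b| + `|c|))).
    exact: flat_wave_le0.
  by move=> h; rewrite add0r; exact: flat_wave_bound.
Unshelve. all: by end_near. Qed.

Lemma Ck_at_flat_wave k m a b c d : Ck_at k (flat_wave m a b c) d.
Proof.
elim: k m a b c => [|k IHk] m a b c.
  apply: differentiable_continuous; apply/derivable1_diffP.
  by have [] := is_derive_flat_wave m a b c d.
apply: (Ck_atS1T (is_derive_flat_wave m a b c)).
by apply: Ck_atD; exact: IHk.
Qed.

End Flat.

Section FlatMore.
Context {R : realType}.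
Implicit Types (x y d l t : R).

Lemma flat_wave_lin m a b c d : flat_wave m a b c d =
  a * flat_wave m 1 0 0 d + b * flat_wave m 0 1 0 d + c * flat_wave m 0 0 1 d.
Proof. by rewrite /flat_wave; case: ifP => _; ring. Qed.

Lemma is_derive_flat_wave0 a b c d :
  is_derive d (1 : R) (flat_wave 0 a b c) (flat_wave 2 a (b - c) (c + b) d).
Proof.
apply: (isd_eq (is_derive_flat_wave 0 a b c d)).
by rewrite [X in X + _](_ : _ = 0) ?add0r// flat_wave_lin; ring.
Qed.

Definition flat_exp (d : R) : R := flat_wave 0 1 0 0 d.
Definition dflat_exp (d : R) : R := flat_wave 2 1 0 0 d.

Lemma flat_expE d : 0 < d -> flat_exp d = expR (- d^-1).
Proof. by move=> d0; rewrite /flat_exp flat_waveE// expr0; ring. Qed.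

Lemma flat_exp_ge0 d : 0 <= flat_exp d.
Proof.
have [d0|d0] := ltP 0 d; first by rewrite flat_expE// expR_ge0.
by rewrite /flat_exp flat_wave_le0.
Qed.

Lemma flat_exp_gt0 d : 0 < d -> 0 < flat_exp d.
Proof. by move=> d0; rewrite flat_expE// expR_gt0. Qed.

Lemma dflat_exp_ge0 d : 0 <= dflat_exp d.
Proof.
have [d0|d0] := ltP 0 d; last by rewrite /dflat_exp flat_wave_le0.
rewrite /dflat_exp flat_waveE// !mul0r !addr0 mulr1 mulr_ge0 ?expR_ge0//.
by rewrite exprn_ge0// invr_ge0 ltW.
Qed.

Lemma is_derive_flat_exp d : is_derive d (1 : R) flat_exp (dflat_exp d).
Proof.
apply: (isd_eq (is_derive_flat_wave0 1 0 0 d)).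
by rewrite subr0 addr0.
Qed.

Lemma Ck_at_flat_exp k d : Ck_at k flat_exp d.
Proof. exact: Ck_at_flat_wave. Qed.

Definition cutoff_den l : R := flat_exp (l + 1) + flat_exp (- 2^-1 - l).
(** Transition from 0 for l <= -1 to 1 for l >= -1/2. *)
Definition cutoff l : R := flat_exp (l + 1) / cutoff_den l.
Definition dcutoff l : R :=
  (dflat_exp (l + 1) * flat_exp (- 2^-1 - l)
   + flat_exp (l + 1) * dflat_exp (- 2^-1 - l)) / cutoff_den l ^+ 2.

Lemma cutoff_den_gt0 l : 0 < cutoff_den l.
Proof.
rewrite /cutoff_den; have [l1|l1] := ltP (-1) l.
  by rewrite ltr_wpDr ?flat_exp_ge0// flat_exp_gt0// -ltrBlDr sub0r.
by rewrite ltr_wpDl ?flat_exp_ge0// flat_exp_gt0//; lra.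
Qed.

Lemma cutoff_ge0 l : 0 <= cutoff l.
Proof. by rewrite divr_ge0 ?flat_exp_ge0// ltW// cutoff_den_gt0. Qed.

Lemma cutoff_le1 l : cutoff l <= 1.
Proof. by rewrite ler_pdivrMr ?cutoff_den_gt0// mul1r lerDl flat_exp_ge0. Qed.

Lemma cutoff_gt0 l : -1 < l -> 0 < cutoff l.
Proof.
by move=> l1; rewrite divr_gt0 ?cutoff_den_gt0// flat_exp_gt0//; lra.
Qed.

Lemma cutoff0 l : l <= -1 -> cutoff l = 0.
Proof.
move=> l1; rewrite /cutoff [flat_exp (l + 1)]flat_wave_le0 ?mul0r//; lra.
Qed.

Lemma cutoff1 l : - 2^-1 <= l -> cutoff l = 1.
Proof.
move=> l1; rewrite /cutoff /cutoff_den [flat_exp (- _ - _)]flat_wave_le0; last lra.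
by rewrite addr0 divff// gt_eqF// flat_exp_gt0//; lra.
Qed.

Lemma is_derive_cutoff l : is_derive l (1 : R) cutoff (dcutoff l).
Proof.
have dA : is_derive l (1 : R) (fun l => flat_exp (l + 1)) (dflat_exp (l + 1)).
  apply: (isd_eq (isd_comp (is_derive_flat_exp _) (isdD (isd_id l) (isd_cst 1 l)))).
  by rewrite addr0 mulr1.
have dB : is_derive l (1 : R) (fun l => flat_exp (- 2^-1 - l))
    (- dflat_exp (- 2^-1 - l)).
  apply: (isd_eq (isd_comp (is_derive_flat_exp _)
    (isdD (isd_cst (- 2^-1) l) (isdN (isd_id l))))).
  by rewrite add0r mulrN1.
have D0 : cutoff_den l != 0 by rewrite gt_eqF// cutoff_den_gt0.
apply: (isd_eq (isdM dA (isd_comp (isdV D0) (isdD dA dB)))).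
rewrite /dcutoff; move: D0; rewrite /cutoff_den => D0; field.
exact: D0.
Qed.

Lemma dcutoff_ge0 l : 0 <= dcutoff l.
Proof.
rewrite divr_ge0 ?sqr_ge0// addr_ge0// mulr_ge0 ?flat_exp_ge0//;
  exact: dflat_exp_ge0.
Qed.

Lemma dcutoff0 l : l <= -1 -> dcutoff l = 0.
Proof.
move=> l1; rewrite /dcutoff [flat_exp (l + 1)]flat_wave_le0; last lra.
by rewrite [dflat_exp (l + 1)]flat_wave_le0; [rewrite !mul0r addr0 mul0r|lra].
Qed.

Lemma dcutoff1 l : - 2^-1 <= l -> dcutoff l = 0.
Proof.
move=> l1; rewrite /dcutoff [flat_exp (- _ - l)]flat_wave_le0; last lra.
by rewrite [dflat_exp (- _ - l)]flat_wave_le0; [rewrite !mulr0 addr0 mul0r|lra].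
Qed.

Lemma Ck_at_cutoff k l : Ck_at k cutoff l.
Proof.
have sA : Ck_at k (fun l => flat_exp (l + 1)) l.
  apply: (@Ck_at_comp R R k flat_exp (fun l => l + 1)); first exact: Ck_at_flat_exp.
  by apply: Ck_atD; [exact: Ck_at_id|exact: Ck_at_cst].
have sB : Ck_at k (fun l => flat_exp (- 2^-1 - l)) l.
  apply: (@Ck_at_comp R R k flat_exp (fun l => - 2^-1 - l)); first exact: Ck_at_flat_exp.
  by apply: Ck_atB; [exact: Ck_at_cst|exact: Ck_at_id].
apply: Ck_atM => //.
apply: (@Ck_at_comp R R k (fun y => y^-1) cutoff_den); last exact: Ck_atD.
by apply: Ck_at_inv; rewrite gt_eqF// cutoff_den_gt0.
Qed.

End FlatMore.

(** * The conformal factor in logarithmic coordinates *)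

Section Potential.
Context {R : realType}.
Implicit Types (x y d l t : R).

(** For l < 0 this is exp (1/l) (6/5 + sin (t + 1/l)), see [waveE]: in the angle
    t + 1/l the level lines spiral towards l = 0. The constant 6/5 has to lie
    strictly between 1, for the absence of critical points, and
    7/5 = 3/5 + 4/5, for the barrier. *)
Definition wave l t : R := flat_wave 0 (6 / 5) (sin t) (- cos t) (- l).

(** The potential F is - cutoff l * (2 l + wave l t), see [potE]. It is given by its
    three Fourier coefficients in t, so that its smoothness in both variables
    reduces to that of functions of l. *)
Definition pot0 l : R := - (cutoff l * (2 * l + flat_wave 0 (6 / 5) 0 0 (- l))).
Definition pot1 l : R := - (cutoff l * flat_wave 0 0 1 0 (- l)).
Definition pot2 l : R := - (cutoff l * flat_wave 0 0 0 1 (- l)).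

Definition pot l t : R := pot0 l + pot1 l * sin t - pot2 l * cos t.
(** The partial derivative of pot in l. *)
Definition potl l t : R :=
  'D_1 pot0 l + 'D_1 pot1 l * sin t - 'D_1 pot2 l * cos t.
(** The partial derivative of pot in t. *)
Definition pott l t : R := pot1 l * cos t + pot2 l * sin t.

Lemma potE l t : pot l t = - (cutoff l * (2 * l + wave l t)).
Proof. by rewrite /pot /pot0 /pot1 /pot2 /wave [X in _ = - (_ * (_ + X))]flat_wave_lin [X in - (_ * (_ + X)) + _]flat_wave_lin; ring. Qed.

Lemma pottE l t : pott l t = - (cutoff l * flat_wave 0 0 (cos t) (sin t) (- l)).
Proof. by rewrite /pott /pot1 /pot2 [flat_wave 0 0 (cos t) _ _]flat_wave_lin; ring. Qed.

Lemma isd_flat_wave0N a b e l :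
  is_derive l (1 : R) (fun l => flat_wave 0 a b e (- l))
    (- flat_wave 2 a (b - e) (e + b) (- l)).
Proof.
apply: (isd_eq (isd_comp (is_derive_flat_wave0 a b e (- l)) (isdN (isd_id l)))).
by rewrite mulrN1.
Qed.

Lemma isd_pot0 l : is_derive l (1 : R) pot0
  (- (dcutoff l * (2 * l + flat_wave 0 (6 / 5) 0 0 (- l))
      + cutoff l * (2 - flat_wave 2 (6 / 5) 0 0 (- l)))).
Proof.
apply: (isd_eq (isdN (isdM (is_derive_cutoff l)
  (isdD (isdM (isd_cst 2 l) (isd_id l)) (isd_flat_wave0N (6 / 5) 0 0 l))))).
by rewrite subr0 addr0 mul0r add0r mulr1.
Qed.

Lemma isd_pot1 l : is_derive l (1 : R) pot1
  (- (dcutoff l * flat_wave 0 0 1 0 (- l) - cutoff l * flat_wave 2 0 1 1 (- l))).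
Proof.
apply: (isd_eq (isdN (isdM (is_derive_cutoff l) (isd_flat_wave0N 0 1 0 l)))).
by rewrite subr0 add0r mulrN.
Qed.

Lemma isd_pot2 l : is_derive l (1 : R) pot2
  (- (dcutoff l * flat_wave 0 0 0 1 (- l) - cutoff l * flat_wave 2 0 (-1) 1 (- l))).
Proof.
apply: (isd_eq (isdN (isdM (is_derive_cutoff l) (isd_flat_wave0N 0 0 1 l)))).
by rewrite sub0r addr0 mulrN.
Qed.

Definition dwave l t : R :=
  flat_wave 2 (6 / 5) (sin t + cos t) (sin t - cos t) (- l).

Lemma potlE l t : potl l t =
  - (dcutoff l * (2 * l + wave l t) + cutoff l * (2 - dwave l t)).
Proof.
rewrite /potl (isd_val (isd_pot0 l)) (isd_val (isd_pot1 l)) (isd_val (isd_pot2 l)).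
rewrite /wave /dwave.
rewrite [flat_wave 0 _ (sin t) _ _]flat_wave_lin.
rewrite [flat_wave 2 _ (sin t + _) _ _]flat_wave_lin.
rewrite [flat_wave 0 _ 0 0 _]flat_wave_lin [flat_wave 2 _ 0 0 _]flat_wave_lin.
rewrite [flat_wave 2 _ 1 1 _]flat_wave_lin [flat_wave 2 _ (-1) 1 _]flat_wave_lin.
by ring.
Qed.

Lemma Ck_at_flatN k m a b e l : Ck_at k (fun l => flat_wave m a b e (- l)) l.
Proof.
apply: (@Ck_at_comp R R k (flat_wave m a b e) (fun l => - l)).
  exact: Ck_at_flat_wave.
by apply: Ck_atN; exact: Ck_at_id.
Qed.

Lemma Ck_at_pot k l : [/\ Ck_at k pot0 l, Ck_at k pot1 l & Ck_at k pot2 l].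
Proof.
split; apply: Ck_atN; apply: Ck_atM; try exact: Ck_at_cutoff; try exact: Ck_at_flatN.
apply: Ck_atD; last exact: Ck_at_flatN.
by apply: Ck_atZ; exact: Ck_at_id.
Qed.

Lemma Ck_at_dpot k l : [/\ Ck_at k ('D_1 pot0) l, Ck_at k ('D_1 pot1) l
  & Ck_at k ('D_1 pot2) l].
Proof.
have [[_ s0] [_ s1] [_ s2]] := Ck_at_pot k.+1 l.
by split; [exact: s0|exact: s1|exact: s2].
Qed.

Lemma pot_far l t : l <= -1 -> [/\ pot l t = 0, potl l t = 0 & pott l t = 0].
Proof.
by move=> l1; rewrite potE potlE pottE cutoff0// dcutoff0// !mul0r addr0 oppr0.
Qed.

Lemma pot_out l t : 0 <= l -> [/\ pot l t = - (2 * l), potl l t = - 2 & pott l t = 0].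
Proof.
move=> l0; have l1 : - 2^-1 <= l by lra.
have l2 : - l <= 0 by lra.
rewrite potE potlE pottE cutoff1// dcutoff1// /wave /dwave.
by rewrite !flat_wave_le0// !mul1r mul0r addr0 add0r subr0 oppr0.
Qed.

Lemma sin_cosD2pi (m : int) t :
  sin (t + 2 * pi * m%:~R) = sin t /\ cos (t + 2 * pi * m%:~R) = cos t.
Proof.
have H (n : nat) (u : R) : sin (u + 2 * pi * n%:R) = sin u /\ cos (u + 2 * pi * n%:R) = cos u.
  have -> : 2 * pi * n%:R = (pi *+ 2 : R) *+ n by rewrite mulr_natr mulr_natl.
  rewrite (periodicn (@sinD2pi R)) (periodicn (@cosD2pi R)).
  done.
case: m => n; first exact: H.
have [Hs Hc] := H n.+1 (t + 2 * pi * (Negz n)%:~R).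
by rewrite -Hs -Hc NegzE mulrNz mulrN subrK.
Qed.

Lemma potDpi l t m : [/\ pot l (t + 2 * pi * m%:~R) = pot l t,
  potl l (t + 2 * pi * m%:~R) = potl l t & pott l (t + 2 * pi * m%:~R) = pott l t].
Proof.
by rewrite /pot /potl /pott; have [-> ->] := sin_cosD2pi m t.
Qed.

Lemma waveE l t : l < 0 ->
  wave l t = expR l^-1 * (6 / 5 + sin (t + l^-1)).
Proof.
move=> l0; rewrite /wave flat_waveE ?oppr_gt0// expr0 invrN opprK.
by rewrite sinD cosN sinN; ring.
Qed.

Lemma dwaveE l t : l < 0 -> dwave l t =
  l^-1 ^+ 2 * expR l^-1 * (6 / 5 + sin (t + l^-1) + cos (t + l^-1)).
Proof.
move=> l0; rewrite /dwave flat_waveE ?oppr_gt0// invrN opprK sqrrN.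
by rewrite sinD cosD cosN sinN; ring.
Qed.

Lemma pott_waveE l t : l < 0 -> pott l t =
  - (cutoff l * (expR l^-1 * cos (t + l^-1))).
Proof.
move=> l0; rewrite pottE flat_waveE ?oppr_gt0// expr0 invrN opprK.
by rewrite cosD cosN sinN; ring.
Qed.

Lemma wave_bounds l t : l < 0 -> expR l^-1 / 5 <= wave l t <= 11 / 5 * expR l^-1.
Proof.
move=> l0; rewrite waveE//.
have := sin_geN1 (t + l^-1); have := sin_le1 (t + l^-1).
have := expR_gt0 l^-1; move: (expR _) (sin _) => e s; nra.
Qed.

(** With y = -1/l this says 11/5 exp (-y) < 2 / y, which follows from
    1 + y^2 / 2 <= exp y. *)
Lemma wave_lt l t : l < 0 -> 2 * l + wave l t < 0.
Proof.
move=> l0; have /andP[_ H] := wave_bounds t l0.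
apply: (le_lt_trans (lerD (lexx _) H)).
pose y := - l^-1; have y0 : 0 < y by rewrite /y oppr_gt0 invr_lt0.
have -> : l = - y^-1 by rewrite /y invrN invrK opprK.
rewrite invrN invrK expRN mulrN addrC subr_lt0.
have Hy : 1 + y ^+ 2 / 2 <= expR y by exact: (expR_ge1Dxn 1 (ltW y0)).
rewrite ltr_pdivrMr ?expR_gt0// mulrAC ltr_pdivlMr//.
apply: (@lt_le_trans _ _ (2 * (1 + y ^+ 2 / 2))); last by rewrite ler_pM2l.
by have := sqr_ge0 (y - 11 / 10); rewrite !expr2; nra.
Qed.

(** The logarithm of exp F |z|^2 / Q; the flow below is gradient-like for it. *)
Definition ham l t : R := 2 * l + pot l t.

(** The value ham l t is a convex combination, with weight cutoff l, of 2 l and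
    - wave l t. *)
Lemma ham_le l t : l < 0 ->
  ham l t <= Num.max (2 * l) (- (expR l^-1 / 5)).
Proof.
move=> l0; rewrite /ham potE.
have /andP[H _] := wave_bounds t l0.
have k0 := cutoff_ge0 l; have k1 := cutoff_le1 l.
set M := Num.max _ _.
have M1 : 2 * l <= M by rewrite /M le_max lexx.
have M2 : - (expR l^-1 / 5) <= M by rewrite /M le_max lexx orbT.
have -> : 2 * l - cutoff l * (2 * l + wave l t) =
  (1 - cutoff l) * (2 * l) + cutoff l * - wave l t by ring.
have -> : M = (1 - cutoff l) * M + cutoff l * M by ring.
apply: lerD; apply: ler_wpM2l => //; first by rewrite subr_ge0.
by rewrite (le_trans _ M2)// lerN2.
Qed.

Lemma ham_lt0 l t : l < 0 -> ham l t < 0.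
Proof.
move=> l0; apply: (le_lt_trans (ham_le t l0)).
by rewrite gt_max; apply/andP; split; [lra|rewrite oppr_lt0 divr_gt0 ?expR_gt0].
Qed.

Lemma ham_ge l t : l < 0 -> 2 * l <= ham l t.
Proof.
move=> l0; rewrite /ham potE lerDl -mulrN mulr_ge0 ?cutoff_ge0//.
by rewrite oppr_ge0 ltW// wave_lt.
Qed.

Lemma ham_near l t : - 2^-1 <= l -> l < 0 -> ham l t = - wave l t.
Proof. by move=> l1 l0; rewrite /ham potE cutoff1//; ring. Qed.

(** In l the derivative of ham is a sum of nonnegative terms, the last of which
    is cutoff l * dwave l t. If the derivative in t vanishes then
    cos (t + 1/l) = 0, so that dwave is a positive multiple of
    6/5 + sin (t + 1/l) >= 1/5. *)
Lemma ham_noncritical l t : l < 0 -> pott l t = 0 -> 0 < 2 + potl l t.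
Proof.
move=> l0 Ht; rewrite potlE.
have kd := dcutoff_ge0 l; have W := wave_lt t l0.
have k1 := cutoff_le1 l.
have -> : 2 - (dcutoff l * (2 * l + wave l t) + cutoff l * (2 - dwave l t)) =
   dcutoff l * (- (2 * l + wave l t)) + 2 * (1 - cutoff l) + cutoff l * dwave l t by ring.
have P1 : 0 <= dcutoff l * (- (2 * l + wave l t)).
  by rewrite mulr_ge0// oppr_ge0 ltW.
have [l1|l1] := leP l (-1); first by rewrite cutoff0// in k1 *; lra.
have kp := cutoff_gt0 l1.
suff : 0 < dwave l t by move: (dwave l t) => z z0; nra.
rewrite dwaveE//; have /eqP := Ht; rewrite pott_waveE// oppr_eq0.
rewrite mulf_eq0 (gt_eqF kp) mulf_eq0 expR_eq0 /= => /eqP ->.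
rewrite addr0; apply: mulr_gt0.
  by apply: mulr_gt0; rewrite ?expR_gt0// expr2 nmulr_rgt0 invr_lt0.
have := sin_geN1 (t + l^-1); lra.
Qed.

End Potential.

(** * Global solutions of Lipschitz planar differential equations *)

Section Primitive.
Context {R : realType}.
Notation mu := (@lebesgue_measure R).

(** On each half-line ]-N, +oo[ the integral from -N is a primitive; normalised
    at 0 these primitives agree on overlaps, which gives a global one. *)
Lemma continuous_primitive (g : R -> R) : continuous g ->
  exists P : R -> R, P 0 = 0 /\ forall s, is_derive s (1 : R) P (g s).
Proof.
move=> cg.
pose J (N x : R) := (\int[mu]_(t in `[- N, x]) g t)%R.
have dJ (N x : R) : - N < x -> is_derive x (1 : R) (J N) (g x).
  move=> Nx; have := @continuous_FTC1_closed R g (- N) x (x + 1).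
  rewrite ltrDl => /(_ ltr01) H.
  have [||d1 d2] := H _ Nx.
  - apply: continuous_compact_integrable; first exact: segment_compact.
    by apply: continuous_subspaceT.
  - exact: cg.
  - by apply: DeriveDef; [exact: d1|rewrite -derive1E d2].
pose P (N x : R) := J N x - J N 0.
have dP (N x : R) : - N < x -> is_derive x (1 : R) (P N) (g x).
  by move=> /dJ H; apply: (isd_eq (isdD H (isd_cst (- J N 0) x))); rewrite addr0.
have PP (N M x : R) : 0 < N -> 0 < M -> - N < x -> - M < x -> P N x = P M x.
  move=> N0 M0 Nx Mx; apply/eqP; rewrite -subr_eq0.
  have d (z : R) : - N < z -> - M < z -> is_derive z (1 : R) (fun z => P N z - P M z) 0.
    by move=> Nz Mz; apply: (isd_eq (isdD (dP N z Nz) (isdN (dP M z Mz)))); rewrite subrr.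
  have E0 : P N 0 - P M 0 = 0 by rewrite /P !subrr.
  have [x0|x0] := leP 0 x.
    rewrite -[X in _ == X]E0 eq_sym; apply/eqP; apply: (@isd_cst_on R (fun z => P N z - P M z) 0 x x0) => z /andP[z0 _].
    by apply: d; rewrite (lt_le_trans _ z0)// oppr_lt0.
  rewrite -[X in _ == X]E0; apply/eqP; apply: (@isd_cst_on R (fun z => P N z - P M z) x 0 (ltW x0)) => z /andP[xz _].
  by apply: d; apply: lt_le_trans xz.
exists (fun x => P (`|x| + 1) x); split; first by rewrite /P subrr.
move=> s; apply: (@isd_near _ (P (`|s| + 2))); last first.
  by apply: dP; rewrite ltrNl (le_lt_trans (ler_norm _))// normrN ltrDl.
near=> x; apply: PP; rewrite ?ltr_wpDl//.
- have H : `|s - x| < 1 by near: x; apply: cvgr_dist_lt => //; exact: cvg_id.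
  have := ler_norm (- s); rewrite normrN.
  by have := ler_norm (s - x); lra.
- by rewrite ltrNl (le_lt_trans (ler_norm _))// normrN ltrDl.
Unshelve. all: by end_near. Qed.

End Primitive.

Section Sandwich.
Context {R : realType}.

Lemma half_pow_small (A e : R) : 0 < e -> exists k, A * 2^-1 ^+ k < e.
Proof.
move=> e0; pose k := Num.bound (A / e); exists k.
rewrite exprVn ltr_pdivrMr ?exprn_gt0// mulrC -ltr_pdivrMr//.
have [A0|A0] := leP (A / e) 0; first by rewrite (le_lt_trans A0)// exprn_gt0.
rewrite (lt_trans (archi_boundP (ltW A0)))// -natrX ltr_nat.
exact: ltn_expl.
Qed.

(** The intervals [u k - 2 A / 2^k, u k + 2 A / 2^k] are nested; the limit is the
    supremum of their left ends. *)
Lemma geometric_limit (u : nat -> R) (A : R) :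
  (forall k, `|u k.+1 - u k| <= A * 2^-1 ^+ k) ->
  exists x, forall k, `|u k - x| <= 2 * A * 2^-1 ^+ k.
Proof.
move=> uA.
pose v k := u k - 2 * A * 2^-1 ^+ k.
pose w k := u k + 2 * A * 2^-1 ^+ k.
have A0 : 0 <= A.
  by have := uA 0%N; rewrite expr0 mulr1; apply: le_trans.
have vS k : v k <= v k.+1.
  have := uA k; rewrite ler_norml => /andP[H _]; rewrite /v exprS.
  have -> : 2 * A * (2^-1 * 2^-1 ^+ k) = A * 2^-1 ^+ k by field.
  lra.
have wS k : w k.+1 <= w k.
  have := uA k; rewrite ler_norml => /andP[_ H]; rewrite /w exprS.
  have -> : 2 * A * (2^-1 * 2^-1 ^+ k) = A * 2^-1 ^+ k by field.
  lra.
have vm j k : (j <= k)%N -> v j <= v k.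
  by move=> jk; rewrite -(subnKC jk); elim: (_ - _)%N => [|n IH]; rewrite ?addn0// addnS (le_trans IH).
have wm j k : (j <= k)%N -> w k <= w j.
  by move=> jk; rewrite -(subnKC jk); elim: (_ - _)%N => [|n IH]; rewrite ?addn0// addnS (le_trans _ IH).
have vw k : v k <= w k.
  rewrite /v /w lerD2l -subr_ge0 opprK addr_ge0// !mulr_ge0//;
  by rewrite exprn_ge0.
have vwjk j k : v j <= w k.
  apply: (le_trans (vm j (maxn j k) (leq_maxl _ _))).
  by apply: (le_trans (vw _)); apply: wm; exact: leq_maxr.
have hs : has_sup (range v).
  by split; [exists (v 0%N), 0%N|exists (w 0%N) => _ [j _ <-]].
exists (sup (range v)) => k.
have H1 : v k <= sup (range v) by apply: ub_le_sup; [case: hs|exists k].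
have H2 : sup (range v) <= w k by apply: ge_sup; [case: hs|move=> _ [j _ <-]].
rewrite ler_norml; move: H1 H2; rewrite /v /w => H1 H2.
by apply/andP; split; lra.
Qed.

Lemma small_eq (x y A : R) : (forall k, `|x - y| <= A * 2^-1 ^+ k) -> x = y.
Proof.
move=> H; apply/eqP; rewrite -subr_eq0 -normr_eq0 eq_le normr_ge0 andbT.
rewrite leNgt; apply/negP => /(half_pow_small A)[k]; rewrite ltNge => /negP; apply.
exact: H.
Qed.

End Sandwich.

Section Gronwall.
Context {R : realType}.

(** phi s exp (M s) is nondecreasing and phi s exp (- M s) is nonincreasing, so
    the zeros of phi propagate in both directions. *)
Lemma gronwall_zero (phi dphi : R -> R) (M a b : R) : a <= b ->
  (forall s, a <= s <= b -> is_derive s (1 : R) phi (dphi s)) ->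
  (forall s, 0 <= phi s) ->
  (forall s, a <= s <= b -> `|dphi s| <= M * phi s) ->
  (phi a = 0 <-> phi b = 0).
Proof.
move=> ab d p0 dM.
have E (z : R) (N : R) : is_derive z (1 : R) (fun s => expR (N * s)) (expR (N * z) * N).
  by apply: (isd_eq (isd_expR (isdM (isd_cst N z) (isd_id z)))); rewrite mul0r add0r mulr1.
have H1 : phi a * expR (M * a) <= phi b * expR (M * b).
  apply: (@isd_nondecr _ (fun s => phi s * expR (M * s)) (fun s => (dphi s + M * phi s) * expR (M * s))) => // z zab.
    by apply: (isd_eq (isdM (d z zab) (E z M))); ring.
  rewrite mulr_ge0 ?expR_ge0//; have := dM z zab; rewrite ler_norml => /andP[+ _]; lra.
have H2 : - (phi a * expR (- M * a)) <= - (phi b * expR (- M * b)).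
  apply: (@isd_nondecr _ (fun s => - (phi s * expR (- M * s))) (fun s => (- dphi s + M * phi s) * expR (- M * s))) => // z zab.
    by apply: (isd_eq (isdN (isdM (d z zab) (E z (- M))))); ring.
  rewrite mulr_ge0 ?expR_ge0//; have := dM z zab; rewrite ler_norml => /andP[_]; lra.
split => h0.
  apply/eqP; rewrite eq_le p0 andbT; move: H2; rewrite h0 mul0r lerN2.
  by rewrite pmulr_lle0 ?expR_gt0.
apply/eqP; rewrite eq_le p0 andbT; move: H1; rewrite h0 mul0r.
by rewrite pmulr_lle0 ?expR_gt0.
Qed.

(** The bounds c exp (K |s|) are those in which the Picard iteration contracts:
    integrating divides by K. *)
Lemma expR_bound_primitive (phi dphi : R -> R) (c K : R) : 0 <= c -> 0 < K ->
  phi 0 = 0 -> (forall s, is_derive s (1 : R) phi (dphi s)) ->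
  (forall s, `|dphi s| <= c * K * expR (K * `|s|)) ->
  forall s, `|phi s| <= c * expR (K * `|s|).
Proof.
move=> c0 K0 phi0 d dB.
suff H (f df : R -> R) (s : R) : 0 <= s -> f 0 = 0 ->
    (forall s, is_derive s (1 : R) f (df s)) ->
    (forall s, 0 <= s -> df s <= c * K * expR (K * s)) ->
    f s <= c * expR (K * s).
  move=> s; have [s0|s0] := leP 0 s.
    rewrite (ger0_norm s0) ler_norml lerNl; apply/andP; split.
      apply: (H (fun s => - phi s) (fun s => - dphi s)) => //.
      - by rewrite phi0 oppr0.
      - move=> z z0; have := dB z; rewrite (ger0_norm z0) ler_norml => /andP[+ _]; lra.
    apply: (H phi dphi) => // z z0; apply: le_trans (ler_norm _) _.
    by have := dB z; rewrite (ger0_norm z0).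
  have dN (f df : R -> R) (z : R) : (forall s, is_derive s (1 : R) f (df s)) ->
      is_derive z (1 : R) (fun s => f (- s)) (- df (- z)).
    by move=> h; apply: (isd_eq (isd_comp (h (- z)) (isdN (isd_id z)))); rewrite mulrN1.
  rewrite -[in phi s](opprK s) (ltr0_norm s0) ler_norml lerNl; apply/andP; split.
    apply: (H (fun s => - phi (- s)) (fun s => dphi (- s))); first by lra.
    - by rewrite oppr0 phi0 oppr0.
    - by move=> z; apply: (isd_eq (isdN (dN phi dphi z d))); rewrite opprK.
    - by move=> z z0; apply: le_trans (ler_norm _) _; have := dB (- z); rewrite normrN (ger0_norm z0).
  apply: (H (fun s => phi (- s)) (fun s => - dphi (- s))); first by lra.
  - by rewrite oppr0 phi0.
  - move=> z z0; apply: le_trans (ler_norm _) _; rewrite normrN.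
    by have := dB (- z); rewrite normrN (ger0_norm z0).
move=> s0 f0 fd fB.
have : c * expR (K * 0) - f 0 <= c * expR (K * s) - f s.
  apply: (@isd_nondecr _ (fun s => c * expR (K * s) - f s)
      (fun s => c * K * expR (K * s) - df s)) => // z /andP[z0 _].
    apply: (isd_eq (isdD (isdM (isd_cst c z) (isd_expR (isdM (isd_cst K z) (isd_id z)))) (isdN (fd z)))).
    by ring.
  by rewrite subr_ge0 fB.
rewrite mulr0 expR0 f0 subr0 mulr1 => H.
by rewrite -subr_ge0 (le_trans c0).
Qed.

End Gronwall.

Section Picard.
Context {R : realType}.
Variables (W1 W2 : R -> R -> R) (L : R).
Implicit Types s z t : R.
Hypothesis L0 : 0 < L.
Hypothesis W1L : forall a b a' b', `|W1 a b - W1 a' b'| <= L * (`|a - a'| + `|b - b'|).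
Hypothesis W2L : forall a b a' b', `|W2 a b - W2 a' b'| <= L * (`|a - a'| + `|b - b'|).

Lemma lip_continuous (W : R -> R -> R) (x y : R -> R) :
  (forall a b a' b', `|W a b - W a' b'| <= L * (`|a - a'| + `|b - b'|)) ->
  continuous x -> continuous y -> continuous (fun s => W (x s) (y s)).
Proof.
move=> WL cx cy s; apply/cvgrPdist_lt => e e0.
have e2 : 0 < e / (2 * L) by rewrite divr_gt0// mulr_gt0.
near=> z; apply: (le_lt_trans (WL _ _ _ _)).
have H1 : `|x s - x z| < e / (2 * L) by near: z; move/cvgrPdist_lt : (cx s); apply.
have H2 : `|y s - y z| < e / (2 * L) by near: z; move/cvgrPdist_lt : (cy s); apply.
have -> : e = L * (e / (2 * L) + e / (2 * L)) by field; rewrite gt_eqF.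
by rewrite ltr_pM2l// ltrD.
Unshelve. all: by end_near. Qed.

(** Gronwall applied to the squared distance; the equivalence expresses forward
    and backward uniqueness. *)
Lemma ode_unique (x y x' y' : R -> R) (a b : R) : a <= b ->
  (forall s, a <= s <= b -> is_derive s (1 : R) x (W1 (x s) (y s))
     /\ is_derive s (1 : R) y (W2 (x s) (y s))) ->
  (forall s, a <= s <= b -> is_derive s (1 : R) x' (W1 (x' s) (y' s))
     /\ is_derive s (1 : R) y' (W2 (x' s) (y' s))) ->
  (x a = x' a /\ y a = y' a) <-> (x b = x' b /\ y b = y' b).
Proof.
move=> ab d d'.
pose phi s := (x s - x' s) * (x s - x' s) + (y s - y' s) * (y s - y' s).
pose dphi s := 2 * (x s - x' s) * (W1 (x s) (y s) - W1 (x' s) (y' s))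
   + 2 * (y s - y' s) * (W2 (x s) (y s) - W2 (x' s) (y' s)).
have p0 s : 0 <= phi s by rewrite addr_ge0// -expr2 sqr_ge0.
have := @gronwall_zero _ phi dphi (4 * L) a b ab.
have phi0 s : phi s = 0 <-> (x s = x' s /\ y s = y' s).
  rewrite /phi -!expr2; split => [/eqP|[-> ->]]; last by rewrite !subrr expr0n addr0.
  by rewrite paddr_eq0 ?sqr_ge0// !sqrf_eq0 !subr_eq0 => /andP[/eqP -> /eqP ->].
move=> H; rewrite -!phi0; apply: H => // s sab.
- have [dx dy] := d s sab; have [dx' dy'] := d' s sab.
  have dX := isdD dx (isdN dx'); have dY := isdD dy (isdN dy').
  by apply: (isd_eq (isdD (isdM dX dX) (isdM dY dY))); rewrite /dphi; ring.
- rewrite /phi /dphi.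
  have := W1L (x s) (y s) (x' s) (y' s); have := W2L (x s) (y s) (x' s) (y' s).
  set u := x s - _; set v := y s - _; set w1 := W1 _ _ - _; set w2 := W2 _ _ - _.
  move=> h2 h1; apply: (le_trans (ler_normD _ _)); rewrite !normrM normr_nat.
  rewrite -(expr2 u) -(expr2 v) -(real_normK (num_real u)) -(real_normK (num_real v)).
  have := normr_ge0 u; have := normr_ge0 v.
  move: `|u| `|v| `|w1| `|w2| h1 h2 => U V A B h1 h2 V0 U0.
  have H1 : 2 * U * A <= 2 * U * (L * (U + V)) by rewrite ler_wpM2l// mulr_ge0.
  have H2 : 2 * V * B <= 2 * V * (L * (U + V)) by rewrite ler_wpM2l// mulr_ge0.
  apply: (le_trans (lerD H1 H2)).
  have := mulr_ge0 (ltW L0) (sqr_ge0 (U - V)); rewrite !expr2; nra.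
Qed.

(** Picard iteration in the norm sup |u s| exp (- K |s|) with K = 4 L: one step
    divides distances by two, so the iteration converges on the whole line
    without patching local solutions. *)
Lemma ode_exists (x0 y0 : R) : exists x y : R -> R,
  [/\ x 0 = x0, y 0 = y0,
      forall s, is_derive s (1 : R) x (W1 (x s) (y s)) &
      forall s, is_derive s (1 : R) y (W2 (x s) (y s))].
Proof.
have [prim primP] : exists prim : (R -> R) -> R -> R, forall g, continuous g ->
    prim g 0 = 0 /\ forall s, is_derive s (1 : R) (prim g) (g s).
  suff /(@choice _ _ (fun g (P : R -> R) => continuous g ->
    P 0 = 0 /\ forall s, is_derive s (1 : R) P (g s)))[f Hf] : forall g : R -> R,
    exists P : R -> R, continuous g ->
      P 0 = 0 /\ forall s, is_derive s (1 : R) P (g s) by exists f.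
  move=> g.
  have [cg|ncg] := pselect (continuous g).
    by have [P PP] := continuous_primitive cg; exists P.
  by exists (fun=> 0).
pose K := 4 * L; have K0 : 0 < K by rewrite mulr_gt0.
pose step (z : (R -> R) * (R -> R)) : (R -> R) * (R -> R) :=
  (fun s => x0 + prim (fun s => W1 (z.1 s) (z.2 s)) s,
   fun s => y0 + prim (fun s => W2 (z.1 s) (z.2 s)) s).
pose zs k := iter k step (fun=> x0, fun=> y0).
pose X k := (zs k).1; pose Y k := (zs k).2.
have stepd (z : (R -> R) * (R -> R)) : continuous z.1 -> continuous z.2 ->
   [/\ (step z).1 0 = x0, (step z).2 0 = y0,
    forall s, is_derive s (1 : R) (step z).1 (W1 (z.1 s) (z.2 s)) &
    forall s, is_derive s (1 : R) (step z).2 (W2 (z.1 s) (z.2 s))].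
  move=> c1 c2.
  have [p1 d1] := primP _ (lip_continuous W1L c1 c2).
  have [p2 d2] := primP _ (lip_continuous W2L c1 c2).
  split; rewrite /= ?p1 ?p2 ?addr0// => s.
    by apply: (isd_eq (isdD (isd_cst x0 s) (d1 s))); rewrite add0r.
  by apply: (isd_eq (isdD (isd_cst y0 s) (d2 s))); rewrite add0r.
have cXY k : continuous (X k) /\ continuous (Y k).
  elim: k => [|k [c1 c2]]; first by split; exact: cst_continuous.
  have [_ _ d1 d2] := stepd _ c1 c2.
  by split => s; [exact: isd_continuous (d1 s)|exact: isd_continuous (d2 s)].
have XYd k : [/\ X k.+1 0 = x0, Y k.+1 0 = y0,
    forall s, is_derive s (1 : R) (X k.+1) (W1 (X k s) (Y k s)) &
    forall s, is_derive s (1 : R) (Y k.+1) (W2 (X k s) (Y k s))].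
  by have [c1 c2] := cXY k; exact: stepd.
(* With this C the derivatives W1 x0 y0 and W2 x0 y0 of the first iterates are at most C * K. *)
pose C := (`|W1 x0 y0| + `|W2 x0 y0|) / K.
have C0 : 0 <= C by rewrite divr_ge0 ?addr_ge0// ltW.
have eK s : 1 <= expR (K * `|s|).
  by rewrite -expR0 ler_expR mulr_ge0// ltW.
have XYk k s : `|X k.+1 s - X k s| <= C * 2^-1 ^+ k * expR (K * `|s|) /\
               `|Y k.+1 s - Y k s| <= C * 2^-1 ^+ k * expR (K * `|s|).
  elim: k s => [|k IHk] s.
    have [e1 e2 d1 d2] := XYd 0%N.
    rewrite expr0 mulr1; split.
    - apply: (@expR_bound_primitive _ (fun s => X 1%N s - X 0%N s) (fun=> W1 x0 y0)) => //.
      + by rewrite e1 subrr.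
      + by move=> z; apply: (isd_eq (isdD (d1 z) (isdN (isd_cst x0 z)))); rewrite subr0.
      + move=> z; rewrite /C divfK ?gt_eqF//.
        have H := eK z; have H0 := normr_ge0 (W1 x0 y0); have H1 := normr_ge0 (W2 x0 y0).
        nra.
    - apply: (@expR_bound_primitive _ (fun s => Y 1%N s - Y 0%N s) (fun=> W2 x0 y0)) => //.
      + by rewrite e2 subrr.
      + by move=> z; apply: (isd_eq (isdD (d2 z) (isdN (isd_cst y0 z)))); rewrite subr0.
      + move=> z; rewrite /C divfK ?gt_eqF//.
        have H := eK z; have H0 := normr_ge0 (W1 x0 y0); have H1 := normr_ge0 (W2 x0 y0).
        nra.
  have [e1 e2 d1 d2] := XYd k.+1; have [e1' e2' d1' d2'] := XYd k.
  have Ck0 : 0 <= C * 2^-1 ^+ k.+1 by rewrite mulr_ge0// exprn_ge0.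
  have B (W : R -> R -> R) z :
      (forall a b a' b', `|W a b - W a' b'| <= L * (`|a - a'| + `|b - b'|)) ->
      `|W (X k.+1 z) (Y k.+1 z) - W (X k z) (Y k z)| <=
         C * 2^-1 ^+ k.+1 * K * expR (K * `|z|).
    move=> WL; have [h1 h2] := IHk z; apply: (le_trans (WL _ _ _ _)).
    have -> : C * 2^-1 ^+ k.+1 * K * expR (K * `|z|) =
      L * (C * 2^-1 ^+ k * expR (K * `|z|) + C * 2^-1 ^+ k * expR (K * `|z|)).
      by rewrite exprS /K; field.
    by rewrite ler_pM2l// lerD.
  split.
  - apply: (@expR_bound_primitive _ (fun s => X k.+2 s - X k.+1 s)
      (fun s => W1 (X k.+1 s) (Y k.+1 s) - W1 (X k s) (Y k s))) => //.
    + by rewrite e1 e1' subrr.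
    + by move=> z; exact: B.
  - apply: (@expR_bound_primitive _ (fun s => Y k.+2 s - Y k.+1 s)
      (fun s => W2 (X k.+1 s) (Y k.+1 s) - W2 (X k s) (Y k s))) => //.
    + by rewrite e2 e2' subrr.
    + by move=> z; exact: B.
have lim (U : nat -> R -> R) :
    (forall k s, `|U k.+1 s - U k s| <= C * 2^-1 ^+ k * expR (K * `|s|)) ->
    exists u : R -> R, forall s k, `|U k s - u s| <= 2 * (C * expR (K * `|s|)) * 2^-1 ^+ k.
  move=> HU.
  suff /(@choice _ _ (fun s us => forall k,
      `|U k s - us| <= 2 * (C * expR (K * `|s|)) * 2^-1 ^+ k))[f Hf] :
    forall s, exists us : R, forall k,
      `|U k s - us| <= 2 * (C * expR (K * `|s|)) * 2^-1 ^+ k by exists f.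
  by move=> s; apply: geometric_limit => k; rewrite mulrAC; exact: HU.
have [x Hx] := lim X (fun k s => (XYk k s).1).
have [y Hy] := lim Y (fun k s => (XYk k s).2).
have ulim (U : nat -> R -> R) (u : R -> R) : (forall k, continuous (U k)) ->
    (forall s k, `|U k s - u s| <= 2 * (C * expR (K * `|s|)) * 2^-1 ^+ k) ->
    continuous u.
  move=> cU HU s; apply/cvgrPdist_lt => e e0.
  have e3 : 0 < e / 3 by rewrite divr_gt0.
  have [k Hk] := half_pow_small (2 * (C * expR (K * (`|s| + 1)))) e3.
  near=> z.
  have z1 : `|z| <= `|s| + 1.
    have H : `|s - z| < 1 by near: z; apply: cvgr_dist_lt => //; exact: cvg_id.
    have := ler_normD s (z - s); rewrite (addrC s) subrK (distrC z).
    by move=> /le_trans; apply; rewrite lerD2l ltW.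
  have Hb t : `|t| <= `|s| + 1 -> `|U k t - u t| < e / 3.
    move=> ht; apply: le_lt_trans Hk; apply: (le_trans (HU t k)).
    rewrite ler_wpM2r ?exprn_ge0// ler_pM2l// ler_wpM2l// ler_expR ler_pM2l//.
  have b1 := Hb z z1.
  have b2 : `|U k s - u s| < e / 3 by apply: Hb; rewrite lerDl.
  have b3 : `|U k s - U k z| < e / 3.
    by near: z; move/cvgrPdist_lt : (cU k s); apply.
  move: b1 b2 b3; rewrite !ltr_norml => /andP[? ?] /andP[? ?] /andP[? ?].
  by apply/andP; split; lra.
have cx := ulim X x (fun k => (cXY k).1) Hx.
have cy := ulim Y y (fun k => (cXY k).2) Hy.
have [e1 e2 d1 d2] := stepd (x, y) cx cy.
have fix1 (W : R -> R -> R) (u g : R -> R) (U : nat -> R -> R) :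
    (forall a b a' b', `|W a b - W a' b'| <= L * (`|a - a'| + `|b - b'|)) ->
    (forall s k, `|U k s - u s| <= 2 * (C * expR (K * `|s|)) * 2^-1 ^+ k) ->
    (forall k, U k.+1 0 = g 0) ->
    (forall k s, is_derive s (1 : R) (U k.+1) (W (X k s) (Y k s))) ->
    (forall s, is_derive s (1 : R) g (W (x s) (y s))) -> u = g.
  move=> WL HU U0 dU dg; apply/funext => s.
  apply: (@small_eq _ _ _ (2 * (C * expR (K * `|s|)))) => k.
  have Ck0 : 0 <= C * 2^-1 ^+ k by rewrite mulr_ge0// exprn_ge0.
  have H1 : `|U k.+1 s - g s| <= C * 2^-1 ^+ k * expR (K * `|s|).
    apply: (@expR_bound_primitive _ (fun s => U k.+1 s - g s)
      (fun s => W (X k s) (Y k s) - W (x s) (y s))) => //.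
    - by rewrite U0 subrr.
    - move=> z; apply: (le_trans (WL _ _ _ _)).
      have -> : C * 2^-1 ^+ k * K * expR (K * `|z|) =
        L * (2 * (C * expR (K * `|z|)) * 2^-1 ^+ k
           + 2 * (C * expR (K * `|z|)) * 2^-1 ^+ k) by rewrite /K; ring.
      by rewrite ler_pM2l// lerD.
  have H2 := HU s k.+1.
  have -> : u s - g s = (U k.+1 s - g s) - (U k.+1 s - u s) by ring.
  apply: (le_trans (ler_normB _ _)); apply: (le_trans (lerD H1 H2)).
  by rewrite exprS le_eqVlt; apply/orP; left; apply/eqP; field.
exists x, y; split.
- rewrite (fix1 W1 x _ X W1L Hx _ _ d1) ?e1// => k; have [] := XYd k => //.
- rewrite (fix1 W2 y _ Y W2L Hy _ _ d2) ?e2// => k; have [] := XYd k => //.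
- move=> s; rewrite [X in is_derive _ _ X _](fix1 W1 x _ X W1L Hx _ _ d1)// => k; have [] := XYd k => //.
  by move=> ->; rewrite e1.
- move=> s; rewrite [X in is_derive _ _ X _](fix1 W2 y _ Y W2L Hy _ _ d2)// => k; have [] := XYd k => //.
  by move=> _ ->; rewrite e2.
Unshelve. all: by end_near. Qed.

End Picard.

(** * The flow governing the symmetric planes *)

Section Blip.
Context {R : realType}.
Implicit Types (x y s t l : R).

(** Products of bounded Lipschitz functions are Lipschitz; boundedness by the same
    constant avoids a second one. *)
Definition bounded_lipschitz (f : R -> R) := exists C : R,
  [/\ 0 <= C, forall x, `|f x| <= C & forall x y, `|f x - f y| <= C * `|x - y|].

Lemma lipschitz_of_derive (f df : R -> R) (C : R) :
  (forall x, is_derive x (1 : R) f (df x)) -> (forall x, `|df x| <= C) ->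
  forall x y, `|f x - f y| <= C * `|x - y|.
Proof.
move=> fd dC; suff H x y : x <= y -> `|f x - f y| <= C * `|x - y|.
  move=> x y; have [xy|/ltW yx] := leP x y; first exact: H.
  by rewrite distrC (distrC x); exact: H.
move=> xy; have cf : {within `[x, y], continuous f}.
  by apply: continuous_subspaceT => z; exact: isd_continuous (fd z).
have [c _] := MVT_segment xy (fun z _ => fd z) cf.
by rewrite distrC => ->; rewrite normrM (distrC x) ler_wpM2r.
Qed.

Lemma Ck_at1_isd k (f : R -> R) x : Ck_at k.+1 f x ->
  is_derive x (1 : R) f ('D_1 f x).
Proof.
move=> [/nbhs_singleton /derivable1_diffP df _]; exact: DeriveDef.
Qed.

(** A C^1 function constant on both sides of [-1, 0] has a bounded derivative. *)
Lemma bounded_lipschitz_Ck_at (f : R -> R) (a b : R) : (forall x, Ck_at 1 f x) ->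
  (forall x, x <= -1 -> f x = a) -> (forall x, 0 <= x -> f x = b) -> bounded_lipschitz f.
Proof.
move=> sf fa fb.
have fd x : is_derive x (1 : R) f ('D_1 f x) by exact: Ck_at1_isd (sf x).
have cD : continuous ('D_1 f) by move=> x; have [_ H] := sf x; exact: (H 1).
have N10 : -1 <= 0 :> R by lra.
have [c _ Hc] := @EVT_max R (fun x => `|'D_1 f x|) (-1) 0 N10
  (continuous_subspaceT (fun x => cvg_norm (cD x))).
pose C := `|'D_1 f c|.
have dC x : `|'D_1 f x| <= C.
  have [x1|x1] := ltP x (-1).
    suff -> : 'D_1 f x = 0 by rewrite normr0 /C normr_ge0.
    apply: isd_val; apply: (isd_near _ (isd_cst a x)).
    by near=> z; rewrite fa// ltW//; near: z; exact: lt_nbhsl.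
  have [x0|x0] := ltP 0 x.
    suff -> : 'D_1 f x = 0 by rewrite normr0 /C normr_ge0.
    apply: isd_val; apply: (isd_near _ (isd_cst b x)).
    by near=> z; rewrite fb// ltW//; near: z; exact: lt_nbhsr.
  by apply: Hc; rewrite in_itv/= x1 x0.
have fL := lipschitz_of_derive fd dC.
have C0 : 0 <= C by rewrite normr_ge0.
exists (`|a| + `|b| + C); split; first by rewrite !addr_ge0.
- move=> x; have [x1|x1] := ltP x (-1).
    by rewrite (fa _ (ltW x1)) -addrA lerDl addr_ge0.
  have [x0|x0] := ltP 0 x.
    by rewrite (fb _ (ltW x0)) addrAC lerDr addr_ge0.
  have -> : f x = f (-1) + (f x - f (-1)) by rewrite addrC subrK.
  apply: (le_trans (ler_normD _ _)); rewrite fa//.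
  apply: (@le_trans _ _ (`|a| + C)); last by rewrite lerD2r lerDl.
  rewrite lerD2l -(fa (-1))//; apply: (le_trans (fL _ _)).
  by rewrite ler_piMr// ler_norml; apply/andP; split; lra.
- move=> x y; apply: (le_trans (fL _ _)).
  by rewrite ler_wpM2r// lerDr addr_ge0.
Unshelve. all: by end_near. Qed.

Lemma sin_lip x y : `|sin x - sin y| <= `|x - y|.
Proof.
by rewrite -[leRHS]mul1r; apply: (lipschitz_of_derive (@is_derive_sin R)) => z; exact: cos_max.
Qed.

Lemma cos_lip x y : `|cos x - cos y| <= `|x - y|.
Proof.
rewrite -[leRHS]mul1r; apply: (lipschitz_of_derive (@is_derive_cos R)) => z.
by rewrite normrN; exact: sin_max.
Qed.

Lemma trig_lip (z0 z1 z2 : R -> R) : bounded_lipschitz z0 -> bounded_lipschitz z1 -> bounded_lipschitz z2 ->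
  exists2 L : R, 0 < L & forall a b a' b',
   `|(z0 a + z1 a * sin b + z2 a * cos b) -
     (z0 a' + z1 a' * sin b' + z2 a' * cos b')| <= L * (`|a - a'| + `|b - b'|).
Proof.
move=> [C0 [c0 b0 l0]] [C1 [c1 b1 l1]] [C2 [c2 b2 l2]].
exists (C0 + C1 + C2 + 1) => [|a b a' b']; first by rewrite ltr_wpDl// !addr_ge0.
have -> : (z0 a + z1 a * sin b + z2 a * cos b) - (z0 a' + z1 a' * sin b' + z2 a' * cos b')
  = (z0 a - z0 a') + ((z1 a - z1 a') * sin b + z1 a' * (sin b - sin b'))
    + ((z2 a - z2 a') * cos b + z2 a' * (cos b - cos b')) by ring.
have D0 := normr_ge0 (a - a'); have E0 := normr_ge0 (b - b').
have H (z : R -> R) (C u u' : R) : (forall x, `|z x| <= C) ->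
   (forall x y, `|z x - z y| <= C * `|x - y|) -> `|u| <= 1 -> `|u - u'| <= `|b - b'| ->
   `|(z a - z a') * u + z a' * (u - u')| <= C * (`|a - a'| + `|b - b'|).
  move=> zb zl u1 spiral; apply: (le_trans (ler_normD _ _)); rewrite !normrM mulrDr.
  apply: lerD; first by rewrite -[leRHS]mulr1 ler_pM.
  by rewrite ler_pM.
have h0 := l0 a a'.
have h1 := H z1 C1 _ _ b1 l1 (sin_max b) (sin_lip b b').
have h2 := H z2 C2 _ _ b2 l2 (cos_max b) (cos_lip b b').
apply: (le_trans (ler_normD _ _)); apply: (le_trans (lerD (ler_normD _ _) (lexx _))).
apply: (le_trans (lerD (lerD h0 h1) h2)).
nra.
Qed.

End Blip.

Section Flow.
Context {R : realType}.
Variable Q : R.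
Hypothesis Q0 : 0 < Q.
Implicit Types (x y s t l : R).

(** The right-hand sides of the equations for (lam, th), that is, for the
    logarithmic radius and for theta in terms of s = ln |w|. *)
Definition flowl l t : R := 1 + potl l t / 2.
Definition flowt l t : R := Q ^+ 2 / 2 * expR (4 * l) * pott l t.

Lemma Ck_at_exp_lin k (c l : R) : Ck_at k (fun l => expR (c * l)) l.
Proof.
apply: (@Ck_at_comp R R k expR (fun l => c * l)); first exact: Ck_at_expR.
by apply: Ck_atZ; exact: Ck_at_id.
Qed.

Lemma pot_coef_far l : l <= -1 -> [/\ pot1 l = 0, pot2 l = 0,
  'D_1 pot0 l = 0, 'D_1 pot1 l = 0 & 'D_1 pot2 l = 0].
Proof.
move=> l1; rewrite (isd_val (isd_pot0 l)) (isd_val (isd_pot1 l)) (isd_val (isd_pot2 l)).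
by rewrite /pot1 /pot2 cutoff0// dcutoff0// !mul0r !subr0 ?addr0 oppr0.
Qed.

Lemma pot_coef_out l : 0 <= l -> [/\ pot1 l = 0, pot2 l = 0,
  'D_1 pot0 l = -2, 'D_1 pot1 l = 0 & 'D_1 pot2 l = 0].
Proof.
move=> l0; rewrite (isd_val (isd_pot0 l)) (isd_val (isd_pot1 l)) (isd_val (isd_pot2 l)).
have l2 : - l <= 0 by lra.
rewrite /pot1 /pot2 dcutoff1 ?cutoff1; try by lra.
by rewrite !flat_wave_le0// !mul1r !mul0r !subr0 ?addr0 ?add0r oppr0.
Qed.

Lemma flowl_lip : exists2 L : R, 0 < L & forall a b a' b',
  `|flowl a b - flowl a' b'| <= L * (`|a - a'| + `|b - b'|).
Proof.
have [L L0 H] : exists2 L : R, 0 < L & forall a b a' b',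
   `|('D_1 pot0 a + 'D_1 pot1 a * sin b + (- 'D_1 pot2 a) * cos b) -
     ('D_1 pot0 a' + 'D_1 pot1 a' * sin b' + (- 'D_1 pot2 a') * cos b')| <= L * (`|a - a'| + `|b - b'|).
  apply: (@trig_lip _ ('D_1 pot0) ('D_1 pot1) (fun l => - 'D_1 pot2 l)).
  - apply: (@bounded_lipschitz_Ck_at _ _ 0 (-2)) => x; first by have [h0 h1 h2] := Ck_at_dpot 1 x; exact: h0.
      by move=> /pot_coef_far[].
    by move=> /pot_coef_out[].
  - apply: (@bounded_lipschitz_Ck_at _ _ 0 0) => x; first by have [h0 h1 h2] := Ck_at_dpot 1 x; exact: h1.
      by move=> /pot_coef_far[].
    by move=> /pot_coef_out[].
  - apply: (@bounded_lipschitz_Ck_at _ _ 0 0) => x; first by apply: Ck_atN; have [h0 h1 h2] := Ck_at_dpot 1 x; exact: h2.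
      by move=> /pot_coef_far[_ _ _ _ ->]; rewrite oppr0.
    by move=> /pot_coef_out[_ _ _ _ ->]; rewrite oppr0.
exists (L / 2) => [|a b a' b']; first by rewrite divr_gt0.
have := H a b a' b'; rewrite /flowl /potl !mulNr.
set A := _ - _ * cos b; set B := _ - _ * cos b'.
have -> : 1 + A / 2 - (1 + B / 2) = (A - B) / 2 by ring.
rewrite normrM [`|2^-1|]ger0_norm// => h.
by rewrite mulrAC ler_wpM2r.
Qed.

Lemma flowt_lip : exists2 L : R, 0 < L & forall a b a' b',
  `|flowt a b - flowt a' b'| <= L * (`|a - a'| + `|b - b'|).
Proof.
pose E l := Q ^+ 2 / 2 * expR (4 * l).
have sE k l : Ck_at k E l by apply: Ck_atZ; exact: Ck_at_exp_lin.
have b0 : bounded_lipschitz (fun _ : R => 0 : R).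
  by exists 0; split => // *; rewrite ?subrr normr0 ?mul0r.
have bp (p : R -> R) : (forall k l, Ck_at k p l) -> (forall l, l <= -1 -> p l = 0) ->
    (forall l, 0 <= l -> p l = 0) -> bounded_lipschitz (fun l => E l * p l).
  move=> sp p1 p2; apply: (@bounded_lipschitz_Ck_at _ _ 0 0) => x.
  - by apply: Ck_atM; [exact: sE|exact: sp].
  - by move=> /p1 ->; rewrite mulr0.
  - by move=> /p2 ->; rewrite mulr0.
have b1 : bounded_lipschitz (fun l => E l * pot1 l).
  apply: bp => [k l|l|l]; first by have [h0 h1 h2] := Ck_at_pot k l; exact: h1.
    by move=> /pot_coef_far[].
  by move=> /pot_coef_out[].
have b2 : bounded_lipschitz (fun l => E l * pot2 l).
  apply: bp => [k l|l|l]; first by have [h0 h1 h2] := Ck_at_pot k l; exact: h2.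
    by move=> /pot_coef_far[].
  by move=> /pot_coef_out[].
have [L L0 H] := trig_lip b0 b2 b1.
exists L => // a b a' b'; have := H a b a' b'; rewrite /flowt /pott !add0r.
have -> : Q ^+ 2 / 2 * expR (4 * a) * (pot1 a * cos b + pot2 a * sin b) =
  E a * pot2 a * sin b + E a * pot1 a * cos b by rewrite /E; ring.
have -> // : Q ^+ 2 / 2 * expR (4 * a') * (pot1 a' * cos b' + pot2 a' * sin b') =
  E a' * pot2 a' * sin b' + E a' * pot1 a' * cos b' by rewrite /E; ring.
Qed.

Definition orbit_of (lam th : R -> R) := forall s,
  is_derive s (1 : R) lam (flowl (lam s) (th s)) /\
  is_derive s (1 : R) th (flowt (lam s) (th s)).

(** The Fourier coefficients in t of both right-hand sides are constant for
    l <= -1 and for l >= 0, hence bounded and Lipschitz. *)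
Lemma flow_lip : exists2 L : R, 0 < L & 
  (forall a b a' b', `|flowl a b - flowl a' b'| <= L * (`|a - a'| + `|b - b'|)) /\
  (forall a b a' b', `|flowt a b - flowt a' b'| <= L * (`|a - a'| + `|b - b'|)).
Proof.
have [L1 L10 H1] := flowl_lip; have [L2 L20 H2] := flowt_lip.
exists (L1 + L2); first exact: addr_gt0.
by split => a b a' b'; [apply: le_trans (H1 _ _ _ _) _|apply: le_trans (H2 _ _ _ _) _];
  rewrite ler_wpM2r ?addr_ge0// ?lerDl ?lerDr ltW.
Qed.

Lemma orbit_shift lam th c : orbit_of lam th ->
  orbit_of (fun s => lam (s + c)) (fun s => th (s + c)).
Proof.
move=> o s; have [d1 d2] := o (s + c).
have dc : is_derive s (1 : R) (fun s => s + c) 1.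
  by apply: (isd_eq (isdD (isd_id s) (isd_cst c s))); rewrite addr0.
split.
  by apply: (isd_eq (@isd_comp R lam (fun s => s + c) s _ 1 d1 dc)); rewrite mulr1.
by apply: (isd_eq (@isd_comp R th (fun s => s + c) s _ 1 d2 dc)); rewrite mulr1.
Qed.

Lemma orbit_exists l0 t0 s0 : exists lam th,
  [/\ orbit_of lam th, lam s0 = l0 & th s0 = t0].
Proof.
have [L L0 [H1 H2]] := flow_lip.
have [x [y [x0 y0 dx dy]]] := ode_exists L0 H1 H2 l0 t0.
exists (fun s => x (s - s0)), (fun s => y (s - s0)).
rewrite subrr x0 y0; split => //; apply: (@orbit_shift x y) => s.
by split; [exact: dx|exact: dy].
Qed.

Lemma flow_out l t : 0 <= l -> flowl l t = 0 /\ flowt l t = 0.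
Proof.
move=> l0; have [_ e1 e2] := pot_out t l0.
by rewrite /flowl /flowt e1 e2 mulr0; split => //; field.
Qed.

Lemma flow_far l t : l <= -1 -> flowl l t = 1 /\ flowt l t = 0.
Proof.
by move=> l0; have [_ e1 e2] := pot_far t l0; rewrite /flowl /flowt e1 e2 mulr0 mul0r addr0.
Qed.

(** All points of l >= 0 are stationary, and solutions are unique. *)
Lemma orbit_inside lam th s0 : orbit_of lam th -> lam s0 < 0 ->
  forall s, lam s < 0.
Proof.
move=> o l0 s; rewrite ltNge; apply/negP => ls.
have [L L0 [H1 H2]] := flow_lip.
have oc z : is_derive z (1 : R) (fun=> lam s) (flowl (lam s) (th s)) /\
            is_derive z (1 : R) (fun=> th s) (flowt (lam s) (th s)).
  by have [-> ->] := flow_out (th s) ls; split; exact: isd_cst.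
suff : lam s0 = lam s by move=> e; rewrite e ltNge ls in l0.
have [ss|/ltW ss] := leP s s0.
  by have [+ _] := ode_unique L0 H1 H2 ss (fun z _ => o z) (fun z _ => oc z); case.
by have [_] := ode_unique L0 H1 H2 ss (fun z _ => o z) (fun z _ => oc z); case.
Qed.

(** In l <= -1 the field is (1, 0), and backward in time this region is not left. *)
Lemma orbit_far lam th s0 : orbit_of lam th -> lam s0 <= -1 ->
  forall s, s <= s0 -> lam s = lam s0 + (s - s0) /\ th s = th s0.
Proof.
move=> o l0 s ss.
have [L L0 [H1 H2]] := flow_lip.
have oc z : s <= z <= s0 ->
   is_derive z (1 : R) (fun z => lam s0 + (z - s0)) (flowl (lam s0 + (z - s0)) (th s0)) /\
   is_derive z (1 : R) (fun=> th s0) (flowt (lam s0 + (z - s0)) (th s0)).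
  move=> /andP[_ zs]; have lz : lam s0 + (z - s0) <= -1 by lra.
  have [-> ->] := flow_far (th s0) lz; split; last exact: isd_cst.
  apply: (isd_eq (isdD (isd_cst (lam s0) z) (isdD (isd_id z) (isd_cst (- s0) z)))).
  by rewrite add0r addr0.
have [_] := ode_unique L0 H1 H2 ss (fun z _ => o z) oc; apply.
by rewrite subrr addr0.
Qed.

Lemma orbit_Ck_at lam th : orbit_of lam th ->
  forall k s, Ck_at k lam s /\ Ck_at k th s.
Proof.
move=> o; elim => [|k IHk] s.
  by have [d1 d2] := o s; split; [exact: isd_continuous d1|exact: isd_continuous d2].
have [sl st] := IHk s.
have sc (z : R -> R) : Ck_at k z (lam s) -> Ck_at k (fun s => z (lam s)) s.
  by move=> sz; exact: (Ck_at_comp sz sl).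
have ssin : Ck_at k (fun s => sin (th s)) s by exact: (Ck_at_comp (Ck_at_sin k _) st).
have scos : Ck_at k (fun s => cos (th s)) s by exact: (Ck_at_comp (Ck_at_cos k _) st).
have [p0 p1 p2] := Ck_at_pot k (lam s); have [q0 q1 q2] := Ck_at_dpot k (lam s).
split.
- apply: (Ck_atS1T (fun s => (o s).1)); rewrite /flowl /potl.
  apply: Ck_atD; first exact: Ck_at_cst.
  apply: Ck_atM; last exact: Ck_at_cst.
  apply: Ck_atB; last by apply: Ck_atM => //; exact: (sc _ q2).
  apply: Ck_atD; first exact: (sc _ q0).
  by apply: Ck_atM => //; exact: (sc _ q1).
- apply: (Ck_atS1T (fun s => (o s).2)); rewrite /flowt /pott.
  apply: Ck_atM.
    apply: Ck_atZ; apply: (sc (fun l => expR (4 * l))); exact: Ck_at_exp_lin.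
  apply: Ck_atD; first by apply: Ck_atM => //; exact: (sc _ p1).
  by apply: Ck_atM => //; exact: (sc _ p2).
Qed.

End Flow.

(** * Long-time behaviour of the orbits *)

Section Barrier.
Context {R : realType}.
Implicit Types (s z t : R).

(** At the last time before s at which phi >= b one has phi = b, and then phi'
    is positive there, a contradiction. *)
Lemma barrier (phi dphi : R -> R) (a b : R) :
  (forall s, a <= s -> is_derive s (1 : R) phi (dphi s)) ->
  (forall s, a <= s -> phi s = b -> 0 < dphi s) ->
  b <= phi a -> forall s, a <= s -> b <= phi s.
Proof.
move=> d pos ba s as_; rewrite leNgt; apply/negP => sb.
pose A := [set z | a <= z <= s /\ b <= phi z].
have Aa : A a by split => //; rewrite lexx.
have hs : has_sup A by split; [exists a|exists s => z [/andP[]]].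
pose z := sup A.
have az : a <= z by apply: ub_le_sup => //; case: hs.
have zs : z <= s by apply: ge_sup; [exists a|move=> y [/andP[]]].
have cz : {for z, continuous phi} by exact: isd_continuous (d z az).
have bz : b <= phi z.
  rewrite leNgt; apply/negP => zb.
  have : \forall y \near z, phi y < b by exact: (cvgr_lt (phi z) cz).
  move=> /nbhs_ballP[e /= e0 He].
  have [y [/andP[ay ys] yb] zy] := sup_adherent e0 hs.
  have yz : y <= z by apply: ub_le_sup; [case: hs|split => //; apply/andP].
  have : phi y < b.
    by apply: He; rewrite /ball/= ger0_norm ?subr_ge0//; move: zy; rewrite -/z; lra.
  by rewrite ltNge yb.
have zs' : z < s.
  by rewrite lt_neqAle zs andbT; apply/eqP => e; rewrite e leNgt sb in bz.
have [zb|zb] := ltP b (phi z).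
  have : \forall y \near z, b < phi y by exact: (cvgr_gt (phi z) cz).
  move=> /nbhs_ballP[e /= e0 He].
  pose y := Num.min s (z + e / 2).
  have zy : z < y by rewrite /y lt_min zs'/= ltrDl divr_gt0.
  have : y <= z.
    apply: ub_le_sup; first by case: hs.
    split.
      by apply/andP; split; [exact: le_trans az (ltW zy)|rewrite /y ge_min lexx].
    apply/ltW/He; rewrite /ball/= distrC gtr0_norm ?subr_gt0//.
    by rewrite ltrBlDl /y gt_min; apply/orP; right; rewrite ltrD2l ltr_pdivrMr// mulr_natr mulr2n ltrDl.
  by rewrite leNgt zy.
have ez : phi z = b by apply/eqP; rewrite eq_le zb bz.
have dz := pos z az ez; have [ddz Dz] := d z az.
have H : h^-1 *: (phi (h *: (1 : R) + z) - phi z) @[h --> (0 : R)^'] --> dphi z.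
  by rewrite -Dz; exact: ddz.
have : \forall h \near (0 : R)^', 0 < h^-1 *: (phi (h *: (1 : R) + z) - phi z).
  exact: (cvgr_gt (dphi z) H).
move=> /nbhs_ballP[e /= e0 He].
pose h := Num.min (s - z) (e / 2).
have h0 : 0 < h by rewrite /h lt_min subr_gt0 zs' divr_gt0.
have : 0 < h^-1 *: (phi (h *: (1 : R) + z) - phi z).
  apply: He; last by rewrite gt_eqF.
  rewrite /ball/= sub0r normrN gtr0_norm// /h gt_min; apply/orP; right.
  by rewrite ltr_pdivrMr// mulr_natr mulr2n ltrDl.
rewrite /GRing.scale/= mulr1 pmulr_rgt0 ?invr_gt0// subr_gt0 ez => hb.
have : h + z <= z.
  apply: ub_le_sup; first by case: hs.
  split; last exact: ltW.
  apply/andP; split; first by rewrite (le_trans az)// lerDr ltW.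
  by rewrite -lerBrDr /h ge_min lexx.
by rewrite gerDr leNgt h0.
Qed.

End Barrier.

Section Asymptotics.
Context {R : realType}.
Variable Q : R.
Hypothesis Q0 : 0 < Q.
Implicit Types (x y s t l : R).

(** The derivative of ham along the flow; it is a positive definite quadratic form
    in the gradient of ham. *)
Definition speed l t : R :=
  2 * flowl l t ^+ 2 + Q ^+ 2 / 2 * expR (4 * l) * pott l t ^+ 2.

Lemma isd_ham lam th : orbit_of Q lam th -> forall s,
  is_derive s (1 : R) (fun s => ham (lam s) (th s)) (speed (lam s) (th s)).
Proof.
move=> o s; have [dl dt] := o s.
have [p0 p1 p2] : [/\ is_derive (lam s) (1 : R) pot0 ('D_1 pot0 (lam s)),
   is_derive (lam s) (1 : R) pot1 ('D_1 pot1 (lam s)) &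
   is_derive (lam s) (1 : R) pot2 ('D_1 pot2 (lam s))].
  have [h0 h1 h2] := Ck_at_pot 1 (lam s).
  by split; [exact: (Ck_at1_isd h0)|exact: (Ck_at1_isd h1)|exact: (Ck_at1_isd h2)].
have c0 := isd_comp p0 dl; have c1 := isd_comp p1 dl; have c2 := isd_comp p2 dl.
have D := isdD (isdM (isd_cst 2 s) dl)
  (isdD (isdD c0 (isdM c1 (isd_sin dt))) (isdN (isdM c2 (isd_cos dt)))).
rewrite /ham /pot; apply: (isd_eq D).
by rewrite /speed /flowt /flowl /potl /pott; field.
Qed.

Lemma speed_ge0 l t : 0 <= speed l t.
Proof.
apply: addr_ge0; first by rewrite mulr_ge0// sqr_ge0.
apply: mulr_ge0; last exact: sqr_ge0.
by rewrite mulr_ge0 ?expR_ge0// divr_ge0// sqr_ge0.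
Qed.

Lemma speed_gt0 l t : l < 0 -> 0 < speed l t.
Proof.
move=> l0; have Q2 : 0 < Q ^+ 2 / 2 by rewrite divr_gt0// exprn_gt0.
have QE : 0 < Q ^+ 2 / 2 * expR (4 * l) by rewrite mulr_gt0// expR_gt0.
have [p0|p0] := eqVneq (pott l t) 0.
  have := ham_noncritical l0 p0 => H.
  apply: ltr_wpDr; first by rewrite mulr_ge0 ?sqr_ge0// ltW.
  by rewrite mulr_gt0// exprn_gt0// /flowl; lra.
apply: ltr_wpDl; first by rewrite mulr_ge0// sqr_ge0.
by rewrite mulr_gt0// exprn_even_gt0.
Qed.

Lemma speedDpi l t m : speed l (t + 2 * pi * m%:~R) = speed l t.
Proof. by rewrite /speed /flowl; have [_ -> ->] := potDpi l t m. Qed.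

Lemma speed_continuous : continuous (fun p : R * R => speed p.1 p.2).
Proof.
move=> p; apply: (@Ck_at_cvg _ _ 0).
have sf k : Ck_at k (fun p : R * R => p.1) p by exact: Ck_at_fst.
have ss k : Ck_at k (fun p : R * R => p.2) p by exact: Ck_at_snd.
have sc k (z : R -> R) : Ck_at k z p.1 -> Ck_at k (fun p : R * R => z p.1) p.
  by move=> sz; exact: (Ck_at_comp sz (sf k)).
have ssin k : Ck_at k (fun p : R * R => sin p.2) p by exact: (Ck_at_comp (Ck_at_sin k _) (ss k)).
have scos k : Ck_at k (fun p : R * R => cos p.2) p by exact: (Ck_at_comp (Ck_at_cos k _) (ss k)).
have [p0 p1 p2] := Ck_at_pot 0 p.1; have [q0 q1 q2] := Ck_at_dpot 0 p.1.
have sl : Ck_at 0 (fun p : R * R => flowl p.1 p.2) p.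
  rewrite /flowl /potl; apply: Ck_atD; first exact: Ck_at_cst.
  apply: Ck_atM; last exact: Ck_at_cst.
  apply: Ck_atB; last by apply: Ck_atM; [exact: (sc _ _ q2)|exact: scos].
  apply: Ck_atD; first exact: (sc _ _ q0).
  by apply: Ck_atM; [exact: (sc _ _ q1)|exact: ssin].
have st : Ck_at 0 (fun p : R * R => pott p.1 p.2) p.
  rewrite /pott; apply: Ck_atD.
    by apply: Ck_atM; [exact: (sc _ _ p1)|exact: scos].
  by apply: Ck_atM; [exact: (sc _ _ p2)|exact: ssin].
rewrite /speed; apply: Ck_atD.
  by apply: Ck_atZ; exact: (Ck_atM sl sl).
apply: Ck_atM; last exact: (Ck_atM st st).
apply: Ck_atZ; apply: (sc 0%N (fun l => expR (4 * l))); exact: Ck_at_exp_lin.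
Qed.

Lemma reduce_2pi t : exists m : int, 0 <= t + 2 * pi * m%:~R <= 2 * pi.
Proof.
have p0 : 0 < 2 * pi :> R by rewrite mulr_gt0// pi_gt0.
exists (- Num.floor (t / (2 * pi))).
rewrite mulrNz mulrN subr_ge0 lerBlDl.
have := Num.Theory.floor_le (t / (2 * pi)); have := Num.Theory.floorD1_gt (t / (2 * pi)).
rewrite ler_pdivlMr// ltr_pdivrMr// intrD1 => h1 h2.
apply/andP; split; first by rewrite mulrC.
by move/ltW: h1; rewrite mulrDl mul1r mulrC.
Qed.

(** Compactness: modulo 2 pi the band is a rectangle, on which the speed is
    continuous and positive. *)
Lemma speed_band (A B : R) : A <= B -> B < 0 ->
  exists2 e : R, 0 < e & forall l t, A <= l <= B -> e <= speed l t.
Proof.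
move=> AB B0.
have p0 : 0 <= 2 * pi :> R by rewrite mulr_ge0// pi_ge0.
pose K : set (R * R) := `[A, B]%classic `*` `[0, 2 * pi]%classic.
have cK : compact K by apply: compact_setX; exact: segment_compact.
have K0 : K !=set0 by exists (A, 0); split; rewrite /= in_itv/= ?lexx.
have [c /set_mem[/= + _] Hc] := compact_EVT_min K0 cK
  (continuous_subspaceT speed_continuous).
rewrite in_itv/= => /andP[_ cB].
exists (speed c.1 c.2); first by apply: speed_gt0; exact: le_lt_trans B0.
move=> l t AlB; have [m Hm] := reduce_2pi t.
rewrite -(speedDpi l t m); apply: (Hc (l, t + 2 * pi * m%:~R)).
by apply/mem_set; split; rewrite /= in_itv.
Qed.

Section Orbit.
Variables lam th : R -> R.
Hypothesis o : orbit_of Q lam th.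
Hypothesis lam_lt0 : forall s, lam s < 0.
Let H s := ham (lam s) (th s).

Lemma ham_orbit_nondecr s s' : s <= s' -> H s <= H s'.
Proof.
move=> ss; apply: (@isd_nondecr _ H (fun s => speed (lam s) (th s))) => // z _.
  exact: isd_ham.
exact: speed_ge0.
Qed.

(** As long as an orbit stays in a band its ham grows at a definite rate. Since ham
    is bounded on l < 0 from above by 0, an orbit cannot stay in a band forever. *)
Lemma ham_orbit_grows (A B : R) : A <= B -> B < 0 -> exists2 e : R, 0 < e &
  forall a b, a <= b -> (forall s, a <= s <= b -> A <= lam s <= B) ->
   e * (b - a) <= H b - H a.
Proof.
move=> AB B0; have [e e0 He] := speed_band AB B0; exists e => // a b ab lAB.
have : H a - e * a <= H b - e * b.
  apply: (@isd_nondecr _ (fun s => H s - e * s) (fun s => speed (lam s) (th s) - e)) => // z zab.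
    by apply: (isd_eq (isdD (isd_ham o z) (isdN (isdM (isd_cst e z) (isd_id z))))); ring.
  by rewrite subr_ge0 He// lAB.
lra.
Qed.

(** Being below a negative level of ham keeps away from l = 0, uniformly in t: near
    l = 0 one has - ham <= 11/5 exp (1/l) <= 11/5 (- l). *)
Lemma lam_le_of_ham l t h : h < 0 -> l < 0 -> ham l t <= h ->
  l <= Num.max (- 2^-1) (5 / 11 * h).
Proof.
move=> h0 l0 hl; rewrite le_max; have [//|l1] := leP l (- 2^-1); rewrite /=.
have := hl; rewrite (ham_near t (ltW l1) l0); have /andP[_] := wave_bounds t l0.
have E : expR l^-1 <= - l.
  have y0 : 0 < - l^-1 by rewrite oppr_gt0 invr_lt0.
  rewrite -[l^-1]opprK expRN -[leRHS]invrK lef_pV2 ?posrE ?expR_gt0//; last first.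
    by rewrite invr_gt0 oppr_gt0.
  by rewrite invrN (le_trans _ (expR_ge1Dx _))// lerDr.
lra.
Qed.

(** Otherwise the orbit stays, for negative times, in a band -1 <= l <= B < 0: the
    upper bound comes from the monotonicity of ham. There ham decreases
    backward at a definite rate, while ham >= 2 l > -2. *)
Lemma orbit_backward : exists s, lam s <= -1.
Proof.
apply/not_existsP => far.
have l1 s : -1 < lam s by rewrite ltNge; apply/negP/far.
have H0 : H 0 < 0 by exact: ham_lt0.
pose B := Num.max (- 2^-1) (5 / 11 * H 0).
have B0 : B < 0 by rewrite gt_max; apply/andP; split; lra.
have AB : -1 <= B by rewrite le_max; apply/orP; left; lra.
have [e e0 He] := @ham_orbit_grows (-1) B AB B0.
(* Over a time 3 / e, ham would change by 3, more than its range [-2, 0]. *)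
have e3 : 0 <= 3 / e by rewrite divr_ge0// ltW.
have := He (- (3 / e)) 0; rewrite sub0r opprK oppr_le0 => /(_ e3).
rewrite mulrCA divff ?gt_eqF// mulr1 => Hb.
have : 3 <= H 0 - H (- (3 / e)).
  apply: Hb => s /andP[_ s0]; rewrite ltW//=.
  exact: lam_le_of_ham (ham_orbit_nondecr s0).
have := ham_ge (th (- (3 / e))) (lam_lt0 (- (3 / e))).
by have := l1 (- (3 / e)); rewrite /H in H0 *; lra.
Qed.

(** Otherwise the orbit stays, for positive times, in a band A <= l <= B < 0, the lower
    bound because ham = 2 l for l <= -1; then ham would tend to infinity. *)
Lemma ham_orbit_to_0 h : h < 0 -> exists S, h < H S.
Proof.
move=> h0; apply/not_existsP => far.
have l1 s : H s <= h by rewrite leNgt; apply/negP/far.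
pose B := Num.max (- 2^-1) (5 / 11 * h).
have B0 : B < 0 by rewrite gt_max; apply/andP; split; lra.
(* Where l < -1 one has ham = 2 l, hence l >= ham 0 / 2 along the orbit. *)
pose A := Num.min (-1) (H 0 / 2).
have AB : A <= B by rewrite ge_min le_max; apply/orP; left; apply/orP; left; lra.
have [e e0 He] := @ham_orbit_grows A B AB B0.
pose N := - H 0 / e.
have H00 : H 0 < 0 by exact: ham_lt0.
have N0 : 0 <= N by rewrite divr_ge0 ?ltW// oppr_gt0.
have := He 0 N N0; rewrite subr0 mulrCA divff ?gt_eqF// mulr1 => Hb.
have : - H 0 <= H N - H 0.
  apply: Hb => s /andP[s0 _]; apply/andP; split; last first.
    exact: lam_le_of_ham (l1 s).
  rewrite ge_min; have [//|ls] := leP (-1) (lam s); rewrite /=.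
  have := ham_orbit_nondecr s0; have [e1 _ _] := pot_far (th s) (ltW ls).
  rewrite /H [leRHS]/ham e1 addr0; lra.
by have := ham_lt0 (th N) (lam_lt0 N); rewrite /H; lra.
Qed.

(** By [ham_le], ham is bounded away from 0 on l <= B. *)
Lemma lam_to_0 (B : R) : B < 0 -> exists S, forall s, S <= s -> B < lam s.
Proof.
move=> B0; pose h := Num.max (2 * B) (- (expR B^-1 / 5)).
have h0 : h < 0.
  by rewrite gt_max; apply/andP; split; [lra|rewrite oppr_lt0 divr_gt0 ?expR_gt0].
have [S HS] := ham_orbit_to_0 h0; exists S => s Ss; rewrite ltNge; apply/negP => ls.
have := lt_le_trans HS (ham_orbit_nondecr Ss); rewrite ltNge => /negP; apply.
apply: (le_trans (ham_le (th s) (lam_lt0 s))).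
rewrite ge_max !le_max; apply/andP; split; apply/orP.
  by left; rewrite ler_pM2l.
right; rewrite lerN2 ler_pM2r// ler_expR.
by rewrite lef_nV2 // negrE.
Qed.

(** With cos b = -3/5 and sin b = -4/5 one has 6/5 + sin b + cos b = -1/5 < 0, which
    makes l decrease where theta + 1/l = b, and cos b < 0, which makes theta
    increase there: both make theta + 1/l increase. *)
Lemma barrier_angle : exists b : R, cos b = - (3 / 5) /\ sin b = - (4 / 5).
Proof.
have i : -1 <= (3 / 5 : R) <= 1 by apply/andP; split; lra.
exists (acos (3 / 5) + pi); rewrite cosDpi sinDpi acosK ?in_itv// sin_acos//.
have -> : 1 - (3 / 5) ^+ 2 = (4 / 5) ^+ 2 :> R by rewrite !expr2; field.
by rewrite sqrtr_sqr ger0_norm// divr_ge0.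
Qed.

(** By the barrier, theta + 1/l >= b for large times, where b is fixed; and 1/l tends
    to minus infinity. *)
Lemma th_to_pinfty (A : R) : exists S, forall s, S <= s -> A <= th s.
Proof.
(* After S1 the cut-off is 1, so that the potential is explicit. *)
have h2 : - 2^-1 < 0 :> R by lra.
have [S1 HS1] := lam_to_0 h2.
have [b0 [cb sb]] := barrier_angle.
pose psi s := th s + (lam s)^-1.
have [m Hm] : exists m : int, b0 + 2 * pi * m%:~R <= psi S1.
  have p0 : 0 < 2 * pi :> R by rewrite mulr_gt0// pi_gt0.
  exists (Num.floor ((psi S1 - b0) / (2 * pi))).
  by rewrite addrC -lerBrDr mulrC -ler_pdivlMr// Num.Theory.floor_le.
pose b := b0 + 2 * pi * m%:~R.
have lamn s : lam s != 0 by rewrite lt_eqF.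
have Hpsi : forall s, S1 <= s -> b <= psi s.
  apply: (@barrier _ psi (fun s => flowt Q (lam s) (th s)
      - ((lam s)^-1 * (lam s)^-1) * flowl (lam s) (th s))) => //.
    move=> s _; have [dl dt] := o s.
    by apply: (isd_eq (isdD dt (isd_comp (isdV (lamn s)) dl))); rewrite mulNr.
  move=> s Ss epsi.
  have l0 := lam_lt0 s; have l1 := HS1 s Ss.
  have [es ec] : sin (th s + (lam s)^-1) = - (4 / 5) /\ cos (th s + (lam s)^-1) = - (3 / 5).
    by rewrite -/(psi s) epsi /b; have [-> ->] := sin_cosD2pi m b0.
  have lt1 : flowl (lam s) (th s) = (lam s)^-1 ^+ 2 * expR (lam s)^-1 * - (1 / 10).
    rewrite /flowl potlE (cutoff1 (ltW l1)) (dcutoff1 (ltW l1)) dwaveE// es ec; field.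
    exact: lamn.
  rewrite lt1 /flowt pott_waveE// (cutoff1 (ltW l1)) ec.
  have E0 := expR_gt0 (lam s)^-1; have E1 := expR_gt0 (4 * lam s).
  have Q2 : 0 < Q * Q by rewrite mulr_gt0.
  have Y : 0 < (lam s)^-1 * (lam s)^-1 by rewrite nmulr_rgt0 invr_lt0.
  rewrite !expr2; have Y2 := mulr_gt0 Y Y.
  move: (expR (lam s)^-1) (expR (4 * lam s)) (Q * Q) E0 E1 Q2 => E E' q E0 E1 Q20.
  move: (lam s)^-1 Y Y2 => y Y Y2.
  rewrite subr_gt0; apply: (@lt_trans _ _ 0).
    have := mulr_gt0 Y2 E0; lra.
  have := mulr_gt0 (mulr_gt0 Q20 E1) E0; lra.
pose B := - (`|A - b| + 1)^-1.
have B0 : B < 0 by rewrite oppr_lt0 invr_gt0 ltr_wpDl.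
have [S2 HS2] := lam_to_0 B0.
exists (Num.max S1 S2) => s; rewrite ge_max => /andP[s1 s2].
have h := Hpsi s s1; have lB := HS2 s s2.
have : (lam s)^-1 <= B^-1 by rewrite lef_nV2 ?negrE// ltW.
rewrite /B invrN invrK; have := ler_norm (A - b); rewrite /psi in h; lra.
Qed.

End Orbit.
End Asymptotics.

(** * The contact form, its complex structure and conformal Reeb fields *)

Section Dot.
Context {R : realType} {n : nat}.
Implicit Types (a b c : 'rV[R]_n) (k : R).

Definition dot a b : R := \sum_(i < n) a 0 i * b 0 i.

Lemma dotC a b : dot a b = dot b a.
Proof. by apply: eq_bigr => i _; rewrite mulrC. Qed.

Lemma dotDl a b c : dot (a + b) c = dot a c + dot b c.
Proof. by rewrite -big_split/=; apply: eq_bigr => i _; rewrite mxE mulrDl. Qed.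

Lemma dotDr a b c : dot a (b + c) = dot a b + dot a c.
Proof. by rewrite dotC dotDl !(dotC a). Qed.

Lemma dotZl k a b : dot (k *: a) b = k * dot a b.
Proof. by rewrite /dot mulr_sumr; apply: eq_bigr => i _; rewrite mxE mulrA. Qed.

Lemma dotZr k a b : dot a (k *: b) = k * dot a b.
Proof. by rewrite dotC dotZl dotC. Qed.

Lemma dotNl a b : dot (- a) b = - dot a b.
Proof. by rewrite -scaleN1r dotZl mulN1r. Qed.

Lemma dotNr a b : dot a (- b) = - dot a b.
Proof. by rewrite dotC dotNl dotC. Qed.

Lemma dotBl a b c : dot (a - b) c = dot a c - dot b c.
Proof. by rewrite dotDl dotNl. Qed.

Lemma dotBr a b c : dot a (b - c) = dot a b - dot a c.
Proof. by rewrite dotDr dotNr. Qed.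

Lemma dot0l a : dot 0 a = 0.
Proof. by rewrite -(scale0r 0) dotZl mul0r. Qed.

Lemma dot0r a : dot a 0 = 0.
Proof. by rewrite dotC dot0l. Qed.

Lemma dot_ge0 a : 0 <= dot a a.
Proof. by apply: sumr_ge0 => i _; rewrite -expr2 sqr_ge0. Qed.

Lemma dot_eq0 a : dot a a = 0 -> a = 0.
Proof.
move=> /eqP; rewrite psumr_eq0; last by move=> i _; rewrite -expr2 sqr_ge0.
move=> /allP H; apply/rowP => i; rewrite mxE.
have := H i; rewrite mem_index_enum => /(_ isT); rewrite /= -expr2 sqrf_eq0.
by move=> /eqP.
Qed.

Definition dotE := (dotDl, dotDr, dotBl, dotBr, dotNl, dotNr, dotZl, dotZr).

End Dot.

Section Manifold.
Context {R : realType} {n : nat}.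
Local Notation M := (ucover R n).
Implicit Types (p v w : M).

Lemma lambda0E p v : lambda0 p v = v.1 + (dot p.2.1 v.2.2 - dot p.2.2 v.2.1).
Proof. by rewrite /lambda0 sumrB. Qed.

Lemma continuous_fst_ (U W : topologicalType) : continuous (@fst U W).
Proof. by move=> q; exact: cvg_fst. Qed.

Lemma cx_cont (i : 'I_n) : continuous (fun p : M => p.2.1 0 i).
Proof.
move=> p; apply: (@continuous_comp _ _ _ (fun p : M => p.2.1) (fun a : 'rV[R]_n => a 0 i)).
  by apply: (@continuous_comp _ _ _ (@snd R ('rV[R]_n * 'rV[R]_n)%type) fst);
    [exact: cvg_snd|exact: cvg_fst].
exact: coord_continuous.
Qed.

Lemma cy_cont (i : 'I_n) : continuous (fun p : M => p.2.2 0 i).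
Proof.
move=> p; apply: (@continuous_comp _ _ _ (fun p : M => p.2.2) (fun a : 'rV[R]_n => a 0 i)).
  by apply: (@continuous_comp _ _ _ (@snd R ('rV[R]_n * 'rV[R]_n)%type) snd);
    [exact: cvg_snd|exact: cvg_snd].
exact: coord_continuous.
Qed.

Lemma hasD_cx (i : 'I_n) p : hasD (fun p : M => p.2.1 0 i) p (fun v => v.2.1 0 i).
Proof. by apply: hasD_linear; [move=> a u v; rewrite /= !mxE|exact: cx_cont]. Qed.

Lemma hasD_cy (i : 'I_n) p : hasD (fun p : M => p.2.2 0 i) p (fun v => v.2.2 0 i).
Proof. by apply: hasD_linear; [move=> a u v; rewrite /= !mxE|exact: cy_cont]. Qed.

Lemma hasD_th p : hasD (fun p : M => p.1) p (fun v => v.1).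
Proof. by apply: hasD_linear => //; exact: continuous_fst_. Qed.

Lemma hasD_dotx (a : 'rV[R]_n) p :
  hasD (fun p : M => dot p.2.1 a) p (fun v => dot v.2.1 a).
Proof.
apply: hasD_sum => i; apply: hasD_eq (hasDM (hasD_cx i p) (hasD_cst (a 0 i) p)) _.
by move=> v; rewrite mulr0 addr0.
Qed.

Lemma hasD_doty (a : 'rV[R]_n) p :
  hasD (fun p : M => dot p.2.2 a) p (fun v => dot v.2.2 a).
Proof.
apply: hasD_sum => i; apply: hasD_eq (hasDM (hasD_cy i p) (hasD_cst (a 0 i) p)) _.
by move=> v; rewrite mulr0 addr0.
Qed.

Definition sqrad p : R := dot p.2.1 p.2.1 + dot p.2.2 p.2.2.

Lemma sqrad_ge0 p : 0 <= sqrad p.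
Proof. by rewrite addr_ge0// dot_ge0. Qed.

Lemma hasD_sqrad p :
  hasD sqrad p (fun v => 2 * (dot p.2.1 v.2.1 + dot p.2.2 v.2.2)).
Proof.
have hx : hasD (fun p : M => dot p.2.1 p.2.1) p (fun v => 2 * dot p.2.1 v.2.1).
  apply: (hasD_eq (hasD_sum (fun i => hasDM (hasD_cx i p) (hasD_cx i p)))) => v.
  by rewrite /dot mulr_sumr; apply: eq_bigr => i _; ring.
have hy : hasD (fun p : M => dot p.2.2 p.2.2) p (fun v => 2 * dot p.2.2 v.2.2).
  apply: (hasD_eq (hasD_sum (fun i => hasDM (hasD_cy i p) (hasD_cy i p)))) => v.
  by rewrite /dot mulr_sumr; apply: eq_bigr => i _; ring.
by apply: (hasD_eq (hasDD hx hy)) => v; rewrite mulrDr.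
Qed.

Lemma Ck_at_cx k (i : 'I_n) p : Ck_at k (fun p : M => p.2.1 0 i) p.
Proof. by apply: Ck_at_linear; [move=> a u v; rewrite /= !mxE|exact: cx_cont]. Qed.

Lemma Ck_at_cy k (i : 'I_n) p : Ck_at k (fun p : M => p.2.2 0 i) p.
Proof. by apply: Ck_at_linear; [move=> a u v; rewrite /= !mxE|exact: cy_cont]. Qed.

Lemma Ck_at_sqrad k p : Ck_at k sqrad p.
Proof.
apply: Ck_atD; apply: Ck_at_sum => i.
  exact: (Ck_atM (Ck_at_cx k i p) (Ck_at_cx k i p)).
exact: (Ck_atM (Ck_at_cy k i p) (Ck_at_cy k i p)).
Qed.

(** Multiplication by i on C^n, lifted along the projection from xi: the first
    component is forced by the condition that the value lies in xi. *)
Definition Jstd p v : M := (- (dot p.2.1 v.2.1 + dot p.2.2 v.2.2), (- v.2.2, v.2.1)).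

Lemma hasD_lambda0 p w :
  hasD (fun q : M => lambda0 q w) p (fun v => dot v.2.1 w.2.2 - dot v.2.2 w.2.1).
Proof.
apply: (@hasD_ext _ _ (fun q : M => w.1 + (dot q.2.1 w.2.2 - dot q.2.2 w.2.1))).
  by move=> q; rewrite lambda0E.
apply: (hasD_eq (hasDD (hasD_cst w.1 p) (hasDB (hasD_dotx w.2.2 p) (hasD_doty w.2.1 p)))).
by move=> v; rewrite add0r.
Qed.

Lemma dlambda0E p v w :
  dform lambda0 p v w = 2 * (dot v.2.1 w.2.2 - dot v.2.2 w.2.1).
Proof.
rewrite /dform (hasD_lambda0 p w).2 (hasD_lambda0 p v).2.
by rewrite (dotC w.2.1) (dotC w.2.2); ring.
Qed.

Lemma compatible_Jstd : compatible (@lambda0 R n) Jstd.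
Proof.
split.
- move=> p a u v; rewrite /Jstd /=; congr pair; last congr pair.
  + rewrite !dotE.
    transitivity (a * - (dot p.2.1 u.2.1 + dot p.2.2 u.2.2) -
      (dot p.2.1 v.2.1 + dot p.2.2 v.2.2)); [by ring|by []].
  + by rewrite opprD -scalerN.
- move=> v k.
  pose g (p : M) := - (dot p.2.1 v.2.1 + dot p.2.2 v.2.2).
  have sg j p : Ck_at j g p.
    apply: Ck_atN; apply: Ck_atD; apply: Ck_at_sum => i.
      by apply: Ck_atM; [exact: Ck_at_cx|exact: Ck_at_cst].
    by apply: Ck_atM; [exact: Ck_at_cy|exact: Ck_at_cst].
  rewrite (_ : (fun p => _) = (fun p => g p *: ((1, (0, 0)) : M) + (1 : R) *: ((0, (- v.2.2, v.2.1)) : M))).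
    by apply: CkD; apply: Ck_at_scale => p; [exact: sg|exact: Ck_at_cst].
  apply/funext => p; rewrite /Jstd -/(g p) scale1r; congr pair; last congr pair.
  + by rewrite /= addr0 /GRing.scale/= mulr1.
  + by rewrite /= scaler0 add0r.
  + by rewrite /= scaler0 add0r.
- by move=> m p; rewrite /Jstd /deck /= !addr0.
- move=> p; split.
  + by move=> v _; rewrite lambda0E /Jstd /= dotNr; ring.
  + move=> v; rewrite lambda0E => h; rewrite /Jstd /=; congr pair.
    by rewrite dotNr; move: h; lra.
  + by move=> v w _ _; rewrite !dlambda0E /Jstd /= !dotNr (dotC w.2.1) (dotC w.2.2); ring.
  + move=> v h v0; rewrite dlambda0E /Jstd /= dotNr opprK.
    rewrite pmulr_rgt0// lt_neqAle addr_ge0 ?dot_ge0// andbT.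
    apply: contra_neq v0 => /esym/eqP; rewrite paddr_eq0 ?dot_ge0//.
    move=> /andP[/eqP/dot_eq0 hx /eqP/dot_eq0 hy].
    move: h; rewrite lambda0E hx hy !dot0r subr0 addr0 => h.
    by case: v h hx hy => a [b c] /= -> -> ->.
Qed.

Section Reeb.
Variables (F : M -> R) (p : M) (T ph : R).
Hypothesis hF : hasD F p (fun v => T * v.1 + 2 * ph * (dot p.2.1 v.2.1 + dot p.2.2 v.2.2)).

(** If dF = T dtheta + 2 ph (x dx + y dy) at p, this vector times exp (- F p) is the
    Reeb vector of exp F lambda0. It is lambda0-normalised, and
    d lambda0 of it is T lambda0 - dF. *)
Definition reeb_vec : M := (1 + sqrad p * ph,
  (ph *: p.2.2 - (T / 2) *: p.2.1, - (ph *: p.2.1) - (T / 2) *: p.2.2)).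

Let dF v := T * v.1 + 2 * ph * (dot p.2.1 v.2.1 + dot p.2.2 v.2.2).

Lemma dconformalE v w : dform (conformal F lambda0) p v w =
  expR (F p) * (dF v * lambda0 p w - dF w * lambda0 p v
                + 2 * (dot v.2.1 w.2.2 - dot v.2.2 w.2.1)).
Proof.
have H x : hasD (fun q : M => conformal F lambda0 q x) p
    (fun v => expR (F p) * (dF v * lambda0 p x + (dot v.2.1 x.2.2 - dot v.2.2 x.2.1))).
  apply: (hasD_eq (hasDM (hasD_comp (is_derive_expR (F p)) hF) (hasD_lambda0 p x))).
  by move=> u; rewrite -/(dF u); ring.
rewrite /dform (H w).2 (H v).2.
by rewrite (dotC w.2.1) (dotC w.2.2); ring.
Qed.

(** The Reeb conditions determine the vector: the difference Z of two candidates
    is in xi and satisfies dF Z lambda0 + d lambda0 (Z, .) = 0; testing on the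
    theta direction gives dF Z = 0, and testing on i Z gives Z = 0. *)
Lemma reeb_conformal :
  reeb (conformal F lambda0) p = expR (- F p) *: reeb_vec.
Proof.
have E0 : expR (F p) != 0 by rewrite gt_eqF// expR_gt0.
have l1 : lambda0 p reeb_vec = 1.
  rewrite lambda0E /= !dotE /sqrad (dotC p.2.2 p.2.1); ring.
have dFX : dF reeb_vec = T.
  by rewrite /dF /= !dotE /sqrad (dotC p.2.2 p.2.1); field.
have scE (a b : R) : a *: (b : R^o) = a * b by [].
have lZ a u : lambda0 p (a *: u) = a * lambda0 p u.
  by rewrite !lambda0E /= !dotE [a *: u.1]scE; ring.
have fZ a u : dF (a *: u) = a * dF u.
  by rewrite /dF /= !dotE [a *: u.1]scE; ring.
have E1 : expR (F p) * expR (- F p) = 1 by rewrite expRxMexpNx_1.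
have X1 w : dform (conformal F lambda0) p (expR (- F p) *: reeb_vec) w = 0.
  rewrite dconformalE fZ lZ dFX l1 /= !dotE.
  transitivity (expR (F p) * expR (- F p) * (T * lambda0 p w - dF w
     + 2 * (ph * dot p.2.2 w.2.2 - T / 2 * dot p.2.1 w.2.2
            - (- (ph * dot p.2.1 w.2.1) - T / 2 * dot p.2.2 w.2.1)))); first by ring.
  by rewrite E1 lambda0E /dF; field.
apply: xget_unique.
  by split => //; rewrite /conformal lZ l1 mulr1 E1.
move=> Y [Y1 Y2].
pose Z := Y - expR (- F p) *: reeb_vec.
have lZ0 : lambda0 p Z = 0.
  have lB u u' : lambda0 p (u - u') = lambda0 p u - lambda0 p u'.
    by rewrite !lambda0E /= !dotE; ring.
  rewrite lB lZ l1 mulr1; apply: (mulfI E0); rewrite mulr0 mulrBr E1.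
  by rewrite -/(conformal F lambda0 p Y) Y2 subrr.
have BZ w : dF Z * lambda0 p w + 2 * (dot Z.2.1 w.2.2 - dot Z.2.2 w.2.1) = 0.
  have fB u u' : dF (u - u') = dF u - dF u' by rewrite /dF /= !dotE; ring.
  have := Y1 w; have := X1 w; rewrite !dconformalE.
  move=> /eqP; rewrite mulf_eq0 (negbTE E0) => /eqP h1.
  move=> /eqP; rewrite mulf_eq0 (negbTE E0) => /eqP h2.
  transitivity (dF Z * lambda0 p w - dF w * lambda0 p Z + 2 * (dot Z.2.1 w.2.2 - dot Z.2.2 w.2.1)).
    by rewrite lZ0; ring.
  have lB u u' : lambda0 p (u - u') = lambda0 p u - lambda0 p u'.
    by rewrite !lambda0E /= !dotE; ring.
  rewrite -[RHS](subrr 0) -{1}h2 -h1 /Z fB lB.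
  set X := expR (- F p) *: reeb_vec; rewrite /= !dotE; ring.
suff : Z = 0 by move=> /eqP; rewrite subr_eq0 => /eqP.
move: Z lZ0 BZ => {Y Y1 Y2} Z lZ0 BZ.
have dFZ : dF Z = 0.
  have := BZ (1, (0, 0)); rewrite lambda0E /= !dot0r subrr mulr0 !addr0.
  by rewrite mulr1.
have := BZ (0, (- Z.2.2, Z.2.1)); rewrite dFZ mul0r add0r /= dotNr opprK.
move=> /eqP; rewrite mulf_eq0 pnatr_eq0 /= paddr_eq0 ?dot_ge0//.
move=> /andP[/eqP/dot_eq0 hx /eqP/dot_eq0 hy].
move: lZ0; rewrite lambda0E hx hy !dot0r subrr addr0.
by move: hx hy; case: (Z) => a [b c] /= -> -> ->.
Qed.

End Reeb.
End Manifold.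

(** * The conformal factor on the manifold *)

Section ConformalFactor.
Context {R : realType} {n : nat}.
Local Notation M := (ucover R n).
Variable Q : R.
Hypothesis Q0 : 0 < Q.
Implicit Types (p v w : M) (x l : R).

(** The logarithmic radius l as a function of the squared radius. *)
Definition half_ln (x : R) : R := 2^-1 * ln (x / Q).
(** At sqrad p = 0 the argument is the junk value half_ln 0 = 0, but pot takes the
    value 0 there as it does near l = -oo, so that Fpot is smooth
    ([Fpot_near0]). *)
Definition Fpot p : R := pot (half_ln (sqrad p)) p.1.

Lemma half_ln0 : half_ln 0 = 0.
Proof. by rewrite /half_ln mul0r ln0// mulr0. Qed.

Lemma expR_half_ln x : 0 < x -> Q * expR (2 * half_ln x) = x.
Proof.
move=> x0; rewrite /half_ln mulrA divff// mul1r lnK ?posrE ?divr_gt0//.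
by rewrite mulrC divfK// gt_eqF.
Qed.

Lemma half_ln_exp l : half_ln (Q * expR (2 * l)) = l.
Proof.
rewrite /half_ln mulrAC divff ?gt_eqF// mul1r expRK mulrA mulVf ?mul1r//.
Qed.

Lemma isd_half_ln x : 0 < x -> is_derive x (1 : R) half_ln (2 * x)^-1.
Proof.
move=> x0; have xQ : 0 < x / Q by rewrite divr_gt0.
have D := isdM (isd_cst 2^-1 x) (@isd_comp R (@ln R) (fun x => x / Q) x _ _ (is_derive1_ln xQ) (isdM (isd_id x) (isd_cst Q^-1 x))).
apply: (isd_eq D); field.
by rewrite !gt_eqF.
Qed.

Lemma Ck_at_half_ln k x : 0 < x -> Ck_at k half_ln x.
Proof.
move=> x0; apply: Ck_atZ.
apply: (@Ck_at_comp _ _ k (@ln R) (fun x => x / Q)).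
  by apply: Ck_at_ln; rewrite divr_gt0.
by apply: Ck_atM; [exact: Ck_at_id|exact: Ck_at_cst].
Qed.

Lemma half_ln_small x : 0 < x -> x <= Q * expR (-2) -> half_ln x <= -1.
Proof.
move=> x0 xQ; rewrite /half_ln.
have : ln (x / Q) <= -2.
  rewrite -[leRHS]expRK ler_ln ?posrE ?divr_gt0 ?expR_gt0//.
  by rewrite ler_pdivrMr// mulrC.
lra.
Qed.

Lemma Fpot_near0 p : sqrad p = 0 -> \forall z \near p, Fpot z = 0.
Proof.
move=> p0.
have H : \forall z \near p, sqrad z < Q * expR (-2).
  apply: (cvgr_lt (sqrad p) (Ck_at_cvg (Ck_at_sqrad 0 p))).
  by rewrite p0 mulr_gt0// expR_gt0.
near=> z; have zQ : sqrad z < Q * expR (-2) by near: z.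
rewrite /Fpot.
have [z0|z0] := ltP 0 (sqrad z).
  by have [->] := pot_far z.1 (half_ln_small z0 (ltW zQ)).
have -> : sqrad z = 0 by apply/eqP; rewrite eq_le z0 sqrad_ge0.
by rewrite half_ln0; have [->] := pot_out z.1 (lexx 0); rewrite mulr0 oppr0.
Unshelve. all: by end_near. Qed.

Lemma Ck_at_Fpot k p : Ck_at k Fpot p.
Proof.
have [p0|p0] := ltP 0 (sqrad p); last first.
  have {}p0 : sqrad p = 0 by apply/eqP; rewrite eq_le p0 sqrad_ge0.
  apply: (@Ck_at_near _ _ k (fun=> 0)); last exact: Ck_at_cst.
  by apply: filterS (Fpot_near0 p0) => z ->.
have sl : Ck_at k (fun p : M => half_ln (sqrad p)) p.
  exact: (Ck_at_comp (Ck_at_half_ln k p0) (Ck_at_sqrad k p)).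
have ssin : Ck_at k (fun p : M => sin p.1) p by exact: (Ck_at_comp (Ck_at_sin k _) (Ck_at_fst k p)).
have scos : Ck_at k (fun p : M => cos p.1) p by exact: (Ck_at_comp (Ck_at_cos k _) (Ck_at_fst k p)).
have [h0 h1 h2] := Ck_at_pot k (half_ln (sqrad p)).
rewrite /Fpot /pot; apply: Ck_atB.
  apply: Ck_atD; first exact: (Ck_at_comp (g := fun p : M => half_ln (sqrad p)) h0 sl).
  by apply: Ck_atM; [exact: (Ck_at_comp (g := fun p : M => half_ln (sqrad p)) h1 sl)|exact: ssin].
by apply: Ck_atM; [exact: (Ck_at_comp (g := fun p : M => half_ln (sqrad p)) h2 sl)|exact: scos].
Qed.

Lemma smooth_Fpot : smooth Fpot.
Proof. by apply: smooth_Ck_at => k p; exact: Ck_at_Fpot. Qed.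

Lemma sqrad_deck p m : sqrad (p + deck m) = sqrad p.
Proof. by rewrite /sqrad /deck /= !addr0. Qed.

Lemma Fpot_deck : deck_invariant Fpot.
Proof.
move=> m p; rewrite /Fpot sqrad_deck /deck /=.
by have [-> _ _] := potDpi (half_ln (sqrad p)) p.1 m.
Qed.

Definition Fth p : R := pott (half_ln (sqrad p)) p.1.
(** With [Fth], the coefficients of the differential of Fpot, see [hasD_Fpot]. *)
Definition Frad p : R := potl (half_ln (sqrad p)) p.1 / (2 * sqrad p).

Lemma hasD_Fpot p : hasD Fpot p (fun v => Fth p * v.1
  + 2 * Frad p * (dot p.2.1 v.2.1 + dot p.2.2 v.2.2)).
Proof.
have [p0|p0] := ltP 0 (sqrad p); last first.
  have {}p0 : sqrad p = 0 by apply/eqP; rewrite eq_le p0 sqrad_ge0.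
  apply: (@hasD_near _ _ (fun=> 0)).
    by apply: filterS (Fpot_near0 p0) => z ->.
  apply: (hasD_eq (hasD_cst 0 p)) => v.
  rewrite /Fth /Frad p0 half_ln0 mulr0 invr0 mulr0.
  by have [_ _ ->] := pot_out p.1 (lexx 0); rewrite mulr0 !mul0r addr0.
have hl : hasD (fun p : M => half_ln (sqrad p)) p
    (fun v => (dot p.2.1 v.2.1 + dot p.2.2 v.2.2) / sqrad p).
  apply: (hasD_eq (hasD_comp (isd_half_ln p0) (hasD_sqrad p))) => v.
  by field; rewrite gt_eqF.
pose L := half_ln (sqrad p).
have [h0 h1 h2] := Ck_at_pot 1 L.
have hs := hasD_comp (is_derive_sin p.1) (hasD_th p).
have hc := hasD_comp (is_derive_cos p.1) (hasD_th p).
have D := hasDB (hasDD (hasD_comp (f := fun p : M => half_ln (sqrad p)) (Ck_at1_isd h0) hl)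
   (hasDM (hasD_comp (f := fun p : M => half_ln (sqrad p)) (Ck_at1_isd h1) hl) hs)) (hasDM (hasD_comp (f := fun p : M => half_ln (sqrad p)) (Ck_at1_isd h2) hl) hc).
apply: (hasD_eq D) => v; rewrite /Fth /Frad -/L /potl /pott.
by field; rewrite gt_eqF.
Qed.

Definition reebF p : M := expR (- Fpot p) *: reeb_vec p (Fth p) (Frad p).

Lemma reebE p : reeb (conformal Fpot lambda0) p = reebF p.
Proof. exact: reeb_conformal (hasD_Fpot p). Qed.

Lemma reeb_projE p v : reeb_proj (conformal Fpot lambda0) p v =
  v - lambda0 p v *: reeb_vec p (Fth p) (Frad p).
Proof.
rewrite /reeb_proj reebE /reebF /conformal scalerA; congr (_ - _ *: _).
by rewrite mulrAC expRxMexpNx_1 mul1r.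
Qed.

End ConformalFactor.

(** * Points over a complex line, and radial functions of the plane *)

Section Vec3.
Context {R : realType} {n : nat}.
Local Notation M := (ucover R n).
Variable e : 'rV[R]_n.
Hypothesis e1 : dot e e = 1.

(** The point theta = a, x + i y = (b + i c) e. *)
Definition vec3 (a b c : R) : M := (a, (b *: e, c *: e)).

Lemma vec3B a b c k a' b' c' :
  vec3 a b c - k *: vec3 a' b' c' = vec3 (a - k * a') (b - k * b') (c - k * c').
Proof.
congr pair; congr pair; rewrite /= ?scalerBl ?scalerA//.
Qed.

Lemma lambda0_vec3 a b c a' b' c' :
  lambda0 (vec3 a b c) (vec3 a' b' c') = a' + (b * c' - c * b').
Proof. by rewrite lambda0E /= !dotE e1 !mulr1. Qed.

Lemma sqrad_vec3 a b c : sqrad (vec3 a b c) = b * b + c * c.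
Proof. by rewrite /sqrad /= !dotE e1 !mulr1. Qed.

Lemma reeb_vec3 a b c T ph : reeb_vec (vec3 a b c) T ph =
  vec3 (1 + (b * b + c * c) * ph) (ph * c - T / 2 * b) (- (ph * b) - T / 2 * c).
Proof.
rewrite /reeb_vec sqrad_vec3; congr pair; congr pair; rewrite /= !scalerA.
  by rewrite scalerBl.
by rewrite -scaleNr -scalerBl.
Qed.

Lemma Jstd_vec3 a b c a' b' c' :
  Jstd (vec3 a b c) (vec3 a' b' c') = vec3 (- (b * b' + c * c')) (- c') b'.
Proof. by rewrite /Jstd /vec3 /= !dotE e1 !mulr1 scaleNr. Qed.

Lemma vec3E a b c : vec3 a b c =
  a *: (vec3 1 0 0) + (b *: vec3 0 1 0 + c *: vec3 0 0 1).
Proof.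
rewrite /vec3; congr pair; last congr pair; rewrite /= ?scale0r ?scaler0 ?scale1r ?addr0 ?add0r//.
by rewrite /GRing.scale/= mulr1.
Qed.

Lemma Ck_vec3 (V : normedModType R) k (f g h : V -> R) :
  (forall x, Ck_at k f x) -> (forall x, Ck_at k g x) -> (forall x, Ck_at k h x) ->
  Ck k (fun x => vec3 (f x) (g x) (h x)).
Proof.
move=> sf sg sh; rewrite (_ : (fun x => _) = (fun x => f x *: (vec3 1 0 0) +
  (g x *: vec3 0 1 0 + h x *: vec3 0 0 1))).
  by apply: CkD; last apply: CkD; exact: Ck_at_scale.
by apply/funext => x; exact: vec3E.
Qed.

Lemma derive_vec3 (V : normedModType R) (f g h : V -> R) x (Df Dg Dh : V -> R) :
  hasD f x Df -> hasD g x Dg -> hasD h x Dh ->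
  forall v, is_derive x v (fun x => vec3 (f x) (g x) (h x)) (vec3 (Df v) (Dg v) (Dh v)).
Proof.
move=> [df ef] [dg eg] [dh eh] v.
have H (k : V -> R) (c : M) : differentiable k x ->
    is_derive x v (fun x => k x *: c) ('D_v k x *: c).
  move=> dk; apply: DeriveDef; first exact/diff_derivable/differentiableZl.
  rewrite deriveE; last exact: differentiableZl.
  by rewrite diffZl//= deriveE.
rewrite (_ : (fun x => _) = (fun x => f x *: (vec3 1 0 0) +
  (g x *: vec3 0 1 0 + h x *: vec3 0 0 1))); last first.
  by apply/funext => y; exact: vec3E.
rewrite (vec3E (Df v)) -ef -eg -eh.
by apply: is_deriveD; [exact: H|apply: is_deriveD; exact: H].
Qed.

End Vec3.

Section Radial.
Context {R : realType}.
Local Notation C := (plane R).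
Implicit Types (w v z : C) (s : R).

Definition nsq w : R := w.1 * w.1 + w.2 * w.2.
(** The logarithm of the modulus. At w = 0 its value is 0, so a function g of
    logr extends smoothly over 0 as soon as g is constant on s <= 1: the constant
    is then also the value g 0. *)
Definition logr w : R := 2^-1 * ln (nsq w).
(** The derivative of logr. *)
Definition radial w v : R := (w.1 * v.1 + w.2 * v.2) / nsq w.

Lemma nsq_ge0 w : 0 <= nsq w.
Proof. by rewrite addr_ge0// -expr2 sqr_ge0. Qed.

Lemma Ck_at_nsq k w : Ck_at k nsq w.
Proof.
apply: Ck_atD; first exact: (Ck_atM (Ck_at_fst k w) (Ck_at_fst k w)).
exact: (Ck_atM (Ck_at_snd k w) (Ck_at_snd k w)).
Qed.

Lemma hasD_w1 w : hasD (fun w : C => w.1) w (fun v => v.1).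
Proof. by have [h1 h2] := @fst_linear R R; split; [exact: h1|exact: h2]. Qed.

Lemma hasD_w2 w : hasD (fun w : C => w.2) w (fun v => v.2).
Proof. by have [h1 h2] := @snd_linear R; split; [exact: h1|exact: h2]. Qed.

Lemma hasD_nsq w : hasD nsq w (fun v => 2 * (w.1 * v.1 + w.2 * v.2)).
Proof.
apply: (hasD_eq (hasDD (hasDM (hasD_w1 w) (hasD_w1 w)) (hasDM (hasD_w2 w) (hasD_w2 w)))).
by move=> v; ring.
Qed.

Lemma expR_logr w : 0 < nsq w -> expR (2 * logr w) = nsq w.
Proof. by move=> w0; rewrite /logr mulrA divff// mul1r lnK. Qed.

Lemma logr_near0 w : nsq w = 0 -> \forall z \near w, logr z <= 0.
Proof.
move=> w0.
have H : \forall z \near w, nsq z < 1.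
  by apply: (cvgr_lt (nsq w) (Ck_at_cvg (Ck_at_nsq 0 w))); rewrite w0.
near=> z; have zQ : nsq z < 1 by near: z.
by rewrite /logr pmulr_rle0// ln_le0// ltW.
Unshelve. all: by end_near. Qed.

Section RadialFun.
Variable g : R -> R.
Hypothesis gc : forall s, s <= 1 -> g s = g 1.

Lemma radial_near0 w : nsq w = 0 -> \forall z \near w, g 1 = g (logr z).
Proof.
move=> /logr_near0 H; near=> z; rewrite gc//.
by apply: (@le_trans _ _ 0) => //; near: z.
Unshelve. all: by end_near. Qed.

(** Near the origin z |-> g (logr z) is constant. *)
Lemma Ck_at_radial k w : (forall s, Ck_at k g s) -> Ck_at k (fun z => g (logr z)) w.
Proof.
move=> sg; have [w0|w0] := ltP 0 (nsq w); last first.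
  have {}w0 : nsq w = 0 by apply/eqP; rewrite eq_le w0 nsq_ge0.
  exact: (Ck_at_near (radial_near0 w0) (Ck_at_cst k (g 1) w)).
apply: (Ck_at_comp (g := logr) (sg _)).
apply: Ck_atZ; exact: (Ck_at_comp (Ck_at_ln k w0) (Ck_at_nsq k w)).
Qed.

Lemma hasD_radial w (d : R) : is_derive (logr w) (1 : R) g d ->
  hasD (fun z => g (logr z)) w (fun v => d * radial w v).
Proof.
move=> dg; have [w0|w0] := ltP 0 (nsq w); last first.
  have {}w0 : nsq w = 0 by apply/eqP; rewrite eq_le w0 nsq_ge0.
  apply: (hasD_near (radial_near0 w0)).
  by apply: (hasD_eq (hasD_cst (g 1) w)) => v; rewrite /radial w0 invr0 !mulr0.
apply: (hasD_comp dg); rewrite /logr.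
apply: (hasD_eq (hasDZ 2^-1 (hasD_comp (is_derive1_ln w0) (hasD_nsq w)))) => v.
by rewrite /radial; field; rewrite gt_eqF.
Qed.

End RadialFun.
End Radial.

(** * Divergence theorem on squares *)

Section DivergenceSquare.
Context {R : realType}.
Notation mu := (@lebesgue_measure R).
Notation mR := (measurableTypeR R).
Local Notation mu2 := (mu \x mu)%E.

Definition seg (N : R) : set mR := `[- N, N]%classic.
Definition square (N : R) : set (mR * mR) := seg N `*` seg N.

Lemma seg_measure N : 0 < N -> mu (seg N) = (2 * N)%:E.
Proof.
move=> N0; rewrite /seg lebesgue_measure_itv/= lte_fin gtrN// -EFinB.
by congr EFin; lra.
Qed.

Lemma measurable_square N : measurable (square N).
Proof. by apply: measurableX; exact: measurable_itv. Qed.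

Lemma square_finite N : 0 <= N -> (mu2 (square N) < +oo)%E.
Proof.
move=> N0; rewrite /square product_measure1E; try exact: measurable_itv.
have h : (mu (seg N) < +oo)%E.
  by rewrite /seg lebesgue_measure_itv/=; case: ifP => _; rewrite ?ltry.
have h0 : (0 <= mu (seg N))%E by exact: measure_ge0.
by apply: lte_mul_pinfty => //; rewrite ge0_fin_numE.
Qed.

Lemma integrable_square N (f : mR * mR -> R) (c : R) : 0 <= N ->
  measurable_fun [set: mR * mR] f -> (forall w, square N w -> `|f w| <= c) ->
  mu2.-integrable (square N) (EFin \o f).
Proof.
move=> N0 mf fc; apply: measurable_bounded_integrable.
- exact: measurable_square.
- exact: square_finite.
- exact: measurable_funTS.
- exists c; split; first exact: num_real.
  by move=> x cx w Sw; apply: (le_trans (fc w Sw)); exact: ltW.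
Qed.

Lemma FTC_segment (N : R) (f g : R -> R) : 0 < N ->
  (forall x, is_derive x (1 : R) f (g x)) -> continuous g ->
  (\int[mu]_(x in seg N) (g x)%:E = (f N - f (- N))%:E)%E.
Proof.
move=> N0 fg cg.
rewrite (@continuous_FTC2 _ g f (- N) N) ?EFinB//.
- by rewrite gtrN.
- exact: continuous_subspaceT.
- have cf x : {for x, continuous f} by exact: isd_continuous (fg x).
  split; first by move=> x _; have [] := fg x.
    by apply: cvg_at_right_filter; exact: cf.
  by apply: cvg_at_left_filter; exact: cf.
- by move=> x _; rewrite derive1E (isd_val (fg x)).
Qed.

Lemma segment_integral_le (N c : R) (D : R -> R) : 0 < N -> continuous D ->
  (forall y, - N <= y <= N -> D y <= 2 * c) ->
  (\int[mu]_(y in seg N) (D y)%:E <= (4 * N * c)%:E)%E.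
Proof.
move=> N0 cD Dc.
have iseg (g : R -> R) : continuous g -> mu.-integrable (seg N) (EFin \o g).
  move=> cg; apply: continuous_compact_integrable; first exact: segment_compact.
  exact: continuous_subspaceT.
apply: (@le_trans _ _ (\int[mu]_(y in seg N) (2 * c)%:E)%E).
  apply: (@le_integral _ _ _ mu (seg N) (measurable_itv _) (EFin \o D) (EFin \o (fun=> 2 * c))).
  - exact: iseg.
  - by apply: iseg => y; exact: cst_continuous.
  - by move=> y /set_mem; rewrite /seg /= in_itv/= => yN; rewrite lee_fin Dc.
rewrite integral_cst; last exact: measurable_itv.
rewrite [X in (_ * X)%E](_ : _ = (2 * N)%:E); last exact: seg_measure.
by rewrite -EFinM lee_fin; lra.
Qed.

(** Fubini and the fundamental theorem of calculus: the integral over the square of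
    the derivative of A in the first variable is a boundary term. *)
Lemma fst_square_le (N c : R) (A DA : R * R -> R) : 0 < N -> 0 <= c ->
  measurable_fun [set: mR * mR] (DA : mR * mR -> R) ->
  (exists b, forall w, square N w -> `|DA w| <= b) ->
  (forall y x, is_derive x (1 : R) (fun x => A (x, y)) (DA (x, y))) ->
  (forall y, continuous (fun x => DA (x, y))) ->
  (forall x, continuous (fun y => A (x, y))) ->
  (forall y, - N <= y <= N -> `|A (N, y)| <= c /\ `|A (- N, y)| <= c) ->
  (\int[mu2]_(w in square N) (DA w)%:E <= (4 * N * c)%:E)%E.
Proof.
move=> N0 c0 mDA [b DAb] dA cDA cA Ac.
have iS := integrable_square (ltW N0) mDA DAb.
have iST : mu2.-integrable setT ((EFin \o DA) \_ (square N)).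
  by apply/(integrable_mkcond _ (measurable_square N)).
rewrite integral_mkcond -(integral21_prod_meas1 iST).
have H y : (\int[mu]_x ((EFin \o DA) \_ (square N)) (x, y) =
   ((fun y => (A (N, y) - A (- N, y))%:E) \_ (seg N)) y)%E.
  rewrite patchE; case: ifPn => yN.
    rewrite -(FTC_segment N0 (dA y) (cDA y)) [RHS]integral_mkcond.
    apply: eq_integral => x _; rewrite !patchE.
    congr (if _ then _ else _); apply/idP/idP => /set_mem h; apply/mem_set.
      by case: h.
    by split => //; exact/set_mem.
  apply: integral0_eq => x _; rewrite patchE; case: ifPn => // /set_mem[_ /= h].
  by rewrite notin_setE in yN.
rewrite (eq_integral _ _ (fun y _ => H y)) -integral_mkcond.
apply: segment_integral_le => // y; first by apply: continuousB; exact: cA.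
by move=> /Ac[]; rewrite !ler_norml => /andP[_ h1] /andP[h2 _]; lra.
Qed.

Lemma snd_square_le (N c : R) (A DA : R * R -> R) : 0 < N -> 0 <= c ->
  measurable_fun [set: mR * mR] (DA : mR * mR -> R) ->
  (exists b, forall w, square N w -> `|DA w| <= b) ->
  (forall x y, is_derive y (1 : R) (fun y => A (x, y)) (DA (x, y))) ->
  (forall x, continuous (fun y => DA (x, y))) ->
  (forall y, continuous (fun x => A (x, y))) ->
  (forall x, - N <= x <= N -> `|A (x, N)| <= c /\ `|A (x, - N)| <= c) ->
  (\int[mu2]_(w in square N) (DA w)%:E <= (4 * N * c)%:E)%E.
Proof.
move=> N0 c0 mDA [b DAb] dA cDA cA Ac.
have iS := integrable_square (ltW N0) mDA DAb.
have iST : mu2.-integrable setT ((EFin \o DA) \_ (square N)).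
  by apply/(integrable_mkcond _ (measurable_square N)).
rewrite integral_mkcond -(integral12_prod_meas1 iST).
have H x : (\int[mu]_y ((EFin \o DA) \_ (square N)) (x, y) =
   ((fun x => (A (x, N) - A (x, - N))%:E) \_ (seg N)) x)%E.
  rewrite patchE; case: ifPn => xN.
    rewrite -(FTC_segment N0 (dA x) (cDA x)) [RHS]integral_mkcond.
    apply: eq_integral => y _; rewrite !patchE.
    congr (if _ then _ else _); apply/idP/idP => /set_mem h; apply/mem_set.
      by case: h.
    by split => //; exact/set_mem.
  apply: integral0_eq => y _; rewrite patchE; case: ifPn => // /set_mem[/= h _].
  by rewrite notin_setE in xN.
rewrite (eq_integral _ _ (fun x _ => H x)) -integral_mkcond.
apply: segment_integral_le => // x; first by apply: continuousB; exact: cA.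
by move=> /Ac[]; rewrite !ler_norml => /andP[_ h1] /andP[h2 _]; lra.
Qed.

(** Monotone convergence along squares. *)
Lemma plane_integral_le (I : R * R -> R) (B : R) :
  measurable_fun [set: mR * mR] (I : mR * mR -> R) -> (forall w, 0 <= I w) ->
  (forall N, 1 <= N -> (\int[mu2]_(w in square N) (I w)%:E <= B%:E)%E) ->
  (\int[mu2]_w (I w)%:E <= B%:E)%E.
Proof.
move=> mI I0 IB.
pose S k := square k.+1%:R.
have SU : \bigcup_k S k = setT.
  apply/seteqP; split => // w _.
  pose k := Num.truncn (`|w.1| + `|w.2|).
  exists k => //=.
  have : `|w.1| + `|w.2| < k.+1%:R by apply: truncnS_gt.
  move=> h; split; rewrite /= /seg /= in_itv/= -ler_norml.
    by rewrite ltW// (le_lt_trans _ h)// lerDl.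
  by rewrite ltW// (le_lt_trans _ h)// lerDr.
have ndS : nondecreasing_seq S.
  move=> i j ij; rewrite subsetEset => w [/= h1 h2].
  have ij' : i.+1%:R <= j.+1%:R :> R by rewrite ler_nat ltnS.
  move: h1 h2; rewrite /seg /= !in_itv/= => /andP[a1 a2] /andP[a3 a4].
  by split; rewrite /= /seg /= in_itv/=; apply/andP; split;
    rewrite ?(le_trans _ ij')// (le_trans _ a1, le_trans _ a3)// lerN2.
have H : (\int[mu2]_(x in S i) (I x)%:E)%E @[i --> \oo] -->
    (\int[mu2]_(x in \bigcup_i S i) (I x)%:E)%E.
  apply: ge0_nondecreasing_set_cvg_integral => //.
  - by move=> i; exact: measurable_square.
  - by move=> i; apply/measurable_EFinP; exact: measurable_funTS.
  - by move=> i x _; rewrite lee_fin.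
rewrite SU in H.
rewrite -(cvg_lim _ H)//; apply: lime_le; first by apply/cvg_ex; eexists; exact: H.
by apply: nearW => k; apply: IB; rewrite ler1n.
Qed.

End DivergenceSquare.

(** * The exponential cylinder and the limit circles *)

Section Angles.
Context {R : realType}.
Implicit Types x y c s t : R.

Lemma angle_exists c s : c ^+ 2 + s ^+ 2 = 1 ->
  exists x, cos x = c /\ sin x = s.
Proof.
move=> cs; have c1 : -1 <= c <= 1.
  rewrite -ler_norml -(ler_pXn2r (n := 2)) ?nnegrE// expr1n real_normK ?num_real//.
  by rewrite -cs lerDl sqr_ge0.
have sE : Num.sqrt (1 - c ^+ 2) = `|s| by rewrite -cs addrC addKr sqrtr_sqr.
have [s0|s0] := leP 0 s.
  by exists (acos c); rewrite acosK ?in_itv//= sin_acos// sE ger0_norm.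
exists (- acos c); rewrite cosN sinN acosK ?in_itv//= sin_acos// sE.
by rewrite ltr0_norm// opprK.
Qed.

Lemma angle_unique x y : cos x = cos y -> sin x = sin y ->
  exists m : int, x = y + 2 * pi * m%:~R.
Proof.
move=> ec es; have [m /andP[r0 r1]] := reduce_2pi (x - y).
set r := x - y + 2 * pi * m%:~R in r0 r1.
have cr : cos r = 1.
  have [_ ->] := sin_cosD2pi m (x - y).
  by rewrite cosB ec es -!expr2 cos2Dsin2.
have p0 : 0 <= pi :> R := pi_ge0 R.
have zero (u : R) : 0 <= u <= pi -> cos u = 1 -> u = 0.
  move=> u0 cu; apply: cos_inj; [by rewrite in_itv/= u0| |by rewrite cu cos0].
  by rewrite in_itv/= lexx p0.
have [rp|rp] := leP r pi.
  exists (- m); have := zero r; rewrite r0 rp => /(_ isT cr).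
  by rewrite /r mulrNz mulrN; lra.
exists (1 - m).
have : 2 * pi - r = 0.
  apply: zero; first by apply/andP; split; lra.
  have -> : 2 * pi - r = - r + 2 * pi * 1%:~R by rewrite mulr1 addrC.
  by have [_ ->] := sin_cosD2pi 1 (- r); rewrite cosN.
rewrite /r intrB mulrBr mulr1; lra.
Qed.

End Angles.

Section ExpCylinder.
Context {R : realType}.
Local Notation C := (plane R).
Implicit Types (w v : C).

(** The map exp (2 pi (s + i t)). *)
Definition cyl w : C := (expR (2 * pi * w.1) * cos (2 * pi * w.2),
                         expR (2 * pi * w.1) * sin (2 * pi * w.2)).

Lemma nsq_cyl w : nsq (cyl w) = expR (2 * (2 * pi * w.1)).
Proof.
rewrite /nsq /cyl /= expRM_natl expr2.
have := cos2Dsin2 (2 * pi * w.2); move: (cos _) (sin _) (expR _) => c s E h.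
transitivity (E * E * (c ^+ 2 + s ^+ 2)); first by ring.
by rewrite h mulr1.
Qed.

Lemma logr_cyl w : logr (cyl w) = 2 * pi * w.1.
Proof. by rewrite /logr nsq_cyl expRK mulKf ?pnatr_eq0. Qed.

(** The norm of a product space is the maximum, not the Euclidean norm. *)
Lemma norm_nsq w : `|w| ^+ 2 <= nsq w <= 2 * `|w| ^+ 2.
Proof.
have [a1 a2] : `|w.1| <= `|w| /\ `|w.2| <= `|w|.
  by rewrite [`|w|]prod_normE !le_max !lexx orbT.
have N : nsq w = `|w.1| ^+ 2 + `|w.2| ^+ 2 by rewrite /nsq !real_normK ?num_real// !expr2.
apply/andP; split; last first.
  by rewrite N mulr_natl mulr2n lerD// ler_pXn2r ?nnegrE.
have [->|->] : `|w| = `|w.1| \/ `|w| = `|w.2|.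
- by rewrite [`|w|]prod_normE; case: leP => _; [right|left].
- by rewrite N lerDl sqr_ge0.
- by rewrite N lerDr sqr_ge0.
Qed.

Lemma hasD_cyl1 w : hasD (fun w => (cyl w).1) w (fun v =>
  2 * pi * ((cyl w).1 * v.1 - (cyl w).2 * v.2)).
Proof.
have h1 := hasDZ (2 * pi) (hasD_w1 w); have h2 := hasDZ (2 * pi) (hasD_w2 w).
apply: (hasD_eq (hasDM (hasD_comp (is_derive_expR _) h1) (hasD_comp (is_derive_cos _) h2))).
by move=> v; rewrite /cyl /=; ring.
Qed.

Lemma hasD_cyl2 w : hasD (fun w => (cyl w).2) w (fun v =>
  2 * pi * ((cyl w).2 * v.1 + (cyl w).1 * v.2)).
Proof.
have h1 := hasDZ (2 * pi) (hasD_w1 w); have h2 := hasDZ (2 * pi) (hasD_w2 w).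
apply: (hasD_eq (hasDM (hasD_comp (is_derive_expR _) h1) (hasD_comp (is_derive_sin _) h2))).
by move=> v; rewrite /cyl /=; ring.
Qed.

Lemma differentiable_cyl w : differentiable cyl w.
Proof.
exact: (differentiable_pair (hasD_cyl1 w).1 (hasD_cyl2 w).1).
Qed.

Lemma derive_cyl w v : 'D_v cyl w =
  (2 * pi * ((cyl w).1 * v.1 - (cyl w).2 * v.2),
   2 * pi * ((cyl w).2 * v.1 + (cyl w).1 * v.2)).
Proof.
rewrite deriveE; last exact: differentiable_cyl.
have -> : 'd cyl w = (fun v => ('d (fun w => (cyl w).1) w v, 'd (fun w => (cyl w).2) w v)) :> (C -> C).
  exact: (diff_pair (hasD_cyl1 w).1 (hasD_cyl2 w).1).
rewrite -!deriveE; try by [exact: (hasD_cyl1 w).1|exact: (hasD_cyl2 w).1].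
by rewrite (hasD_cyl1 w).2 (hasD_cyl2 w).2.
Qed.

Lemma cylindrical_cyl : cylindrical_coordinates cyl.
Proof.
have p2 : 2 <= pi :> R := pi_ge2 R.
split.
- move=> [x y]; have -> : (x, y) + (0, 1) = (x, y + 1) :> C.
    by congr pair; rewrite addr0.
  rewrite /cyl /= (mulrDr (2 * pi) y 1).
  by have := sin_cosD2pi 1 (2 * pi * y); rewrite mulr1z => -[-> ->].
- exists 1 => // w _; split; first exact: differentiable_cyl.
  move=> v; rewrite !derive_cyl /jC /=; congr pair; ring.
- move=> w _; rewrite derive_cyl /= !mulr1 !mulr0 subr0 addr0.
  apply/eqP => -[] h1 h2.
  have N : nsq (cyl w) = 0.
    have p0 : 2 * pi != 0 :> R by rewrite gt_eqF//; lra.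
    move/eqP: h1; rewrite mulf_eq0 (negbTE p0) => /eqP h1.
    move/eqP: h2; rewrite mulf_eq0 (negbTE p0) => /eqP h2.
    by rewrite /nsq /cyl /= h1 h2 mul0r addr0.
  by have := expR_gt0 (2 * (2 * pi * w.1)); rewrite -nsq_cyl N ltxx.
- move=> w w' _ _ e.
  have es : w.1 = w'.1.
    have : 2 * (2 * pi * w.1) = 2 * (2 * pi * w'.1).
      by apply: expR_inj; rewrite -!nsq_cyl e.
    move=> h; apply: (@mulfI _ (2 * (2 * pi) : R)); first by rewrite gt_eqF//; lra.
    by rewrite -!mulrA in h *.
  have E0 : expR (2 * pi * w'.1) != 0 by rewrite gt_eqF// expR_gt0.
  have ec : cos (2 * pi * w.2) = cos (2 * pi * w'.2).
    by apply: (mulfI E0); rewrite -{1}es; exact: (congr1 fst e).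
  have esin : sin (2 * pi * w.2) = sin (2 * pi * w'.2).
    by apply: (mulfI E0); rewrite -{1}es; exact: (congr1 snd e).
  have [m hm] := angle_unique ec esin; exists m.
  have {}hm : w.2 = w'.2 + m%:~R.
    apply: (@mulfI _ (2 * pi : R)); first by rewrite gt_eqF//; lra.
    by rewrite hm (mulrDr (2 * pi) w'.2).
  case: w w' es hm {e ec esin E0} => x y [x' y'] /= -> ->.
  by congr pair; rewrite addr0.
- move=> A; exists (`|A| + 1) => s t ss; rewrite ltNge; apply/negP => hA.
  have /andP[_] := norm_nsq (cyl (s, t)); rewrite nsq_cyl /= expRM_natl => h.
  have A0 : 0 <= A by apply: le_trans hA.
  rewrite ger0_norm// in ss.
  have E := expR_ge1Dx (2 * pi * s).
  have h4 : 4 * s <= 2 * pi * s by rewrite ler_wpM2r//; lra.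
  have h5 : 2 * A < expR (2 * pi * s) by lra.
  have h6 : (2 * A) ^+ 2 < expR (2 * pi * s) ^+ 2.
    by rewrite ltr_pXn2r ?nnegrE ?expR_ge0//; lra.
  have h7 : `|cyl (s, t)| ^+ 2 <= A ^+ 2 by rewrite ler_pXn2r ?nnegrE.
  by move: h6; rewrite exprMn; have := sqr_ge0 A; lra.
Qed.

End ExpCylinder.

Section Loops.
Context {R : realType} {n : nat}.
Local Notation M := (ucover R n).
Variable e : 'rV[R]_n.
Implicit Types (a b h t : R).

(** The circle over theta = h run once by t in [0, 1], starting at a + i b. *)
Definition loop h a b t : M :=
  vec3 e h (a * cos (2 * pi * t) - b * sin (2 * pi * t))
    (a * sin (2 * pi * t) + b * cos (2 * pi * t)).

Lemma isd_vec3 (f g k : R -> R) (x df dg dk : R) :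
  is_derive x (1 : R) f df -> is_derive x (1 : R) g dg -> is_derive x (1 : R) k dk ->
  is_derive x (1 : R) (fun x => vec3 e (f x) (g x) (k x)) (vec3 e df dg dk).
Proof.
have H (u : R -> R) du : is_derive x (1 : R) u du -> hasD u x (fun v => v * du).
  move=> hu; have d := isd_differentiable hu; split => // v.
  by rewrite derive_R// (isd_val hu).
move=> /H hf /H hg /H hk; have := derive_vec3 e hf hg hk (1 : R).
by rewrite !mul1r.
Qed.

Lemma isd_loop h a b t :
  is_derive t (1 : R) (loop h a b) (loop 0 (- (2 * pi * b)) (2 * pi * a) t).
Proof.
have dt : is_derive t (1 : R) (fun t => 2 * pi * t) (2 * pi).
  by apply: (isd_eq (isdM (isd_cst (2 * pi) t) (isd_id t))); rewrite mul0r add0r mulr1.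
have dc := isd_cos dt; have ds := isd_sin dt.
have h1 : is_derive t (1 : R) (fun t => a * cos (2 * pi * t) - b * sin (2 * pi * t))
    (- (2 * pi * b) * cos (2 * pi * t) - 2 * pi * a * sin (2 * pi * t)).
  by apply: (isd_eq (isdD (isdM (isd_cst a t) dc) (isdN (isdM (isd_cst b t) ds)))); ring.
have h2 : is_derive t (1 : R) (fun t => a * sin (2 * pi * t) + b * cos (2 * pi * t))
    (- (2 * pi * b) * sin (2 * pi * t) + 2 * pi * a * cos (2 * pi * t)).
  by apply: (isd_eq (isdD (isdM (isd_cst a t) ds) (isdM (isd_cst b t) dc))); ring.
exact: (isd_vec3 (isd_cst h t) h1 h2).
Qed.

(** The loops form a family stable under differentiation, which reduces C^oo
    convergence of loops to that of their parameters. *)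
Lemma derive1_loop h a b : derive1 (loop h a b) = loop 0 (- (2 * pi * b)) (2 * pi * a).
Proof. by apply/funext => t; rewrite derive1E; have [] := isd_loop h a b t. Qed.

Lemma loop_smooth h a b : smooth (loop h a b).
Proof.
have s2 k t : Ck_at k (fun t => 2 * pi * t) t by apply: Ck_atZ; exact: Ck_at_id.
have sc k t : Ck_at k (fun t => cos (2 * pi * t)) t := Ck_at_comp (Ck_at_cos k _) (s2 k t).
have ss k t : Ck_at k (fun t => sin (2 * pi * t)) t := Ck_at_comp (Ck_at_sin k _) (s2 k t).
move=> k; apply: Ck_vec3 => t; first exact: Ck_at_cst.
- by apply: Ck_atB; apply: Ck_atZ.
- by apply: Ck_atD; apply: Ck_atZ.
Qed.

Lemma loop_deck h a b m t : loop h a b t + deck m = loop (h + 2 * pi * m%:~R) a b t.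
Proof. by rewrite /loop /vec3 /deck; congr pair; rewrite /= addr0. Qed.

Lemma loop_period h a b t : loop h a b (t + 1) = loop h a b t.
Proof.
rewrite /loop mulrDr.
by have := sin_cosD2pi 1 (2 * pi * t); rewrite mulr1z => -[-> ->].
Qed.

Lemma norm_vec3 a b c : `|vec3 e a b c| <= (`|a| + `|b| + `|c|) * (1 + `|e|).
Proof.
have e0 := normr_ge0 e; have [ha hb hc] := And3 (normr_ge0 a) (normr_ge0 b) (normr_ge0 c).
rewrite /vec3 !prod_normE/= !normrZ !ge_max; apply/andP; split; first nra.
by apply/andP; split; nra.
Qed.

Lemma loop_derivn_dist j h a b h' a' b' t :
  `|derive1n j (loop h a b) t - derive1n j (loop h' a' b') t| <=
  2 * (1 + `|e|) * (2 * pi) ^+ j * (`|h - h'| + `|a - a'| + `|b - b'|).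
Proof.
elim: j h a b h' a' b' => [|j IHj] h a b h' a' b'.
  rewrite !derive1n0 expr0 mulr1 /loop.
  set c := cos _; set s := sin _.
  have -> : vec3 e h (a * c - b * s) (a * s + b * c) -
            vec3 e h' (a' * c - b' * s) (a' * s + b' * c) =
    vec3 e (h - h') ((a - a') * c - (b - b') * s) ((a - a') * s + (b - b') * c).
    rewrite -[X in _ - X]scale1r vec3B !mul1r; congr vec3; ring.
  apply: (le_trans (norm_vec3 _ _ _)).
  rewrite [X in _ <= X]mulrAC; apply: ler_wpM2r; first by rewrite addr_ge0.
  have hc : `|c| <= 1 by exact: cos_max.
  have hs : `|s| <= 1 by exact: sin_max.
  have B u v x y : `|x| <= 1 -> `|y| <= 1 -> `|u * x + v * y| <= `|u| + `|v| :> R.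
    move=> x1 y1; apply: (le_trans (ler_normD _ _)); rewrite !normrM.
    by apply: lerD; rewrite ler_piMr.
  have b1 := B (a - a') (- (b - b')) c s hc hs; rewrite mulNr normrN in b1.
  have b2 := B (a - a') (b - b') s c hs hc.
  have := normr_ge0 (h - h'); lra.
rewrite !derive1Sn !derive1_loop; apply: (le_trans (IHj _ _ _ _ _ _)).
have p0 : 0 <= pi :> R := pi_ge0 R.
have n2 : `|2 * pi| = 2 * pi :> R by rewrite ger0_norm// mulr_ge0.
have -> : - (2 * pi * b) - - (2 * pi * b') = - (2 * pi) * (b - b') by ring.
have -> : 2 * pi * a - 2 * pi * a' = 2 * pi * (a - a') by ring.
rewrite subrr normr0 add0r [`|_ * (b - b')|]normrM [`|_ * (a - a')|]normrM normrN n2 exprS.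
rewrite -mulrDr [`|b - b'| + _]addrC.
have N0 : 0 <= 2 * (1 + `|e|) * (2 * pi * (2 * pi) ^+ j) :> R.
  rewrite -exprS; apply: mulr_ge0; first by apply: mulr_ge0 => //; exact: addr_ge0.
  by apply: exprn_ge0; exact: mulr_ge0.
rewrite (_ : _ * _ * _ * (2 * pi * _) = 2 * (1 + `|e|) * (2 * pi * (2 * pi) ^+ j) * (`|a - a'| + `|b - b'|)); last by ring.
by apply: ler_wpM2l => //; rewrite -addrA lerDr.
Qed.

End Loops.

(** * The spiral planes *)

(** The data of a spiral plane: an orbit (lam, th) in l < 0 with lam 1 <= -1, the
    phase eta, and b, which is the R-component up to a correction (see [height]). *)
Section SpiralPlane.
Context {R : realType} {n : nat}.
Local Notation M := (ucover R n).
Local Notation C := (plane R).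
Implicit Types (w v z : C) (s : R).
Variables (e : 'rV[R]_n) (r0 : R).
Hypothesis e1 : dot e e = 1.
Hypothesis r00 : 0 < r0.
Let Q := r0 ^+ 2.
Variables (lam th eta b : R -> R).
Hypothesis o : orbit_of Q lam th.
Hypothesis lam_lt0 : forall s, lam s < 0.
Hypothesis lam1 : lam 1 <= -1.
Let c1 := lam 1 - 1.
Hypothesis deta : forall s, is_derive s (1 : R) eta
  (- (Q / 2 * expR (2 * lam s) * pott (lam s) (th s))).
Hypothesis db : forall s, is_derive s (1 : R) b
  (Q * (expR (ham (lam s) (th s)) - expR (2 * (s + c1)))).

Let Q0 : 0 < Q. Proof. by rewrite exprn_gt0. Qed.

Lemma lam_start s : s <= 1 -> lam s = s + c1.
Proof. by move=> s1; have [-> _] := orbit_far o lam1 s1; rewrite /c1; ring. Qed.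

Lemma th_start s : s <= 1 -> th s = th 1.
Proof. by move=> s1; have [_ ->] := orbit_far o lam1 s1. Qed.

Lemma lam_start_le s : s <= 1 -> lam s <= -1.
Proof. by move=> s1; rewrite lam_start// /c1; have := lam1; lra. Qed.

Lemma eta_start s : s <= 1 -> eta s = eta 1.
Proof.
move=> s1; apply: (isd_cst_on s1) => z /andP[_ z1].
have [_ _ p0] := pot_far (th z) (lam_start_le z1).
by apply: (isd_eq (deta z)); rewrite p0 mulr0 oppr0.
Qed.

(** The subtraction of exp (2 (s + c1)) in b' is made for this: the uncorrected
    R-component is not constant near s = -oo, but quadratic in w. *)
Lemma b_start s : s <= 1 -> b s = b 1.
Proof.
move=> s1; apply: (isd_cst_on s1) => z /andP[_ z1].
have [p0 _ _] := pot_far (th z) (lam_start_le z1).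
apply: (isd_eq (db z)); rewrite /ham p0 addr0 lam_start//.
by rewrite subrr mulr0.
Qed.

(** With al and be, the modulus and the components of the complex number mu s such
    that the spiral plane is w |-> (th s, mu s w), s = ln |w|. They are constant
    for s <= 1, so the plane is affine near 0. *)
Definition amp s : R := r0 * expR (lam s - s).
Definition al s : R := amp s * cos (eta s).
Definition be s : R := amp s * sin (eta s).
(** The pullback of the contact form by the spiral plane is gg s times
    w1 dw2 - w2 dw1, see [spiral_pullback]. *)
Definition gg s : R := Q * expR (ham (lam s) (th s) - 2 * s).

Lemma ell_start s : s <= 1 -> lam s - s = lam 1 - 1.
Proof. by move=> s1; rewrite lam_start// /c1; ring. Qed.

Lemma al_start s : s <= 1 -> al s = al 1.
Proof. by move=> s1; rewrite /al /amp ell_start// eta_start. Qed.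

Lemma be_start s : s <= 1 -> be s = be 1.
Proof. by move=> s1; rewrite /be /amp ell_start// eta_start. Qed.

Lemma gg_start s : s <= 1 -> gg s = gg 1.
Proof.
move=> s1; have [p0 _ _] := pot_far (th s) (lam_start_le s1).
have [p1 _ _] := pot_far (th 1) (lam_start_le (lexx 1)).
rewrite /gg /ham p0 p1; congr (_ * expR _).
by have := ell_start s1; lra.
Qed.

Lemma isd_al s : is_derive s (1 : R) al
  ((flowl (lam s) (th s) - 1) * al s
   + (Q / 2 * expR (2 * lam s) * pott (lam s) (th s)) * be s).
Proof.
have [dl _] := o s.
have D := isdM (isdM (isd_cst r0 s) (isd_expR (isdD dl (isdN (isd_id s)))))
  (isd_cos (deta s)).
by apply: (isd_eq D); rewrite /al /be /amp; ring.
Qed.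

Lemma isd_be s : is_derive s (1 : R) be
  ((flowl (lam s) (th s) - 1) * be s
   - (Q / 2 * expR (2 * lam s) * pott (lam s) (th s)) * al s).
Proof.
have [dl _] := o s.
have D := isdM (isdM (isd_cst r0 s) (isd_expR (isdD dl (isdN (isd_id s)))))
  (isd_sin (deta s)).
by apply: (isd_eq D); rewrite /al /be /amp; ring.
Qed.

Lemma Ck_at_lam k s : Ck_at k lam s. Proof. by have [h _] := orbit_Ck_at o k s. Qed.
Lemma Ck_at_th k s : Ck_at k th s. Proof. by have [_ h] := orbit_Ck_at o k s. Qed.

Lemma Ck_at_potlt k s : Ck_at k (fun s => pot (lam s) (th s)) s /\
  Ck_at k (fun s => pott (lam s) (th s)) s.
Proof.
have sc (z : R -> R) : Ck_at k z (lam s) -> Ck_at k (fun s => z (lam s)) s.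
  by move=> sz; exact: (Ck_at_comp sz (Ck_at_lam k s)).
have ssin : Ck_at k (fun s => sin (th s)) s by exact: (Ck_at_comp (Ck_at_sin k _) (Ck_at_th k s)).
have scos : Ck_at k (fun s => cos (th s)) s by exact: (Ck_at_comp (Ck_at_cos k _) (Ck_at_th k s)).
have [p0 p1 p2] := Ck_at_pot k (lam s).
split; rewrite /pot /pott.
  apply: Ck_atB; last exact: (Ck_atM (sc _ p2) scos).
  exact: (Ck_atD (sc _ p0) (Ck_atM (sc _ p1) ssin)).
exact: (Ck_atD (Ck_atM (sc _ p1) scos) (Ck_atM (sc _ p2) ssin)).
Qed.

Lemma Ck_at_exp k (f : R -> R) s : Ck_at k f s -> Ck_at k (fun s => expR (f s)) s.
Proof. by move=> sf; exact: (Ck_at_comp (Ck_at_expR k _) sf). Qed.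

Lemma Ck_at_eta k s : Ck_at k eta s.
Proof.
case: k => [|k]; first exact: isd_continuous (deta s).
apply: (Ck_atS1T deta); apply: Ck_atN; apply: Ck_atM; last by have [_ h] := Ck_at_potlt k s.
apply: Ck_atZ; apply: Ck_at_exp; apply: Ck_atZ; exact: Ck_at_lam.
Qed.

Lemma Ck_at_ham k s : Ck_at k (fun s => ham (lam s) (th s)) s.
Proof.
by apply: Ck_atD; [apply: Ck_atZ; exact: Ck_at_lam|have [h _] := Ck_at_potlt k s].
Qed.

Lemma Ck_at_b k s : Ck_at k b s.
Proof.
case: k => [|k]; first exact: isd_continuous (db s).
apply: (Ck_atS1T db); apply: Ck_atZ; apply: Ck_atB; apply: Ck_at_exp; first exact: Ck_at_ham.
by apply: Ck_atZ; apply: Ck_atD; [exact: Ck_at_id|exact: Ck_at_cst].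
Qed.

Lemma Ck_at_amp k s : Ck_at k amp s.
Proof.
by apply: Ck_atZ; apply: Ck_at_exp; apply: Ck_atB; [exact: Ck_at_lam|exact: Ck_at_id].
Qed.

Lemma Ck_at_al k s : Ck_at k al s.
Proof. exact: (Ck_atM (Ck_at_amp k s) (Ck_at_comp (Ck_at_cos k _) (Ck_at_eta k s))). Qed.

Lemma Ck_at_be k s : Ck_at k be s.
Proof. exact: (Ck_atM (Ck_at_amp k s) (Ck_at_comp (Ck_at_sin k _) (Ck_at_eta k s))). Qed.

Lemma Ck_at_gg k s : Ck_at k gg s.
Proof.
apply: Ck_atZ; apply: Ck_at_exp; apply: Ck_atB; first exact: Ck_at_ham.
by apply: Ck_atZ; exact: Ck_at_id.
Qed.

Definition UX w : R := al (logr w) * w.1 - be (logr w) * w.2.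
Definition UY w : R := al (logr w) * w.2 + be (logr w) * w.1.
Definition spiral w : M := vec3 e (th (logr w)) (UX w) (UY w).
(** The R-component of the plane. Its two terms are smooth for different reasons: the
    first is a polynomial, the second is constant near 0. *)
Definition height w : R := Q / 2 * expR (2 * c1) * nsq w + b (logr w).

(** The derivatives of the three components of the plane. *)
Definition Dth w v : R := flowt Q (lam (logr w)) (th (logr w)) * radial w v.
Definition DX w v : R :=
  al (logr w) * v.1 - be (logr w) * v.2 + radial w v *
   ((flowl (lam (logr w)) (th (logr w)) - 1) * UX w
    + (Q / 2 * expR (2 * lam (logr w)) * pott (lam (logr w)) (th (logr w))) * UY w).
Definition DY w v : R :=
  al (logr w) * v.2 + be (logr w) * v.1 + radial w v *
   ((flowl (lam (logr w)) (th (logr w)) - 1) * UY w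
    - (Q / 2 * expR (2 * lam (logr w)) * pott (lam (logr w)) (th (logr w))) * UX w).

Lemma hasD_thlogr w : hasD (fun w => th (logr w)) w (Dth w).
Proof. by apply: hasD_radial th_start _ _ _; have [_ h] := o (logr w). Qed.

Lemma hasD_UX w : hasD UX w (DX w).
Proof.
have ha := hasD_radial al_start (isd_al (logr w)).
have hb := hasD_radial be_start (isd_be (logr w)).
apply: (hasD_eq (hasDB (hasDM ha (hasD_w1 w)) (hasDM hb (hasD_w2 w)))) => v.
by rewrite /DX /UX /UY; ring.
Qed.

Lemma hasD_UY w : hasD UY w (DY w).
Proof.
have ha := hasD_radial al_start (isd_al (logr w)).
have hb := hasD_radial be_start (isd_be (logr w)).
apply: (hasD_eq (hasDD (hasDM ha (hasD_w2 w)) (hasDM hb (hasD_w1 w)))) => v.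
by rewrite /DY /UX /UY; ring.
Qed.

Lemma derive_spiral w v : 'D_v spiral w = vec3 e (Dth w v) (DX w v) (DY w v).
Proof.
by have [_ ->] := derive_vec3 e (hasD_thlogr w) (hasD_UX w) (hasD_UY w) v.
Qed.

Lemma smooth_spiral : smooth spiral.
Proof.
have sa k w := Ck_at_radial al_start w (Ck_at_al k).
have sb k w := Ck_at_radial be_start w (Ck_at_be k).
move=> k; apply: Ck_vec3 => w.
- exact: (Ck_at_radial th_start w (Ck_at_th k)).
- apply: Ck_atB; first exact: (Ck_atM (sa k w) (Ck_at_fst k w)).
  exact: (Ck_atM (sb k w) (Ck_at_snd k w)).
- apply: Ck_atD; first exact: (Ck_atM (sa k w) (Ck_at_snd k w)).
  exact: (Ck_atM (sb k w) (Ck_at_fst k w)).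
Qed.

Lemma Ck_at_height k w : Ck_at k height w.
Proof.
apply: Ck_atD; first by apply: Ck_atZ; exact: Ck_at_nsq.
exact: (Ck_at_radial b_start w (Ck_at_b k)).
Qed.

Lemma hasD_height w : hasD height w (fun v => radial w v * (nsq w * gg (logr w))).
Proof.
have D := hasDD (hasDZ (Q / 2 * expR (2 * c1)) (hasD_nsq w)) (hasD_radial b_start (db (logr w))).
apply: (hasD_eq D) => v.
have [w0|w0] := ltP 0 (nsq w); last first.
  have {}w0 : nsq w = 0 by apply/eqP; rewrite eq_le w0 nsq_ge0.
  have /eqP := w0; rewrite /nsq paddr_eq0 -?expr2 ?sqr_ge0// !sqrf_eq0.
  by move=> /andP[/eqP h1 /eqP h2]; rewrite /radial w0 h1 h2; ring.
have E := expR_logr w0.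
have E2 : expR (2 * (logr w + c1)) = nsq w * expR (2 * c1) by rewrite mulrDr expRD E.
rewrite /gg expRB E E2 /radial.
move: (expR (ham _ _)) (expR (2 * c1)) (nsq w) w0 (w.1 * v.1 + _) => {E E2} H c N N0 S.
by field; rewrite gt_eqF.
Qed.

Lemma UXY w : UX w * UX w + UY w * UY w = amp (logr w) ^+ 2 * nsq w.
Proof.
have := cos2Dsin2 (eta (logr w)).
rewrite /UX /UY /al /be /nsq; move: (cos _) (sin _) (amp _) => c s A h.
transitivity (A ^+ 2 * (c ^+ 2 + s ^+ 2) * (w.1 * w.1 + w.2 * w.2)); first by ring.
by rewrite h mulr1.
Qed.

Lemma UXY_Q w : 0 < nsq w -> UX w * UX w + UY w * UY w = Q * expR (2 * lam (logr w)).
Proof.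
move=> w0; rewrite UXY /amp exprMn -/Q -expRM_natl -(expR_logr w0) -mulrA -expRD.
by congr (_ * expR _); ring.
Qed.

Lemma half_ln_spiral w : 0 < nsq w -> half_ln Q (sqrad (spiral w)) = lam (logr w).
Proof. by move=> w0; rewrite sqrad_vec3// UXY_Q// half_ln_exp. Qed.

Lemma nsq0 w : nsq w = 0 -> w.1 = 0 /\ w.2 = 0.
Proof.
move=> /eqP; rewrite /nsq paddr_eq0 -?expr2 ?sqr_ge0// !sqrf_eq0.
by move=> /andP[/eqP h1 /eqP h2].
Qed.

Definition rot w v : R := (w.1 * v.2 - w.2 * v.1).

(** The contributions of th' and of eta' to lambda0 cancel each other; this fixes
    the equation for eta. *)
Lemma lambda0_spiral w v : lambda0 (spiral w) ('D_v spiral w) = amp (logr w) ^+ 2 * rot w v.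
Proof.
rewrite derive_spiral lambda0_vec3//.
have [w0|w0] := ltP 0 (nsq w); last first.
  have {}w0 : nsq w = 0 by apply/eqP; rewrite eq_le w0 nsq_ge0.
  have [h1 h2] := nsq0 w0.
  by rewrite /Dth /rot /UX /UY /radial w0 h1 h2 invr0; ring.
have E := UXY_Q w0.
have A2 : amp (logr w) ^+ 2 = (UX w * UX w + UY w * UY w) / nsq w.
  by rewrite UXY mulfK// gt_eqF.
rewrite A2.
have hq : flowt Q (lam (logr w)) (th (logr w)) =
  (UX w * UX w + UY w * UY w) * (Q / 2 * expR (2 * lam (logr w)) * pott (lam (logr w)) (th (logr w))).
  rewrite E /flowt (_ : 4 * _ = 2 * lam (logr w) + 2 * lam (logr w)); last by ring.
  by rewrite expRD; ring.
rewrite /Dth hq /DX /DY.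
set K := Q / 2 * _ * _; set L := flowl _ _ - 1; rewrite /UX /UY /radial /rot /nsq.
field; rewrite -/(nsq w) gt_eqF//.
Qed.

Lemma reeb_proj_spiral w v : reeb_proj (conformal (Fpot Q) lambda0) (spiral w) ('D_v spiral w)
  = vec3 e (Dth w v - amp (logr w) ^+ 2 * rot w v *
        (1 + (UX w * UX w + UY w * UY w) * Frad Q (spiral w)))
      (DX w v - amp (logr w) ^+ 2 * rot w v *
        (Frad Q (spiral w) * UY w - Fth Q (spiral w) / 2 * UX w))
      (DY w v - amp (logr w) ^+ 2 * rot w v *
        (- (Frad Q (spiral w) * UX w) - Fth Q (spiral w) / 2 * UY w)).
Proof. by rewrite reeb_projE// lambda0_spiral derive_spiral reeb_vec3// vec3B. Qed.

(** By [lambda0_spiral] both sides are explicit; the identity holds because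
    the equations of lam, th and eta express l', theta' and eta' by the derivatives of
    F occurring in the Reeb field. *)
Lemma spiral_holomorphic w v :
  reeb_proj (conformal (Fpot Q) lambda0) (spiral w) ('D_(jC v) spiral w) =
  Jstd (spiral w) (reeb_proj (conformal (Fpot Q) lambda0) (spiral w) ('D_v spiral w)).
Proof.
apply: etrans (reeb_proj_spiral w (jC v)) _.
apply: etrans _ (esym (congr1 (Jstd (spiral w)) (reeb_proj_spiral w v))).
apply: etrans _ (esym (Jstd_vec3 e1 (th (logr w)) (UX w) (UY w) _ _ _)).
have [w0|w0] := ltP 0 (nsq w); last first.
  have {}w0 : nsq w = 0 by apply/eqP; rewrite eq_le w0 nsq_ge0.
  have [h1 h2] := nsq0 w0.
  rewrite /Dth /DX /DY /rot /UX /UY /radial w0 h1 h2 invr0 /=.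
  by congr vec3; ring.
have E := UXY_Q w0.
have q0 : 0 < UX w * UX w + UY w * UY w by rewrite E mulr_gt0// expR_gt0.
have A2 : amp (logr w) ^+ 2 = (UX w * UX w + UY w * UY w) / nsq w.
  by rewrite UXY mulfK// gt_eqF.
have HL : flowl (lam (logr w)) (th (logr w)) - 1 =
   (UX w * UX w + UY w * UY w) * Frad Q (spiral w).
  rewrite /Frad half_ln_spiral// sqrad_vec3//= /flowl.
  by field; rewrite gt_eqF.
have HT : Fth Q (spiral w) = pott (lam (logr w)) (th (logr w)).
  by rewrite /Fth half_ln_spiral.
have hq : flowt Q (lam (logr w)) (th (logr w)) =
  (UX w * UX w + UY w * UY w) * (UX w * UX w + UY w * UY w) / 2 * Fth Q (spiral w).
  rewrite E /flowt HT (_ : 4 * _ = 2 * lam (logr w) + 2 * lam (logr w)); last by ring.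
  by rewrite expRD; ring.
have hK : Q / 2 * expR (2 * lam (logr w)) * pott (lam (logr w)) (th (logr w)) =
  (UX w * UX w + UY w * UY w) / 2 * Fth Q (spiral w).
  by rewrite E HT; ring.
have nw : w.1 * w.1 + w.2 * w.2 != 0 by rewrite -/(nsq w) gt_eqF.
rewrite /Dth /DX /DY HL hK hq A2 /rot /radial /jC /=.
move: (Fth Q _) (Frad Q _) => T ph {E q0 A2 HL HT hq hK}.
rewrite /UX /UY /nsq.
by congr vec3; field.
Qed.

Lemma spiral_pullback w v : pullback spiral (conformal (Fpot Q) lambda0) w v =
  gg (logr w) * rot w v.
Proof.
rewrite /pullback /conformal lambda0_spiral mulrA.
have [w0|w0] := ltP 0 (nsq w); last first.
  have {}w0 : nsq w = 0 by apply/eqP; rewrite eq_le w0 nsq_ge0.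
  have [h1 h2] := nsq0 w0.
  by rewrite /rot h1 h2; ring.
congr (_ * _); rewrite /Fpot half_ln_spiral//= /gg /ham /amp exprMn -/Q -expRM_natl.
by rewrite mulrCA -expRD; congr (_ * expR _); ring.
Qed.

Lemma spiral_pseudoholomorphic :
  pseudoholomorphic (conformal (Fpot Q) lambda0) Jstd height spiral.
Proof.
split.
- by apply: smooth_Ck_at => k w; exact: Ck_at_height.
- exact: smooth_spiral.
- exact: spiral_holomorphic.
- move=> w v; rewrite spiral_pullback (hasD_height w).2.
  have [w0|w0] := ltP 0 (nsq w); last first.
    have {}w0 : nsq w = 0 by apply/eqP; rewrite eq_le w0 nsq_ge0.
    have [h1 h2] := nsq0 w0.
    by rewrite /rot /radial h1 h2 w0; ring.
  rewrite /rot /radial /jC /=; field.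
  by rewrite gt_eqF.
Qed.

(** * The Hofer energy of a spiral plane *)

Section Energy.
Notation mR := (measurableTypeR R).
Variable phi : R -> R.
Hypothesis sphi : smooth phi.
Hypothesis phi01 : forall x, 0 <= phi x <= 1.
Hypothesis dphi0 : forall x, 0 <= derive1 phi x.

Lemma isd_gg s : is_derive s (1 : R) gg (gg s * (speed Q (lam s) (th s) - 2)).
Proof.
have D := isdM (isd_cst Q s) (isd_expR (isdD (isd_ham o s)
  (isdN (isdM (isd_cst 2 s) (isd_id s))))).
by apply: (isd_eq D); rewrite /gg; ring.
Qed.

(** The form whose differential is integrated is coef (w1 dw2 - w2 dw1), so
    the integrand is the divergence of the field (flux1, flux2) = coef w. *)
Definition coef w : R := phi (height w) * gg (logr w).
(** The derivative of coef in the variable logr w. *)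
Definition dcoef w : R := derive1 phi (height w) * (nsq w * gg (logr w)) * gg (logr w)
  + phi (height w) * (gg (logr w) * (speed Q (lam (logr w)) (th (logr w)) - 2)).

Lemma Ck_at_coef k w : Ck_at k coef w.
Proof.
apply: Ck_atM; last exact: (Ck_at_radial gg_start w (Ck_at_gg k)).
exact: (Ck_at_comp (Ck_at_smooth sphi k _) (Ck_at_height k w)).
Qed.

Lemma hasD_coef w : hasD coef w (fun v => dcoef w * radial w v).
Proof.
have hp : is_derive (height w) (1 : R) phi (derive1 phi (height w)).
  by rewrite derive1E; exact: (Ck_at1_isd (Ck_at_smooth sphi 1 _)).
have D := hasDM (hasD_comp hp (hasD_height w)) (hasD_radial gg_start (isd_gg (logr w))).
by apply: (hasD_eq D) => v; rewrite /dcoef; ring.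
Qed.

Definition flux1 w : R := coef w * w.1.
Definition flux2 w : R := coef w * w.2.
Definition dflux1 w : R := coef w + dcoef w * radial w (1, 0) * w.1.
Definition dflux2 w : R := coef w + dcoef w * radial w (0, 1) * w.2.

Lemma hasD_flux1 w : hasD flux1 w (fun v => dcoef w * radial w v * w.1 + coef w * v.1).
Proof. exact: (hasDM (hasD_coef w) (hasD_w1 w)). Qed.

Lemma hasD_flux2 w : hasD flux2 w (fun v => dcoef w * radial w v * w.2 + coef w * v.2).
Proof. exact: (hasDM (hasD_coef w) (hasD_w2 w)). Qed.

Lemma Ck_at_flux1 k w : Ck_at k flux1 w.
Proof. by apply: Ck_atM; [exact: Ck_at_coef|exact: Ck_at_fst]. Qed.

Lemma Ck_at_flux2 k w : Ck_at k flux2 w.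
Proof. by apply: Ck_atM; [exact: Ck_at_coef|exact: Ck_at_snd]. Qed.

Lemma dflux1_continuous : continuous dflux1.
Proof.
rewrite (_ : dflux1 = 'D_(1, 0) flux1); last first.
  by apply/funext => w; rewrite (hasD_flux1 w).2 /dflux1 mulr1 addrC.
by move=> w; have [_ h] := Ck_at_flux1 1 w; exact: (h (1, 0)).
Qed.

Lemma dflux2_continuous : continuous dflux2.
Proof.
rewrite (_ : dflux2 = 'D_(0, 1) flux2); last first.
  by apply/funext => w; rewrite (hasD_flux2 w).2 /dflux2 mulr1 addrC.
by move=> w; have [_ h] := Ck_at_flux2 1 w; exact: (h (0, 1)).
Qed.

(** nsq w * gg is Q exp ham, and ham < 0. *)
Lemma gg_bound w : 0 <= gg (logr w) /\ nsq w * gg (logr w) <= Q.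
Proof.
split; first by rewrite mulr_ge0 ?expR_ge0// ltW.
have [w0|w0] := ltP 0 (nsq w); last first.
  have {}w0 : nsq w = 0 by apply/eqP; rewrite eq_le w0 nsq_ge0.
  by rewrite w0 mul0r ltW.
rewrite /gg -{1}(expR_logr w0) mulrCA -expRD (_ : _ + (_ - _) = ham (lam (logr w)) (th (logr w))); last by ring.
by rewrite ger_pMr// expR_le1 ltW// ham_lt0.
Qed.

Lemma coef_bound w : 0 <= coef w /\ nsq w * coef w <= Q.
Proof.
have /andP[p0 p1] := phi01 (height w); have [g0 g1] := gg_bound w.
split; first exact: mulr_ge0.
by apply: le_trans g1; rewrite /coef mulrCA; apply: ler_piMl => //; rewrite mulr_ge0// nsq_ge0.
Qed.

Lemma dform_energy w :
  dform (fun q v : C => phi (height q) * pullback spiral (conformal (Fpot Q) lambda0) q v) w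
    ((1, 0) : C) ((0, 1) : C) = dflux1 w + dflux2 w.
Proof.
have E1 : (fun q : C => phi (height q) * pullback spiral (conformal (Fpot Q) lambda0) q (0, 1)) = flux1.
  by apply/funext => q; rewrite spiral_pullback /rot /flux1 /coef /=; ring.
have E2 : (fun q : C => phi (height q) * pullback spiral (conformal (Fpot Q) lambda0) q (1, 0)) = (fun q => - flux2 q).
  by apply/funext => q; rewrite spiral_pullback /rot /flux2 /coef /=; ring.
transitivity ('D_((1, 0) : C) flux1 w - 'D_((0, 1) : C) (fun q => - flux2 q) w).
  exact: (congr2 (fun f g : C -> R => 'D_((1, 0) : C) f w - 'D_((0, 1) : C) g w) E1 E2).
by rewrite (hasD_flux1 w).2 (hasDN (hasD_flux2 w)).2 /dflux1 /dflux2 /=; ring.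
Qed.

(** The density is 2 coef + dcoef, which contains phi' >= 0 and the speed of ham along
    the orbit, both with nonnegative coefficients. *)
Lemma energy_density_ge0 w : 0 <= dflux1 w + dflux2 w.
Proof.
have [w0|w0] := ltP 0 (nsq w); last first.
  have {}w0 : nsq w = 0 by apply/eqP; rewrite eq_le w0 nsq_ge0.
  have [h1 h2] := nsq0 w0; have [K0 _] := coef_bound w.
  by rewrite /dflux1 /dflux2 h1 h2 !mulr0 !addr0 addr_ge0.
have -> : dflux1 w + dflux2 w = 2 * coef w + dcoef w.
  have := w0; rewrite /dflux1 /dflux2 /radial /= => /gt_eqF; rewrite /nsq => /negbT w0'.
  by field.
have -> : 2 * coef w + dcoef w = derive1 phi (height w) * (nsq w * gg (logr w)) * gg (logr w)
  + phi (height w) * (gg (logr w) * speed Q (lam (logr w)) (th (logr w))).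
  by rewrite /coef /dcoef; ring.
have [g0 _] := gg_bound w; have /andP[p0 _] := phi01 (height w).
apply: addr_ge0.
  by apply: mulr_ge0 => //; apply: mulr_ge0 => //; apply: mulr_ge0 => //; exact: nsq_ge0.
by apply: mulr_ge0 => //; apply: mulr_ge0 => //; exact: speed_ge0.
Qed.

Lemma measurable_w1 : measurable_fun [set: mR * mR] (fun w : mR * mR => w.1 : R).
Proof. exact: measurable_fst. Qed.

Lemma measurable_w2 : measurable_fun [set: mR * mR] (fun w : mR * mR => w.2 : R).
Proof. exact: measurable_snd. Qed.

Lemma measurable_nsq : measurable_fun [set: mR * mR] (nsq : mR * mR -> R).
Proof.
apply: measurable_funD; apply: measurable_funM;
  solve [exact: measurable_w1 | exact: measurable_w2].
Qed.

Lemma measurable_logr : measurable_fun [set: mR * mR] (logr : mR * mR -> R).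
Proof.
apply: measurable_funM; first exact: measurable_cst.
exact: (measurableT_comp (@measurable_ln R) measurable_nsq).
Qed.

Lemma measurable_rad (g : R -> R) : continuous g ->
  measurable_fun [set: mR * mR] (fun w : mR * mR => g (logr w)).
Proof.
by move=> cg; exact: (measurableT_comp (continuous_measurable_fun cg) measurable_logr).
Qed.

Lemma measurable_height : measurable_fun [set: mR * mR] (height : mR * mR -> R).
Proof.
apply: measurable_funD; last by apply: measurable_rad => s; exact: (Ck_at_b 0 s).
by apply: measurable_funM; [exact: measurable_cst|exact: measurable_nsq].
Qed.

Lemma measurable_phi_height (g : R -> R) : continuous g ->
  measurable_fun [set: mR * mR] (fun w : mR * mR => g (height w)).
Proof.
by move=> cg; exact: (measurableT_comp (continuous_measurable_fun cg) measurable_height).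
Qed.

Lemma speed_orbit_continuous : continuous (fun s => speed Q (lam s) (th s)).
Proof.
move=> s; apply: (@continuous_comp _ _ _ (fun s => (lam s, th s)) (fun p : R * R => speed Q p.1 p.2)).
  have hl : lam x @[x --> s] --> lam s by exact: (Ck_at_lam 0 s).
  have ht : th x @[x --> s] --> th s by exact: (Ck_at_th 0 s).
  exact: (cvg_pair hl ht).
exact: speed_continuous.
Qed.

Lemma measurable_coef : measurable_fun [set: mR * mR] (coef : mR * mR -> R).
Proof.
apply: measurable_funM; last by apply: measurable_rad => s; exact: (Ck_at_gg 0 s).
by apply: measurable_phi_height => s; exact: (Ck_at_smooth sphi 0 s).
Qed.

Lemma measurable_dcoef : measurable_fun [set: mR * mR] (dcoef : mR * mR -> R).
Proof.
have mg : measurable_fun [set: mR * mR] (fun w : mR * mR => gg (logr w)).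
  by apply: measurable_rad => s; exact: (Ck_at_gg 0 s).
apply: measurable_funD; apply: measurable_funM.
- apply: measurable_funM.
    apply: measurable_phi_height => s.
    have [_ h] := Ck_at_smooth sphi 1 s.
    rewrite (_ : derive1 phi = 'D_1 phi); last by apply/funext => x; rewrite derive1E.
    exact: (h 1).
  by apply: measurable_funM; [exact: measurable_nsq|exact: mg].
- exact: mg.
- by apply: measurable_phi_height => s; exact: (Ck_at_smooth sphi 0 s).
- apply: measurable_funM; first exact: mg.
  apply: (measurable_rad (g := fun s => speed Q (lam s) (th s) - 2)) => s.
  exact: (cvgB (@speed_orbit_continuous s) (cvg_cst _)).
Qed.

(** Replaces 1 / nsq w by a continuous function of logr w, for measurability. *)
Lemma radial_exp (x : R) w : (nsq w = 0 -> x = 0) ->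
  x / nsq w = x * expR (- (2 * logr w)).
Proof.
move=> h; have [w0|w0] := ltP 0 (nsq w); first by rewrite expRN expR_logr.
by rewrite h ?mul0r//; apply/eqP; rewrite eq_le w0 nsq_ge0.
Qed.

Lemma measurable_dflux (p : C -> R) (v : C) :
  measurable_fun [set: mR * mR] (p : mR * mR -> R) ->
  (forall w, w.1 * v.1 + w.2 * v.2 = p w) ->
  measurable_fun [set: mR * mR] ((fun w => coef w + dcoef w * radial w v * p w) : mR * mR -> R).
Proof.
move=> mp pv.
rewrite (_ : ((fun w => _) : mR * mR -> R) = (fun w : mR * mR =>
    coef w + dcoef w * (p w * expR (- (2 * logr w))) * p w)); last first.
  apply/funext => w; rewrite /radial pv radial_exp//.
  by move=> /nsq0[h1 h2]; rewrite -pv h1 h2 !mul0r addr0.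
apply: measurable_funD; first exact: measurable_coef.
apply: measurable_funM => //; apply: measurable_funM; first exact: measurable_dcoef.
apply: measurable_funM => //.
apply: (measurable_rad (g := fun s => expR (- (2 * s)))) => s.
apply: (Ck_at_exp (k := 0) (f := fun s => - (2 * s))).
by apply: Ck_atN; apply: Ck_atZ; exact: Ck_at_id.
Qed.

Lemma measurable_dflux1 : measurable_fun [set: mR * mR] (dflux1 : mR * mR -> R).
Proof. by apply: measurable_dflux => [|w]; [exact: measurable_w1|rewrite mulr1 mulr0 addr0]. Qed.

Lemma measurable_dflux2 : measurable_fun [set: mR * mR] (dflux2 : mR * mR -> R).
Proof. by apply: measurable_dflux => [|w]; [exact: measurable_w2|rewrite mulr1 mulr0 add0r]. Qed.

Lemma bounded_on_square N (f : R * R -> R) : 0 <= N -> continuous f ->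
  exists c, forall w, square N w -> `|f w| <= c.
Proof.
move=> N0 cf.
pose K : set (R * R) := `[- N, N]%classic `*` `[- N, N]%classic.
have cK : compact K by apply: compact_setX; exact: segment_compact.
have K0 : K !=set0 by exists (0, 0); split; rewrite /= in_itv/= oppr_le0 N0.
have cn : continuous (fun w : R * R => `|f w|) by move=> w; exact: (cvg_norm (cf w)).
have [c _ Hc] := compact_EVT_max K0 cK (continuous_subspaceT cn).
by exists `|f c| => w Sw; apply: Hc; apply/mem_set.
Qed.

Lemma cvg_slice1 (f : R * R -> R) y : continuous f -> continuous (fun x => f (x, y)).
Proof.
move=> cf x; apply: (@continuous_comp _ _ _ (fun x : R => (x, y)) f); last exact: cf.
exact: (cvg_pair (@cvg_id _ (nbhs x)) (cvg_cst y)).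
Qed.

Lemma cvg_slice2 (f : R * R -> R) x : continuous f -> continuous (fun y => f (x, y)).
Proof.
move=> cf y; apply: (@continuous_comp _ _ _ (fun y : R => (x, y)) f); last exact: cf.
exact: (cvg_pair (cvg_cst x) (@cvg_id _ (nbhs y))).
Qed.

(** On the boundary of the square, nsq w >= N^2. *)
Lemma coef_side N w : 0 < N -> (`|w.1| = N \/ `|w.2| = N) -> coef w <= Q / N ^+ 2.
Proof.
move=> N0 h; have [k0 k1] := coef_bound w.
rewrite ler_pdivlMr ?exprn_gt0// mulrC; apply: le_trans k1; apply: ler_wpM2r => //.
rewrite /nsq -!expr2 -(real_normK (num_real w.1)) -(real_normK (num_real w.2)).
by case: h => ->; [rewrite lerDl|rewrite lerDr]; rewrite sqr_ge0.
Qed.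

(** The boundary terms are at most Q / N on each of the four sides, of length 2 N. *)
Lemma energy_square N : 1 <= N ->
  (\int[(@lebesgue_measure R \x @lebesgue_measure R)%E]_(w in square N) (dflux1 w + dflux2 w)%:E
    <= (8 * Q)%:E)%E.
Proof.
move=> N1; have N0 : 0 < N by lra.
have [c1' H1] := bounded_on_square (ltW N0) dflux1_continuous.
have [c2' H2] := bounded_on_square (ltW N0) dflux2_continuous.
have i1 := integrable_square (ltW N0) measurable_dflux1 H1.
have i2 := integrable_square (ltW N0) measurable_dflux2 H2.
have -> : (\int[(@lebesgue_measure R \x @lebesgue_measure R)%E]_(w in square N) (dflux1 w + dflux2 w)%:E =
  \int[(@lebesgue_measure R \x @lebesgue_measure R)%E]_(w in square N) (dflux1 w)%:E +
  \int[(@lebesgue_measure R \x @lebesgue_measure R)%E]_(w in square N) (dflux2 w)%:E)%E.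
  rewrite -(integralD (measurable_square N) i1 i2).
  by apply: eq_integral => w _; rewrite EFinD.
have cflux1 : continuous flux1 by move=> w; exact: (Ck_at_flux1 0 w).
have cflux2 : continuous flux2 by move=> w; exact: (Ck_at_flux2 0 w).
have c0 : 0 <= Q / N by rewrite divr_ge0 ?ltW.
have side (w : C) (x : R) : `|x| = N -> (`|w.1| = N \/ `|w.2| = N) -> `|coef w * x| <= Q / N.
  move=> xN h; rewrite normrM xN; have [k0 _] := coef_bound w.
  rewrite ger0_norm//; have := coef_side N0 h; rewrite -(ler_pM2r N0) => /le_trans; apply.
  by rewrite le_eqVlt; apply/orP; left; apply/eqP; field; rewrite gt_eqF.
have nN : `|N| = N by rewrite gtr0_norm.
have nNN : `|- N| = N by rewrite normrN.
have -> : 8 * Q = 4 * N * (Q / N) + 4 * N * (Q / N) by field; rewrite gt_eqF.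
rewrite EFinD; apply: leeD.
- apply: (@fst_square_le _ N (Q / N) flux1 dflux1 N0 c0 measurable_dflux1).
  + by exists c1'.
  + move=> y x; apply: (isd_eq (hasD_isd_fst (hasD_flux1 (x, y)))).
    by rewrite /dflux1 mulr1 addrC.
  + by move=> y; exact: cvg_slice1 dflux1_continuous.
  + by move=> x; exact: cvg_slice2 cflux1.
  + by move=> y _; split; apply: side => //=; left.
- apply: (@snd_square_le _ N (Q / N) flux2 dflux2 N0 c0 measurable_dflux2).
  + by exists c2'.
  + move=> x y; apply: (isd_eq (hasD_isd_snd (hasD_flux2 (x, y)))).
    by rewrite /dflux2 mulr1 addrC.
  + by move=> x; exact: cvg_slice2 dflux2_continuous.
  + by move=> y; exact: cvg_slice1 cflux2.
  + by move=> x _; split; apply: side => //=; right.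
Qed.

Lemma energy_le :
  (\int[(@lebesgue_measure R \x @lebesgue_measure R)%E]_w
      (dform (fun q v : C => phi (height q) * pullback spiral (conformal (Fpot Q) lambda0) q v) w
         ((1, 0) : C) ((0, 1) : C))%:E <= (8 * Q)%:E)%E.
Proof.
under eq_integral => w _ do rewrite dform_energy.
apply: (@plane_integral_le _ (fun w => dflux1 w + dflux2 w)).
- by apply: measurable_funD; [exact: measurable_dflux1|exact: measurable_dflux2].
- exact: energy_density_ge0.
- by move=> N N1; exact: energy_square.
Qed.

End Energy.

Lemma spiral_energy : (hofer_energy (conformal (Fpot Q) lambda0) height spiral < +oo)%E.
Proof.
apply: (@le_lt_trans _ _ (8 * Q)%:E); last exact: ltry.
apply: ge_ereal_sup => _ [phi [sphi p01 dp _ _] <-].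
exact: energy_le.
Qed.

End SpiralPlane.

(** * The limit set of a spiral plane *)

Section Torus.
Context {R : realType} {n : nat}.
Local Notation M := (ucover R n).
Variables (e : 'rV[R]_n) (Q : R).
Hypothesis e1 : dot e e = 1.

(** The torus of radius sqrt Q over the complex line spanned by e. *)
Definition axis_torus : set M :=
  [set p | exists h a b, a * a + b * b = Q /\ p = vec3 e h a b].

Lemma vec3_deck h a b (m : int) : vec3 e h a b + deck m = vec3 e (h + 2 * pi * m%:~R) a b.
Proof. by rewrite /vec3 /deck; congr pair; rewrite /= addr0. Qed.

Lemma axis_torus_deck p (m : int) : axis_torus (p + deck m) <-> axis_torus p.
Proof.
split=> -[h [a [b [ab E]]]]; last first.
  by exists (h + 2 * pi * m%:~R), a, b; split => //; rewrite E vec3_deck.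
exists (h + 2 * pi * (- m)%:~R), a, b; split => //.
rewrite -vec3_deck -E -addrA (_ : deck m + deck (- m) = 0 :> M) ?addr0//.
by rewrite /deck; congr pair; rewrite ?addr0//= -mulrDr -intrD subrr mulr0.
Qed.

(** The complex line over e is closed in R^2n because it is cut out by continuous linear
    functionals: the coordinates of p - dot p e * e. *)
Lemma axis_torus_limit (c : nat -> M) (h a b : nat -> R) p :
  (forall k, c k = vec3 e (h k) (a k) (b k)) ->
  c k @[k --> \oo] --> p -> sqrad (c k) @[k --> \oo] --> Q -> axis_torus p.
Proof.
move=> cE cp cq; exists p.1, (dot p.2.1 e), (dot p.2.2 e).
have lim (f : M -> R) : {for p, continuous f} -> f (c k) @[k --> \oo] --> f p.
  by move=> cf; exact: (@cvg_comp _ _ _ _ _ _ _ _ cp cf).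
have uniq (f : M -> R) x : {for p, continuous f} -> f (c k) @[k --> \oo] --> x -> f p = x.
  by move=> /lim h1 h2; apply: (cvg_unique _ h1 h2).
have zero (f : M -> R) : {for p, continuous f} -> (forall k, f (c k) = 0) -> f p = 0.
  move=> cf f0; apply: uniq => //.
  by rewrite (_ : (fun k => f (c k)) = (fun=> 0)); [exact: cvg_cst|exact/funext].
have pE : p = vec3 e p.1 (dot p.2.1 e) (dot p.2.2 e).
  rewrite {1}(surjective_pairing p) {1}(surjective_pairing p.2) /vec3.
  congr pair; congr pair; apply/rowP => i; rewrite mxE; apply/eqP; rewrite -subr_eq0; apply/eqP.
    apply: (zero (fun p : M => p.2.1 0 i - dot p.2.1 e * e 0 i)) => [|k].
      have D := hasDB (hasD_cx i p) (hasDM (hasD_dotx e p) (hasD_cst (e 0 i) p)).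
      exact: (differentiable_continuous D.1).
    by rewrite cE /= dotZl e1 mulr1 mxE subrr.
  apply: (zero (fun p : M => p.2.2 0 i - dot p.2.2 e * e 0 i)) => [|k].
    have D := hasDB (hasD_cy i p) (hasDM (hasD_doty e p) (hasD_cst (e 0 i) p)).
    exact: (differentiable_continuous D.1).
  by rewrite cE /= dotZl e1 mulr1 mxE subrr.
split; last exact: pE.
rewrite -(sqrad_vec3 e1 p.1) -pE; apply: uniq => //.
exact: (Ck_at_cvg (Ck_at_sqrad 0 p)).
Qed.

(** The convergence of loops controls t in [0, 1] only; other parameters are reached
    through the periodicity of the lift. *)
Lemma axis_torus_loop (gamma : R -> M) (m : int) :
  (forall t, gamma (t + 1) = gamma t + deck m) ->
  (forall t, 0 <= t <= 1 -> axis_torus (gamma t)) -> forall t, axis_torus (gamma t).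
Proof.
move=> per on t.
have H (k : nat) (x : R) : (axis_torus (gamma (x + k%:R)) <-> axis_torus (gamma x)).
  elim: k => [|k IHk]; first by rewrite addr0.
  by rewrite -natr1 addrA per; split=> [/axis_torus_deck/IHk|/IHk/axis_torus_deck].
have /andP[f0 f1] := floor_itv t.
set x := t - (Num.floor t)%:~R.
have ox : axis_torus (gamma x) by apply: on; rewrite /x; move: f1; rewrite intrD; lra.
have tE : t = x + (Num.floor t)%:~R by rewrite /x subrK.
move: tE ox; move: x (Num.floor t) => x [k|k] tE ox.
  by rewrite tE; apply/H.
by apply/(H k.+1); rewrite tE NegzE mulrNz subrK.
Qed.

(** The time is the argument of the quotient (X + i Y) / (a + i b). *)
Lemma loop_hits h a b X Y : a * a + b * b = Q -> X * X + Y * Y = Q -> 0 < Q ->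
  exists t, loop e h a b t = vec3 e h X Y.
Proof.
move=> ab XY Q0.
have [|x [cx sx]] := @angle_exists _ ((a * X + b * Y) / Q) ((a * Y - b * X) / Q).
  have -> : ((a * X + b * Y) / Q) ^+ 2 + ((a * Y - b * X) / Q) ^+ 2 =
     (a * a + b * b) * (X * X + Y * Y) / (Q * Q) by field; rewrite gt_eqF.
  by rewrite ab XY divff// mulf_neq0// gt_eqF.
have p0 : 0 < pi :> R := pi_gt0 R.
exists (x / (2 * pi)); rewrite /loop (_ : 2 * pi * (x / (2 * pi)) = x); last first.
  by rewrite mulrC divfK// gt_eqF// mulr_gt0.
rewrite cx sx; congr vec3; apply: (@mulIf _ Q); rewrite ?gt_eqF//.
  transitivity ((a * a + b * b) * X); first by field; rewrite gt_eqF.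
  by rewrite ab mulrC.
transitivity ((a * a + b * b) * Y); first by field; rewrite gt_eqF.
by rewrite ab mulrC.
Qed.

End Torus.

Section OrbitLimits.
Context {R : realType}.
Variables (Q : R) (lam th : R -> R).
Hypothesis Q0 : 0 < Q.
Hypothesis o : orbit_of Q lam th.
Hypothesis lam_lt0 : forall s, lam s < 0.

Lemma cvg_to0_below (f : R -> R) : (forall s, f s < 0) ->
  (forall B : R, B < 0 -> exists S, forall s, S <= s -> B < f s) -> f s @[s --> +oo] --> 0.
Proof.
move=> f0 fB; apply/cvgrPdist_lt => eps eps0.
have [S HS] := fB (- eps) ltac:(rewrite oppr_lt0//).
near=> s; rewrite add0r normrN ltr0_norm// ltrNl; apply: HS.
near: s; exact: nbhs_pinfty_ge (num_real S).
Unshelve. all: by end_near. Qed.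

Lemma lam_cvg : lam s @[s --> +oo] --> 0.
Proof. by apply: cvg_to0_below => [|B B0]; [exact: lam_lt0|exact: (lam_to_0 Q0 o lam_lt0 B0)]. Qed.

Lemma ham_cvg : ham (lam s) (th s) @[s --> +oo] --> 0.
Proof.
apply: cvg_to0_below => [s|B B0]; first exact: ham_lt0.
have [S HS] := ham_orbit_to_0 Q0 o lam_lt0 B0; exists S => s Ss.
exact: lt_le_trans HS (ham_orbit_nondecr o Ss).
Qed.

(** The angle goes to infinity continuously, hence takes all values modulo 2 pi
    arbitrarily late. *)
Lemma th_recurs (th0 A : R) : exists s (m : int), A <= s /\ th s = th0 + 2 * pi * m%:~R.
Proof.
have [m /andP[m0 _]] := reduce_2pi (th0 - th A).
have [S HS] := th_to_pinfty Q0 o lam_lt0 (th0 + 2 * pi * m%:~R).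
have AS : A <= Num.max A S by rewrite le_max lexx.
have SS : S <= Num.max A S by rewrite le_max lexx orbT.
have cth : continuous th by move=> s; have [_ h] := o s; exact: isd_continuous h.
have [|s] := IVT (v := th0 + 2 * pi * m%:~R) AS (continuous_subspaceT cth).
  rewrite ge_min le_max (HS _ SS) orbT andbT; apply/orP; left; lra.
by rewrite in_itv/= => /andP[As _] Hs; exists s, m.
Qed.

(** Nothing is known of the limit behaviour of the phase eta, so its values are made to
    converge on the circle by compactness. *)
Lemma orbit_subsequence (eta : R -> R) (th0 : R) :
  exists (sig : nat -> R) (m : nat -> int) (c d : R),
  [/\ forall k, k%:R <= sig k, forall k, th (sig k) = th0 + 2 * pi * (m k)%:~R,
      c ^+ 2 + d ^+ 2 = 1,
      cos (eta (sig k)) @[k --> \oo] --> c & sin (eta (sig k)) @[k --> \oo] --> d].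
Proof.
suff /(@choice _ _ (fun (k : nat) (p : R * int) => k%:R <= p.1 /\ th p.1 = th0 + 2 * pi * p.2%:~R))[p Hp] :
    forall k : nat, exists p : R * int, k%:R <= p.1 /\ th p.1 = th0 + 2 * pi * p.2%:~R.
  have bnd (u : nat -> R) : (forall k, `|u k| <= 1) -> bounded_fun u.
    move=> u1; exists 1; split; first exact: num_real.
    by move=> M M1 k _; apply: le_trans (u1 k) (ltW M1).
  have [f incf cf] := bolzano_weierstrass (bnd (fun k => cos (eta (p k).1)) (fun k => cos_max _)).
  have [g incg cg] := bolzano_weierstrass (bnd (fun k => sin (eta (p (f k)).1)) (fun k => sin_max _)).
  have inc_ge (h : nat -> nat) : {mono h : k l / (k <= l)%N >-> (k <= l)%O} -> forall k, (k <= h k)%N.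
    by move=> mh; elim=> // k IH; apply: (leq_ltn_trans IH); exact: (iffRL (increasing_seqP h) mh k).
  have sub (h : nat -> nat) : {mono h : k l / (k <= l)%N >-> (k <= l)%O} -> h k @[k --> \oo] --> \oo.
    move=> mh; apply/cvgnyPge => A; near=> k; apply: leq_trans (inc_ge _ mh k).
    by near: k; exact: nbhs_infty_ge.
  set c := lim (((fun k => cos (eta (p k).1)) \o f) k @[k --> \oo]) in cf.
  have cc : cos (eta (p (f (g k))).1) @[k --> \oo] --> c.
    exact: (@cvg_comp _ _ _ _ _ _ _ _ (sub _ incg) cf).
  set d := lim (((fun k => sin (eta (p (f k)).1)) \o g) k @[k --> \oo]) in cg.
  have cd : sin (eta (p (f (g k))).1) @[k --> \oo] --> d by exact: cg.
  exists (fun k => (p (f (g k))).1), (fun k => (p (f (g k))).2), c, d; split => //.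
  - move=> k; apply: le_trans (Hp _).1; rewrite ler_nat.
    exact: leq_trans (inc_ge _ incg k) (inc_ge _ incf _).
  - by move=> k; exact: (Hp _).2.
  - have h := cvgD (cvgM cc cc) (cvgM cd cd).
    have h1 : (fun k => cos (eta (p (f (g k))).1) * cos (eta (p (f (g k))).1) +
        sin (eta (p (f (g k))).1) * sin (eta (p (f (g k))).1)) k @[k --> \oo] --> c ^+ 2 + d ^+ 2 by exact: h.
    apply: (cvg_unique (@norm_hausdorff _ _) h1).
    rewrite (_ : (fun k => _) = (fun=> 1)); first exact: cvg_cst.
    by apply/funext => k /=; rewrite -!expr2 cos2Dsin2.
by move=> k; have [s [m [h1 h2]]] := th_recurs th0 k%:R; exists (s, m).
Unshelve. all: by end_near. Qed.

End OrbitLimits.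

Section SpiralLimit.
Context {R : realType} {n : nat}.
Local Notation M := (ucover R n).
Local Notation C := (plane R).
Implicit Types (w v z : C) (s : R).
Variables (e : 'rV[R]_n) (r0 : R).
Hypothesis e1 : dot e e = 1.
Hypothesis r00 : 0 < r0.
Let Q := r0 ^+ 2.
Variables (lam th eta : R -> R).
Hypothesis o : orbit_of Q lam th.
Hypothesis lam_lt0 : forall s, lam s < 0.

Let Q0 : 0 < Q. Proof. by rewrite exprn_gt0. Qed.
Local Notation u := (spiral e r0 lam th eta).
Local Notation form := (conformal (@Fpot R n Q) lambda0).

Lemma cvg_expR (T : Type) (F : set_system T) {FF : Filter F} (f : T -> R) (l : R) :
  f x @[x --> F] --> l -> expR (f x) @[x --> F] --> expR l.
Proof. by move=> fl; exact: (cvg_comp _ _ fl (@continuous_expR R l)). Qed.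

(** With cb, the starting point of the circle |w| = exp s. *)
Definition ca s : R := r0 * expR (lam s) * cos (eta s).
Definition cb s : R := r0 * expR (lam s) * sin (eta s).

Lemma ca_cb s : ca s * ca s + cb s * cb s = Q * expR (2 * lam s).
Proof.
rewrite /ca /cb /Q expRM_natl; have := cos2Dsin2 (eta s).
move: (cos _) (sin _) (expR _) => c d E h.
transitivity ((r0 * E) ^+ 2 * (c ^+ 2 + d ^+ 2)); first by ring.
by rewrite h mulr1 exprMn.
Qed.

Lemma circle_spiral s : circle_at u cyl s =
  loop e (th (2 * pi * s)) (ca (2 * pi * s)) (cb (2 * pi * s)).
Proof.
apply/funext => t; rewrite /circle_at /spiral /UX /UY logr_cyl /cyl /=.
have E : amp r0 lam (2 * pi * s) * expR (2 * pi * s) = r0 * expR (lam (2 * pi * s)).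
  by rewrite /amp -mulrA -expRD subrK.
rewrite /loop /ca /cb -E /al /be; congr vec3; ring.
Qed.

(** Stated for the norm of w and not for cylindrical coordinates, since the limit set
    is defined through all cylindrical coordinate systems. *)
Lemma sqrad_spiral_far (eps : R) : 0 < eps ->
  exists A, forall w, A < `|w| -> `|sqrad (u w) - Q| < eps.
Proof.
move=> eps0.
have c1 : 2 * lam s @[s --> +oo] --> (2 * 0 : R).
  by apply: cvgM; [exact: cvg_cst|exact: lam_cvg Q0 o lam_lt0].
have cq : Q * expR (2 * lam s) @[s --> +oo] --> (Q * expR (2 * 0) : R).
  by apply: cvgM; [exact: cvg_cst|exact: cvg_expR].
rewrite mulr0 expR0 mulr1 in cq.
move/cvgrPdist_lt: cq => /(_ eps eps0)[S [_ HS]].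
exists (expR S) => w wA.
have w0 : 0 < nsq w.
  have /andP[+ _] := norm_nsq w; apply: lt_le_trans.
  by rewrite exprn_gt0// (lt_trans (expR_gt0 S)).
rewrite sqrad_vec3// UXY_Q// -/Q distrC; apply: HS.
have h : expR (2 * S) < expR (2 * logr w).
  rewrite expR_logr// expRM_natl; have /andP[+ _] := norm_nsq w; apply: lt_le_trans.
  by rewrite ltr_pXn2r ?nnegrE ?expR_ge0// (ltW (lt_trans (expR_gt0 S) wA)).
by move: h; rewrite ltr_expR; lra.
Qed.

(** A limit point is a pointwise limit of points of the plane that go to the
    puncture: the complex line over e is closed, and sqrad tends to Q. *)
Lemma limit_set_sub p : limit_set form u p -> axis_torus e Q p.
Proof.
move=> [gamma [t [[_ [m per] [psi [T [s [[cy _] _ _ [_ sinf] [mk cvg]]]]]] [m' E]]]].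
suff H : forall t : R, 0 <= t <= 1 -> axis_torus e Q (gamma t).
  by have := axis_torus_loop per H t; rewrite E => /axis_torus_deck.
move=> x x01; have [_ _ _ _ far] := cy.
pose w k : C := psi (s k, x).
apply: (@axis_torus_limit _ _ e Q e1 (fun k => u (w k) + deck (mk k))
  (fun k => th (logr (w k)) + 2 * pi * (mk k)%:~R)
  (fun k => UX r0 lam eta (w k)) (fun k => UY r0 lam eta (w k))).
- by move=> k; rewrite /spiral vec3_deck.
- apply/cvgrPdist_lt => eps eps0; have := cvg 0%N eps eps0.
  apply: filterS => k /(_ x x01); rewrite !derive1n0 distrC; exact.
- apply/cvgrPdist_lt => eps eps0; have [A HA] := sqrad_spiral_far eps0.
  have [s0 Hs0] := far A.
  move/cvgryPge: sinf => /(_ s0); apply: filterS => k sk.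
  by rewrite sqrad_deck distrC; apply: HA; exact: Hs0.
Qed.

Lemma circle_form s t :
  form (circle_at u cyl s t) (derive1 (circle_at u cyl s) t) =
  2 * pi * Q * expR (ham (lam (2 * pi * s)) (th (2 * pi * s))).
Proof.
rewrite circle_spiral derive1_loop /conformal; move: (2 * pi * s) => {}s.
have := cos2Dsin2 (2 * pi * t); set c := cos _; set d := sin _ => cd.
have qE : sqrad (loop e (th s) (ca s) (cb s) t) = Q * expR (2 * lam s).
  rewrite /loop sqrad_vec3// -ca_cb -/c -/d.
  transitivity ((ca s * ca s + cb s * cb s) * (c ^+ 2 + d ^+ 2)); first by ring.
  by rewrite cd mulr1.
rewrite /Fpot qE half_ln_exp// /loop lambda0_vec3// -/c -/d /=.
transitivity (expR (pot (lam s) (th s)) *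
  (2 * pi * (ca s * ca s + cb s * cb s) * (c ^+ 2 + d ^+ 2))); first by ring.
by rewrite cd ca_cb mulr1 /ham (expRD (2 * lam s)); ring.
Qed.

(** The loops have constant speed, so the integrand is the constant
    2 pi Q exp (ham), and ham tends to 0. *)
Lemma mass_spiral : has_mass form u cyl (2 * pi * Q).
Proof.
rewrite /has_mass.
rewrite (_ : (fun s => _) =
   (fun s => 2 * pi * Q * expR (ham (lam (2 * pi * s)) (th (2 * pi * s))))); last first.
  apply/funext => s; under eq_Rintegral => t _ do rewrite circle_form.
  rewrite Rintegral_cst//= lebesgue_measure_itv/= lte_fin ltr01.
  by rewrite oppr0 adde0 mulr1.
have p0 : 0 < pi :> R := pi_gt0 R.
have inf : (fun s : R => 2 * pi * s) @ +oo --> +oo.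
  apply/cvgryPge => A; apply: filterS (nbhs_pinfty_ge (num_real (A / (2 * pi)))) => s.
  by rewrite ler_pdivrMr ?mulr_gt0// mulrC.
have hc : ham (lam (2 * pi * s)) (th (2 * pi * s)) @[s --> +oo] --> 0.
  exact: (cvg_comp _ _ inf (ham_cvg Q0 o lam_lt0)).
have hQ : 2 * pi * Q * expR (ham (lam (2 * pi * s)) (th (2 * pi * s))) @[s --> +oo]
    --> (2 * pi * Q * expR 0 : R).
  by apply: cvgM; [exact: cvg_cst|exact: cvg_expR].
by move: hQ; rewrite expR0 mulr1.
Qed.

(** On the torus F = 0, F_theta = 0 and F_l = -2. *)
Lemma loop_reeb h a b t : a * a + b * b = Q ->
  derive1 (loop e h a b) t = (2 * pi * Q) *: reeb form (loop e h a b t).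
Proof.
move=> ab; rewrite derive1_loop reebE//.
have := cos2Dsin2 (2 * pi * t); set c := cos _; set d := sin _ => cd.
have qE : sqrad (loop e h a b t) = Q.
  rewrite /loop sqrad_vec3// -ab -/c -/d.
  transitivity ((a * a + b * b) * (c ^+ 2 + d ^+ 2)); first by ring.
  by rewrite cd mulr1.
have lE : half_ln Q Q = 0 by have := half_ln_exp Q0 0; rewrite mulr0 expR0 mulr1.
have [p0 p1 p2] := pot_out (loop e h a b t).1 (lexx 0).
rewrite /reebF /Fpot /Fth /Frad qE lE p0 p1 p2 mulr0 !oppr0 expR0 scale1r.
rewrite /loop reeb_vec3// -/c -/d.
rewrite (_ : (a * c - b * d) * (a * c - b * d) + (a * d + b * c) * (a * d + b * c) = Q); last first.
  by rewrite -ab -[RHS]mulr1 -cd; ring.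
have V (k x y z : R) : k *: vec3 e x y z = vec3 e (k * x) (k * y) (k * z).
  by rewrite /vec3; congr pair; congr pair; rewrite /= scalerA.
rewrite V; congr vec3; field; rewrite ?gt_eqF//.
Qed.

(** The loop through p lies over an angle h; take times sig k at which the plane is over
    h modulo 2 pi and the phase converges. The circles of the plane at these times
    are loops whose parameters converge. *)
Lemma limit_set_sup p : axis_torus e Q p -> limit_set form u p.
Proof.
move=> [h [X [Y [XY ->]]]].
have [sig [m [c [d [sge sth cd cc cdd]]]]] := orbit_subsequence Q0 o lam_lt0 eta h.
have ab : (r0 * c) * (r0 * c) + (r0 * d) * (r0 * d) = Q.
  by rewrite -[RHS]mulr1 -cd /Q; ring.
have [t tE] := loop_hits e h ab XY Q0.
have p0 : 0 < pi :> R := pi_gt0 R.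
have p2 : 0 < 2 * pi :> R by rewrite mulr_gt0.
exists (loop e h (r0 * c) (r0 * d)), t; split; last first.
  by exists 0; rewrite tE vec3_deck mulr0z mulr0 addr0.
have siginf : sig k @[k --> \oo] --> +oo.
  apply/cvgryPge => A; near=> k; apply: le_trans (sge k).
  by near: k; exact: nbhs_infty_ger.
split; first exact: loop_smooth.
  by exists 0 => x; rewrite loop_period vec3_deck mulr0z mulr0 addr0.
exists cyl, (2 * pi * Q), (fun k => sig k / (2 * pi)); split.
- by split; [exact: cylindrical_cyl|exact: mass_spiral].
- by rewrite gt_eqF// mulr_gt0.
- by move=> x; exact: loop_reeb.
- split=> [k|]; first by rewrite divr_ge0 ?(ltW p2)// (le_trans _ (sge k)).
  apply/cvgryPge => A; move/cvgryPge: siginf => /(_ (A * (2 * pi))).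
  by apply: filterS => k; rewrite ler_pdivlMr.
exists (fun k => - m k).
have cE : expR (lam (sig k)) @[k --> \oo] --> expR (0 : R).
  by apply: cvg_expR; exact: (cvg_comp _ _ siginf (lam_cvg Q0 o lam_lt0)).
have cr : r0 * expR (lam (sig k)) @[k --> \oo] --> (r0 * expR 0 : R).
  by apply: cvgM; [exact: cvg_cst|exact: cE].
rewrite expR0 mulr1 in cr.
have ha : ca (sig k) @[k --> \oo] --> r0 * c by exact: cvgM.
have hb : cb (sig k) @[k --> \oo] --> r0 * d by exact: cvgM.
have circ k : (fun t' => circle_at u cyl (sig k / (2 * pi)) t' + deck (- m k)) =
    loop e h (ca (sig k)) (cb (sig k)).
  apply/funext => x; rewrite circle_spiral mulrC divfK ?gt_eqF// loop_deck sth.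
  by rewrite -addrA -mulrDr -intrD subrr mulr0 addr0.
move=> j eps eps0.
set K : R := 2 * (1 + `|e|) * (2 * pi) ^+ j.
have K0 : 0 < K by rewrite !mulr_gt0 ?exprn_gt0// ltr_wpDr.
have e2 : 0 < eps / (2 * K) by rewrite divr_gt0// mulr_gt0.
move/cvgrPdist_lt: ha => /(_ _ e2) ha; move/cvgrPdist_lt: hb => /(_ _ e2) hb.
near=> k => x _; rewrite circ.
apply: le_lt_trans (loop_derivn_dist e j _ _ _ _ _ _ _) _.
rewrite subrr normr0 add0r -/K.
have h1 : `|ca (sig k) - r0 * c| < eps / (2 * K) by rewrite distrC; near: k.
have h2 : `|cb (sig k) - r0 * d| < eps / (2 * K) by rewrite distrC; near: k.
rewrite mulrC -ltr_pdivlMr//; apply: lt_le_trans (ltrD h1 h2) _.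
by rewrite le_eqVlt; apply/orP; left; apply/eqP; field; rewrite gt_eqF.
Unshelve. all: by end_near. Qed.

Lemma limit_set_spiral : limit_set form u = axis_torus e Q.
Proof. by apply/seteqP; split => p; [exact: limit_set_sub|exact: limit_set_sup]. Qed.

End SpiralLimit.

(** * Planes through prescribed points *)

Section Assembly.
Context {R : realType}.

(** The orbit through (l0, t0), with time shifted so that at time 1 it has not yet
    left l <= -1. *)
Lemma orbit_through (Q l0 t0 : R) : 0 < Q -> l0 < 0 ->
  exists lam th sig, [/\ orbit_of Q lam th, forall s, lam s < 0, lam 1 <= -1,
    lam sig = l0 & th sig = t0].
Proof.
move=> Q0 l00; have [lam [th [ o E1 E2]]] := orbit_exists Q l0 t0 0.
have neg : forall s, lam s < 0 by apply: (orbit_inside o (s0 := 0)); rewrite E1.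
have [s1 Hs1] := orbit_backward Q0 o neg.
exists (fun s => lam (s + (s1 - 1))), (fun s => th (s + (s1 - 1))), (1 - s1); split.
- exact: orbit_shift.
- by move=> s; exact: neg.
- by rewrite addrC subrK.
- by rewrite (_ : 1 - s1 + (s1 - 1) = 0); [exact: E1|ring].
- by rewrite (_ : 1 - s1 + (s1 - 1) = 0); [exact: E2|ring].
Qed.

Lemma phases (r0 : R) (lam th : R -> R) : orbit_of (r0 ^+ 2) lam th ->
  exists eta b : R -> R,
    (forall s, is_derive s (1 : R) eta
       (- (r0 ^+ 2 / 2 * expR (2 * lam s) * pott (lam s) (th s)))) /\
    (forall s, is_derive s (1 : R) b
       (r0 ^+ 2 * (expR (ham (lam s) (th s)) - expR (2 * (s + (lam 1 - 1)))))).
Proof.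
move=> o.
have ceta : continuous (fun s => - (r0 ^+ 2 / 2 * expR (2 * lam s) * pott (lam s) (th s))).
  move=> s; apply: (Ck_at_cvg (k := 0)); apply: Ck_atN; apply: Ck_atM; last first.
    by have [_ h] := Ck_at_potlt o 0 s.
  by apply: Ck_atZ; apply: Ck_at_exp; apply: Ck_atZ; exact: Ck_at_lam o 0 s.
have cb : continuous (fun s => r0 ^+ 2 * (expR (ham (lam s) (th s)) - expR (2 * (s + (lam 1 - 1))))).
  move=> s; apply: (Ck_at_cvg (k := 0)); apply: Ck_atZ; apply: Ck_atB; apply: Ck_at_exp.
    exact: Ck_at_ham o 0 s.
  by apply: Ck_atZ; apply: Ck_atD; [exact: Ck_at_id|exact: Ck_at_cst].
have [eta [_ deta]] := continuous_primitive ceta.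
have [b [_ db]] := continuous_primitive cb.
by exists eta, b.
Qed.

(** Divide z by the complex number mu sig of modulus exp (lam sig - sig) r0: the quotient
    has modulus exp sig. *)
Lemma polar_preimage (r0 : R) (lam eta : R -> R) (z : R * R) (sig : R) : 0 < r0 ->
  nsq z = r0 ^+ 2 * expR (2 * lam sig) ->
  exists w : plane R, [/\ logr w = sig, UX r0 lam eta w = z.1 & UY r0 lam eta w = z.2].
Proof.
move=> r00 zE.
pose a := al r0 lam eta sig; pose b := be r0 lam eta sig.
have abE : a * a + b * b = amp r0 lam sig ^+ 2.
  have := cos2Dsin2 (eta sig); rewrite /a /b /al /be; move: (cos _) (sin _) (amp _ _ _) => c d A h.
  transitivity (A ^+ 2 * (c ^+ 2 + d ^+ 2)); first by ring.
  by rewrite h mulr1.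
have ab0 : 0 < a * a + b * b by rewrite abE exprn_gt0// mulr_gt0// expR_gt0.
pose w : plane R := ((a * z.1 + b * z.2) / (a * a + b * b), (a * z.2 - b * z.1) / (a * a + b * b)).
have wE : nsq w = nsq z / (a * a + b * b).
  by rewrite /nsq /w /=; field; rewrite gt_eqF.
have lw : logr w = sig.
  rewrite /logr wE zE abE /amp exprMn -expRM_natl.
  rewrite (_ : _ / _ = expR (2 * sig)); first by rewrite expRK mulKf ?pnatr_eq0.
  rewrite -mulf_div divff ?gt_eqF ?exprn_gt0// mul1r -expRN -expRD; congr expR; ring.
exists w; split => //; rewrite /UX /UY lw -/a -/b /w /=; field; rewrite gt_eqF.
all: by [].
Qed.

Lemma znormE (z : R * R) : znorm z ^+ 2 = nsq z.
Proof. by rewrite /znorm sqr_sqrtr ?addr_ge0 ?sqr_ge0// /nsq -!expr2. Qed.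

Lemma axis_torusE (n : nat) (hn : (0 < n)%N) (r : R) : 0 < r ->
  axis_torus (delta_mx 0 (last_ord hn)) (r ^+ 2) = torus hn r.
Proof.
move=> r_gt0; apply/seteqP; split => p.
  move=> [h [a [b [ab ->]]]]; exists h, (a, b); split => //.
  by rewrite /znorm /= !expr2 ab sqrtr_sqr gtr0_norm.
move=> [h [z [zr ->]]]; exists h, z.1, z.2; split => //.
by rewrite -zr znormE.
Qed.

End Assembly.

Theorem theorem5p2 (R : realType) (n : nat) (hn : (0 < n)%N)
    (r0 : R) (hr0 : 0 < r0) :
  exists (F : ucover R n -> R) (J : ucover R n -> ucover R n -> ucover R n),
    [/\ smooth F, deck_invariant F, compatible lambda0 J
      & forall (theta0 : R) (z : R * R), znorm z < r0 ->
        exists (a : plane R -> R) (u : plane R -> ucover R n),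
          [/\ finite_energy_plane (conformal F lambda0) J a u,
              exists w, same_point (u w) (axis_point hn theta0 z)
            & limit_set (conformal F lambda0) u = torus hn r0]].
Proof.
have Q0 : 0 < r0 ^+ 2 by rewrite exprn_gt0.
exists (Fpot (r0 ^+ 2)), Jstd; split.
- exact: smooth_Fpot.
- exact: Fpot_deck.
- exact: compatible_Jstd.
move=> theta0 z zr.
pose e : 'rV[R]_n := delta_mx 0 (last_ord hn).
have e1 : dot e e = 1.
  rewrite /dot (bigD1 (last_ord hn))//= big1 ?addr0 => [|i /negbTE ne].
    by rewrite !mxE !eqxx mulr1.
  by rewrite /e !mxE ne andbF mul0r.
have [lam [th [ o neg l1 H]]] : exists lam th, [/\ orbit_of (r0 ^+ 2) lam th,
    forall s, lam s < 0, lam 1 <= -1 &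
    forall eta, exists w, spiral e r0 lam th eta w = axis_point hn theta0 z].
  have [z0|z0] := ltP 0 (nsq z); last first.
    have {}z0 : nsq z = 0 by apply/eqP; rewrite eq_le z0 nsq_ge0.
    have [lam [th [ o E1 E2]]] := orbit_exists (r0 ^+ 2) (-1) theta0 1.
    have neg : forall s, lam s < 0 by apply: (orbit_inside o (s0 := 1)); rewrite E1 oppr_lt0.
    exists lam, th; split => //; first by rewrite E1.
    move=> eta; exists (0, 0); have [h1 h2] := nsq0 z0.
    have L0 : logr ((0, 0) : plane R) = 0 by rewrite /logr /nsq /= mulr0 addr0 ln0 ?mulr0.
    rewrite /spiral /UX /UY L0 /= !mulr0 subrr addr0 (th_start o) ?E1// E2.
    by rewrite /axis_point h1 h2.
  have l00 : half_ln (r0 ^+ 2) (nsq z) < 0.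
    rewrite /half_ln pmulr_rlt0// ln_lt0// divr_gt0//= ltr_pdivrMr// mul1r.
    by rewrite -znormE ltr_pXn2r ?nnegrE ?sqrtr_ge0// ltW.
  have [lam [th [sig [ o neg l1 E1 E2]]]] := orbit_through theta0 Q0 l00.
  exists lam, th; split => // eta.
  have [|w [lw h1 h2]] := @polar_preimage R r0 lam eta z sig hr0.
    by rewrite E1 expR_half_ln.
  by exists w; rewrite /spiral lw h1 h2 E2.
have [eta [b [deta db]]] := phases o.
exists (height r0 lam b), (spiral e r0 lam th eta); split.
- split; first exact: (spiral_pseudoholomorphic e1 hr0 o l1 deta db).
  exact: (spiral_energy e1 hr0 o neg l1 deta db).
- have [w wE] := H eta; exists w, 0; rewrite wE.
  by rewrite /deck mulr0z mulr0 addr0.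
- by rewrite limit_set_spiral// axis_torusE.
Qed.
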